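(* Let $\mathcal T_h$ be an admissible adjusted cut mesh with $h$ sufficiently small, let $T$ be a tetrahedron with a three-edge (triangular) cut, and let $r_K:\widehat K\to\Gamma\cap T$ be the triangular-patch lift. Let $\boldsymbol s=(s_1,s_2)$ be any smooth local coordinate system on $\Gamma$ with uniformly bounded derivatives, with chart $g$, and write $$r_K(\boldsymbol\xi)=g(\boldsymbol s(\boldsymbol\xi)).$$ Then for every multi-index $\boldsymbol\alpha$ with $|\boldsymbol\alpha|=n\ge1$, $$|D_{\boldsymbol\xi}^{\boldsymbol\alpha}\boldsymbol s|\le C h^{\lfloor n/2\rfloor+1}.$$ Equivalently, with derivatives taken with respect to physical coordinates $X$ on the linear triangle $K$, $$|D_X^{\boldsymbol\alpha}\boldsymbol s|\le C h^{-\lfloor (n-1)/2\rfloor}.$$ Here $C$ is independent of $h$ and of the position of the cut.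
   Context: Setting. $U\subset\mathbb R^3$ is a fixed polygonal (polyhedral) bulk domain, $\Gamma=\{x\in U:F(x)=0\}$ is a smooth closed connected surface, $F\in C^{m+2}(U)$, and $\nabla F\neq 0$ on a tubular neighborhood of $\Gamma$; the derivative orders $n$ considered satisfy $n\le m$, and $C$ may depend on $n$. $d$ is the signed distance function to $\Gamma$. $\mathcal T_h$ is a tetrahedral mesh with mesh size $h=\max_{T\in\mathcal T_h}\operatorname{diam}(T)$; one considers a family of such meshes as $h\to0$. Constants are independent of $h$ and of the particular cut tetrahedron. Admissible adjusted cut mesh: for all sufficiently small $h$, (i) $\mathcal T_h$ is uniformly shape regular; (ii) no vertex lies on $\Gamma$, and every vertex $A$ of a cut tetrahedron (one intersected by $\Gamma$) satisfies $|d(A)|\ge\eta h$ for a fixed $\eta>0$; (iii) if $A_i,A_j$ are two vertices of a tetrahedron then $|d(A_i)|-|d(A_j)|=O(h^2)$. Three-edge cut: $T=\operatorname{conv}\{x_0,x_1,x_2,x_3\}$ and exactly one vertex, $x_0$, has a sign of $F$ different from the other three. $B_i$ is the unique intersection of $\Gamma$ with the edge $x_0x_i$, $i=1,2,3$, and $K=\operatorname{conv}\{B_1,B_2,B_3\}$ is the linear triangle. $X=X_K(\boldsymbol\xi)$ is the affine map from the reference triangle $\widehat K\subset\mathbb R^2$ onto $K$. For $X\in K$, $\Phi_T(X)$ is the unique point of $\Gamma$ in $T$ on the ray starting at $x_0$ and passing through $X$; the triangular-patch lift is $r_K=\Phi_T\circ X_K$. Physical coordinates on $K$ are Cartesian coordinates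 in the plane of $K$, and $\boldsymbol s$ is viewed as a function of $X=X_K(\boldsymbol\xi)$ in the second estimate. *)

(* Defs.v *)
From HB Require Import structures.
From mathcomp Require Import all_boot all_order all_algebra all_fingroup.
From mathcomp Require Import all_classical all_reals all_analysis.

Set Implicit Arguments.
Unset Strict Implicit.
Unset Printing Implicit Defensive.

Import Order.TTheory GRing.Theory Num.Theory.
Import numFieldNormedType.Exports.

Local Open Scope classical_set_scope.
Local Open Scope ring_scope.

(* Points of R^p are row vectors.  The library norm on 'rV[R]_p is the max
   norm (it is only used here for the topology and for derivatives); all
   lengths below are Euclidean. *)
Definition enorm (R : realType) (p : nat) (v : 'rV[R]_p) : R :=
  Num.sqrt (\sum_(j < p) v 0 j ^+ 2).

Definition diam (R : realType) (p : nat) (A : set 'rV[R]_p) : R :=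
  sup [set r | exists x y, [/\ A x, A y & r = enorm (x - y)]].

Definition dist (R : realType) (p : nat) (A : set 'rV[R]_p) (x : 'rV[R]_p) : R :=
  inf [set enorm (x - y) | y in A].

(** Partial derivatives and classes C^k *)

Definition partial (R : realType) (p : nat) (W : normedModType R) (j : 'I_p)
    (f : 'rV[R]_p -> W) : 'rV[R]_p -> W :=
  fun x => 'D_(delta_mx 0 j) f x.

Fixpoint Ck (R : realType) (p : nat) (W : normedModType R) (k : nat)
    (V : set 'rV[R]_p) (f : 'rV[R]_p -> W) : Prop :=
  match k with
  | 0 => forall x, V x -> {for x, continuous f}
  | k'.+1 =>
      (forall x, V x -> {for x, continuous f}) /\
      (forall j : 'I_p, (forall x, V x -> derivable f x (delta_mx 0 j)) /\
                        Ck k' V (partial j f))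
  end.

Definition mlen (p : nat) (alpha : 'I_p -> nat) : nat := \sum_(j < p) alpha j.

Definition mderive (R : realType) (p : nat) (W : normedModType R)
    (alpha : 'I_p -> nat) (f : 'rV[R]_p -> W) : 'rV[R]_p -> W :=
  foldr (fun j h => iter (alpha j) (partial j) h) f (enum 'I_p).

(* [l] is the value at the point x of the closed set D (a triangle) of the
   derivative D^alpha f: f is of class C^|alpha| in the interior of D and l is
   the limit at x of D^alpha f taken from the interior.  For x in the interior
   this is D^alpha f x; on the boundary it is the usual meaning of derivatives
   of a function defined only on D. *)
Definition has_mderive (R : realType) (p : nat) (W : normedModType R)
    (D : set 'rV[R]_p) (alpha : 'I_p -> nat) (f : 'rV[R]_p -> W)
    (x : 'rV[R]_p) (l : W) : Prop :=
  Ck (mlen alpha) D° f /\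
  mderive alpha f y @[y --> within D° (nbhs x)] --> l.

(** Simplices, given by the matrix whose rows are their vertices *)

Definition std_simplex (R : realType) (k : nat) : set 'rV[R]_k :=
  [set a | (forall i, 0 <= a 0 i) /\ \sum_(i < k) a 0 i = 1].

Definition hull (R : realType) (k p : nat) (P : 'M[R]_(k, p)) : set 'rV[R]_p :=
  [set a *m P | a in @std_simplex R k].

Definition segment (R : realType) (p : nat) (x y : 'rV[R]_p) : set 'rV[R]_p :=
  [set (1 - t) *: x + t *: y | t in `[0, 1]%classic].

Definition ray (R : realType) (p : nat) (x y : 'rV[R]_p) : set 'rV[R]_p :=
  [set x + t *: (y - x) | t in [set t : R | 0 <= t]].

Definition nondegenerate (R : realType) (T : 'M[R]_(4, 3)) : Prop :=
  row_free (\matrix_(i < 3) (row (lift ord0 i) T - row ord0 T)).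

Definition inball_diam (R : realType) (T : 'M[R]_(4, 3)) : R :=
  sup [set 2 * r | r in [set r : R | 0 <= r /\
    exists c, [set y | enorm (y - c) <= r] `<=` hull T]].

Definition shape_regular (R : realType) (kappa : R) (T : 'M[R]_(4, 3)) : Prop :=
  diam (hull T) <= kappa * inball_diam T.

(** The domain, the surface and the signed distance *)

Definition polyhedral_domain (R : realType) (U : set 'rV[R]_3) : Prop :=
  [/\ open U, connected U, U !=set0 &
      exists P : seq 'M[R]_(4, 3),
        closure U = [set x | exists2 T, T \in P & hull T x]].

Definition zero_set (R : realType) (U : set 'rV[R]_3) (F : 'rV[R]_3 -> R) :
    set 'rV[R]_3 := [set x | U x /\ F x = 0].

(* "closed" is compact without boundary; absence of boundary and regularity
   of the surface come from the gradient condition. *)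
Definition surface_setting (R : realType) (m : nat) (U : set 'rV[R]_3)
    (F : 'rV[R]_3 -> R) : Prop :=
  let Gamma := zero_set U F in
  [/\ polyhedral_domain U,
      Ck m.+2 U F,
      [/\ Gamma !=set0, compact Gamma & connected Gamma] &
      exists2 e : R, 0 < e & forall x, dist Gamma x < e ->
        U x /\ exists j : 'I_3, partial j F x != 0].

Definition signed_dist (R : realType) (U : set 'rV[R]_3) (F : 'rV[R]_3 -> R)
    (x : 'rV[R]_3) : R :=
  let Gamma := zero_set U F in
  if F x < 0 then - dist Gamma x else dist Gamma x.

(** Meshes *)

Definition is_vertex (R : realType) (A : 'rV[R]_3) (T : 'M[R]_(4, 3)) : Prop :=
  exists i, A = row i T.

(* Conforming tetrahedral mesh of U: two tetrahedra meet in the face (possibly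
   empty) spanned by their common vertices. *)
Definition tetra_mesh (R : realType) (U : set 'rV[R]_3)
    (Th : seq 'M[R]_(4, 3)) : Prop :=
  [/\ forall T, T \in Th -> nondegenerate T,
      closure U = [set x | exists2 T, T \in Th & hull T x] &
      forall T T', T \in Th -> T' \in Th ->
        hull T `&` hull T' =
        [set a *m T | a in [set a | @std_simplex R 4 a /\
           forall i, a 0 i != 0 -> is_vertex (row i T) T']]].

Definition mesh_size (R : realType) (Th : seq 'M[R]_(4, 3)) : R :=
  \big[Num.max/0]_(T <- Th) diam (hull T).

Definition is_cut (R : realType) (Gamma : set 'rV[R]_3) (T : 'M[R]_(4, 3)) :
    Prop := (Gamma `&` hull T) !=set0.

(* A family of meshes is a set of meshes.  The condition relating the
   distances of two vertices is imposed on cut tetrahedra: on a shape regular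
   tetrahedron that is not cut it cannot hold for small h. *)
Definition admissible_family (R : realType) (U : set 'rV[R]_3)
    (F : 'rV[R]_3 -> R) (Fam : set (seq 'M[R]_(4, 3))) : Prop :=
  let Gamma := zero_set U F in
  let d := signed_dist U F in
  (forall Th, Fam Th -> tetra_mesh U Th) /\
  exists h1 kappa eta c : R, [/\ 0 < h1, 0 < eta &
    forall Th, Fam Th -> mesh_size Th < h1 ->
    let h := mesh_size Th in
    [/\ forall T, T \in Th -> shape_regular kappa T,
        forall T i, T \in Th -> ~ Gamma (row i T),
        forall T i, T \in Th -> is_cut Gamma T -> eta * h <= `|d (row i T)| &
        forall T i j, T \in Th -> is_cut Gamma T ->
          `| `|d (row i T)| - `|d (row j T)| | <= c * h ^+ 2]].

(** Three-edge cuts and the triangular-patch lift; the vertices of the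
    tetrahedron are numbered so that row 0 is the isolated vertex. *)

Definition three_edge_cut (R : realType) (U : set 'rV[R]_3)
    (F : 'rV[R]_3 -> R) (X : 'M[R]_(4, 3)) : Prop :=
  is_cut (zero_set U F) X /\
  forall i : 'I_3, F (row ord0 X) * F (row (lift ord0 i) X) < 0.

Definition cut_point (R : realType) (Gamma : set 'rV[R]_3) (X : 'M[R]_(4, 3))
    (i : 'I_3) : 'rV[R]_3 :=
  get (Gamma `&` segment (row ord0 X) (row (lift ord0 i) X)).

Definition cut_triangle (R : realType) (Gamma : set 'rV[R]_3)
    (X : 'M[R]_(4, 3)) : 'M[R]_3 :=
  \matrix_(i < 3) cut_point Gamma X i.

Definition ref_triangle (R : realType) : set 'rV[R]_2 :=
  [set xi | [/\ 0 <= xi 0 0, 0 <= xi 0 1 & xi 0 0 + xi 0 1 <= 1]].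

Definition affine_param (R : realType) (B : 'M[R]_3) (xi : 'rV[R]_2) :
    'rV[R]_3 :=
  row 0 B + xi 0 0 *: (row 1 B - row 0 B) + xi 0 1 *: (row 2%:R B - row 0 B).

Definition radial_lift (R : realType) (Gamma : set 'rV[R]_3)
    (X : 'M[R]_(4, 3)) (x : 'rV[R]_3) : 'rV[R]_3 :=
  get (Gamma `&` hull X `&` ray (row ord0 X) x).

Definition patch_lift (R : realType) (Gamma : set 'rV[R]_3)
    (X : 'M[R]_(4, 3)) (xi : 'rV[R]_2) : 'rV[R]_3 :=
  radial_lift Gamma X (affine_param (cut_triangle Gamma X) xi).

(** Coordinates *)

(* A chart of class C^k of Gamma whose derivatives up to order k, and the
   first derivative of whose inverse, are bounded by M (together these bound
   the derivatives of the inverse up to order k). *)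
Definition local_coordinates (R : realType) (Gamma : set 'rV[R]_3) (k : nat)
    (M : R) (V : set 'rV[R]_2) (g : 'rV[R]_2 -> 'rV[R]_3) : Prop :=
  [/\ open V /\ Ck k V g,
      {in V &, injective g} /\ g @` V `<=` Gamma,
      forall W, open W -> W `<=` V ->
        exists2 O, open O & g @` W = O `&` Gamma,
      forall (alpha : 'I_2 -> nat) s, (1 <= mlen alpha <= k)%N -> V s ->
        enorm (mderive alpha g s) <= M &
      forall (s v : 'rV[R]_2), V s -> enorm v <= M * enorm ('D_v g s)].

(* y |-> p + y *m Q is a Cartesian coordinate system of the plane of the
   triangle B. *)
Definition cartesian_frame (R : realType) (B : 'M[R]_3) (p : 'rV[R]_3)
    (Q : 'M[R]_(2, 3)) : Prop :=
  Q *m Q^T = 1%:M /\ forall i, exists y : 'rV[R]_2, row i B = p + y *m Q.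

(* Main.v *)
Require Import Defs.
From HB Require Import structures.
From mathcomp Require Import all_boot all_order all_algebra all_fingroup.
From mathcomp Require Import all_classical all_reals all_analysis.
From mathcomp Require Import ring lra zify.

(** Write the lift as r = x0 + t v, where v(xi) is the affine vector from the
   isolated vertex x0 to the point of K with parameter xi and t is the radial
   parameter.  Differentiating F(r) = 0 gives

     (d_j t) W = - t N_j,   W = grad F(r) . v,   N_j = grad F(r) . d_j v.

   Two facts of geometry drive the proof.  The vertices stay at distance at
   least eta h from the surface, so |F| >= c h there ([level_ge_dist]); since
   F vanishes at the vertices of K, the rays from x0 are transversal,
   |W| >= c h ([ray_slope]).  The edges of K join two zeros of F, so that
   N_j = O(h^2) and not only O(h) ([edge_slope]).

   Say that f has grade s if |D^n f| <= C h^ceil((s + n)/2) for every n.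
   Differentiation raises the grade by one, grades add up in products
   ([graded_mul]), and division by a function of grade 2a and of exact order
   h^a lowers the grade by 2a ([graded_div]).  The affine vector v has grade 1
   and d_j v has grade 2.  As soon as t has grade 0, the point r has
   derivatives d_j r of grade 2, and so has grad F(r) ([graded_comp]); then N_j
   has grade 3, W has grade 2, and d_j t = - t N_j / W has grade 1.  This is
   grade 0 for t again, with one more derivative: t has grade 0 to every order
   ([radial_parameter_cls]).

   In a chart g one has d_j r = Dg(s) d_j s.  The Gram matrix of Dg is
   uniformly invertible ([gram_det_ge]), and Cramer's rule gives d_j s the grade
   of d_j r, which is 2 ([chart_coordinates_gcls]): hence
   |D^n s| <= C h^ceil((n + 1)/2) = C h^(floor(n/2) + 1).

   For the second estimate, shape regularity provides a ball of radius c h in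
   the tetrahedron, so the parametrization of K expands lengths by a factor at
   least c h ([edge_mx_expand]).  Each derivative in physical coordinates costs
   a factor 1/h, and n - (floor(n/2) + 1) = floor((n - 1)/2).

   Uniformity of the constants is built into the statements: functions come in
   families indexed by the type of all configurations, and a bound is one
   constant for the whole family ([cls], [gcls]).  These classes also carry the
   existence of limits at the boundary of the triangle, where the derivatives
   of s are defined as limits from the interior.  Smoothness is expressed by
   partial derivatives only, so mean values are taken along paths with axis
   parallel edges ([mvt_box]); they yield slopes in the sense of Caratheodory,
   from which the chain rule and both implicit differentiations follow. *)

Set Implicit Arguments.
Unset Strict Implicit.
Unset Printing Implicit Defensive.

Import Order.TTheory GRing.Theory Num.Theory.
Import numFieldNormedType.Exports.

Local Open Scope classical_set_scope.
Local Open Scope ring_scope.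

(** * Sup norm, mean values and slopes *)

Section Sup_norm.
Variables (R : realType) (p : nat).
Implicit Types (x y : 'rV[R]_p) (e : R).

Lemma rV_norm_le x e : 0 <= e -> (forall k, `|x 0 k| <= e) -> `|x| <= e.
Proof.
move=> e0 xe; rewrite [leLHS]/Num.Def.normr /= mx_normrE.
by apply: bigmax_le => // -[i j] _ /=; rewrite (ord1 i).
Qed.

Lemma rV_coord_le x k : `|x 0 k| <= `|x|.
Proof.
rewrite [leRHS]/Num.Def.normr /= mx_normrE.
exact: (le_bigmax _ (fun i : 'I_1 * 'I_p => `|x i.1 i.2|) (0, k)).
Qed.

Lemma delta_norm (j : 'I_p) : `|delta_mx 0 j : 'rV[R]_p| = 1.
Proof.
apply/eqP; rewrite eq_le; apply/andP; split.
  apply: rV_norm_le => // k; rewrite mxE eqxx /=.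
  by case: eqP => _; rewrite ?normr1 ?normr0.
by have := rV_coord_le (delta_mx 0 j) j; rewrite mxE !eqxx normr1.
Qed.

Lemma cvg_rV (T : Type) (G : set_system T) (FG : Filter G)
    (c : T -> 'rV[R]_p) x :
  (forall k, (fun t => c t 0 k) @ G --> x 0 k) <-> c @ G --> x.
Proof.
split=> [cx|cx k].
  apply/cvgrPdist_le => e e0; near=> t.
  apply: rV_norm_le (ltW e0) _ => k.
  rewrite !mxE; move: k; near: t; apply: filter_forall => k.
  exact: ((cvgrPdist_le _ _).1 (cx k) e e0).
apply: (@continuous_cvg _ _ _ G FG c (fun M : 'rV[R]_p => M 0 k) x _ cx).
exact: coord_continuous.
Unshelve. all: by end_near. Qed.

End Sup_norm.

Section Mean_value.
Variables (R : realType) (p : nat).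
Implicit Types (x y z : 'rV[R]_p) (f : 'rV[R]_p -> R).

Lemma is_derive_line f x v (t : R) : derivable f (t *: v + x) v ->
  is_derive t (1 : R) (fun t => f (t *: v + x)) ('D_v f (t *: v + x)).
Proof.
have E : (fun h : R => h^-1 *: (f ((h *: 1 + t) *: v + x) - f (t *: v + x))) =
         (fun h => h^-1 *: (f (h *: v + (t *: v + x)) - f (t *: v + x))).
  by apply/funext => h; rewrite scalerDl [h *: 1]mulr1 addrA.
by move=> df; apply: DeriveDef; rewrite /derivable /derive E.
Qed.

Lemma mvt_line f x j (a : R) :
  (forall t, `|t| <= `|a| -> derivable f (t *: delta_mx 0 j + x) (delta_mx 0 j)) ->
  exists2 t : R, `|t| <= `|a| &
    f (a *: delta_mx 0 j + x) - f x = partial j f (t *: delta_mx 0 j + x) * a.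
Proof.
move=> df; set e := delta_mx 0 j : 'rV[R]_p.
pose g t := f (t *: e + x); pose dg t := 'D_e f (t *: e + x).
have dgP t : `|t| <= `|a| -> is_derive t (1 : R) g (dg t).
  by move=> ta; apply: is_derive_line; exact: df.
have cg b c : (forall t, t \in `[b, c] -> `|t| <= `|a|) ->
    {within `[b, c], continuous g}.
  move=> bca; apply: derivable_within_continuous => t /bca ta.
  by case: (dgP t ta).
have g0 : g 0 = f x by rewrite /g scale0r add0r.
have [a0|a0] := leP 0 a.
  have inI t : t \in `[0, a] -> `|t| <= `|a|.
    by rewrite in_itv /= => /andP[t0 ta]; rewrite !ger0_norm.
  have [||c cI E] := @MVT_segment R g dg 0 a a0; last 1 first.
  - by exists c; [exact: inI|rewrite -g0 -/(g a) E subr0].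
  - by move=> t tI; apply: dgP; apply: inI; apply: subset_itv_oo_cc tI.
  - exact: cg inI.
have inI t : t \in `[a, 0] -> `|t| <= `|a|.
  by rewrite in_itv /= => /andP[ta t0]; rewrite !ler0_norm ?lerN2 // ltW.
have [||c cI E] := @MVT_segment R g dg a 0 (ltW a0); last 1 first.
- exists c; first exact: inI.
  by rewrite -g0 -/(g a) -opprB E sub0r mulrN opprK.
- by move=> t tI; apply: dgP; apply: inI; apply: subset_itv_oo_cc tI.
- exact: cg inI.
Qed.

(** Moving from x to y one coordinate at a time gives a mean value formula
   that uses the derivatives along the axes only; each partial derivative is
   taken at a point of its own, inside the sup-norm ball centred at x through
   y. *)
Lemma mvt_box f x y :
  (forall z k, `|z - x| <= `|y - x| -> derivable f z (delta_mx 0 k)) ->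
  exists z : 'I_p -> 'rV[R]_p, (forall k, `|z k - x| <= `|y - x|) /\
    f y - f x = \sum_k partial k f (z k) * (y 0 k - x 0 k).
Proof.
move=> df.
(* The k-th corner of the path: the first k coordinates are those of y. *)
pose w (k : nat) : 'rV[R]_p := \row_j (if (j < k)%N then y 0 j else x 0 j).
have wS (k : 'I_p) : w k.+1 = (y 0 k - x 0 k) *: delta_mx 0 k + w k.
  apply/rowP => j; rewrite !mxE eqxx /= ltnS leq_eqVlt.
  case: (eqVneq j k) => [->|jk]; first by rewrite eqxx /= ltnn mulr1 subrK.
  by rewrite mulr0 add0r -(inj_eq val_inj) /= in jk *; rewrite (negPf jk).
have wbox (k : 'I_p) t : `|t| <= `|y 0 k - x 0 k| ->
    `|t *: delta_mx 0 k + w k - x| <= `|y - x|.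
  move=> tk; apply: rV_norm_le => // j; rewrite !mxE eqxx /=.
  have jle : `|y 0 j - x 0 j| <= `|y - x|.
    by have := rV_coord_le (y - x) j; rewrite !mxE.
  case: (eqVneq j k) => [->|jk].
    rewrite ltnn mulr1 addrK (le_trans tk) //.
    by have := rV_coord_le (y - x) k; rewrite !mxE.
  by rewrite mulr0 add0r; case: ifP => _ //; rewrite subrr normr0.
have step (k : 'I_p) : exists z, `|z - x| <= `|y - x| /\
    f (w k.+1) - f (w k) = partial k f z * (y 0 k - x 0 k).
  have [t tk|t tk E] := @mvt_line f (w k) k (y 0 k - x 0 k).
    by apply: df; exact: wbox.
  by exists (t *: delta_mx 0 k + w k); split; [exact: wbox|rewrite wS E].
have [z zP] := choice step; exists z; split; first by move=> k; case: (zP k).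
transitivity (\sum_(k < p) (f (w k.+1) - f (w k))); last first.
  by apply: eq_bigr => k _; case: (zP k).
rewrite -(big_mkord xpredT (fun k => f (w k.+1) - f (w k))) telescope_sumr //.
congr (f _ - f _); apply/rowP => j; rewrite mxE ?ltn_ord //.
Qed.

(** Caratheodory's form of differentiability: the slopes A k are partial
   derivatives at the intermediate points of [mvt_box], hence converge to
   those at a. An exact identity with convergent coefficients makes the chain
   rule and implicit differentiation passages to the limit, without remainder
   terms. *)
Lemma caratheodory_slope f a :
  (\forall z \near a, forall k, derivable f z (delta_mx 0 k)) ->
  (forall k, {for a, continuous (partial k f)}) ->
  exists A : 'I_p -> 'rV[R]_p -> R,
    (forall k, A k y @[y --> a] --> partial k f a) /\
    \forall y \near a, f y - f a = \sum_k A k y * (y 0 k - a 0 k).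
Proof.
move=> /nbhs_ballP[e /= e0 df] cf.
have ball_mvt y : exists z : 'I_p -> 'rV[R]_p, `|y - a| < e ->
    (forall k, `|z k - a| <= `|y - a|) /\
    f y - f a = \sum_k partial k f (z k) * (y 0 k - a 0 k).
  have [ye|] := boolP (`|y - a| < e); last by exists (fun=> 0).
  have [z k zy|z zP] := @mvt_box f a y; last by exists z.
  apply: df; rewrite -ball_normE /ball_ /= distrC.
  exact: le_lt_trans zy ye.
have [z zP] := choice ball_mvt.
have near_e : \forall y \near a, `|y - a| < e.
  by apply/nbhs_ballP; exists e => // y; rewrite -ball_normE /ball_ /= distrC.
exists (fun k y => partial k f (z y k)); split; last first.
  by near=> y; apply: (zP y _).2; near: y.
move=> k; apply: (@continuous_cvg _ _ _ (nbhs a) _ (z^~ k) (partial k f) a (cf k)).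
apply/cvgrPdist_lt => d d0; near=> y.
have ye : `|y - a| < e by near: y.
rewrite distrC; apply: le_lt_trans ((zP y ye).1 k) _.
near: y; apply/nbhs_ballP; exists d => // y.
by rewrite -ball_normE /ball_ /= distrC.
Unshelve. all: by end_near. Qed.

End Mean_value.

(** * Chain rule and symmetry of mixed derivatives *)

Lemma cvg_sum_ord (R : realType) (T : Type) (G : set_system T) (FG : Filter G)
    q (f : 'I_q -> T -> R) (l : 'I_q -> R) :
  (forall k, f k t @[t --> G] --> l k) ->
  (\sum_k f k t) @[t --> G] --> \sum_k l k.
Proof.
move=> fl; apply: (@cvg_big _ _ +%R 0 xpredT) => //.
exact: add_continuous.
Qed.

Section Chain_rule.
Variables (R : realType) (p q : nat).

Lemma derivable_line_cvg (f : 'rV[R]_p -> R) x v :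
  derivable f x v -> f (h *: v + x) @[h --> 0^'] --> f x.
Proof.
move=> /derivable1P /derivable1_diffP /differentiable_continuous cf.
apply: cvg_within_filter.
by move: cf; rewrite /prop_for /continuous_at /= scale0r add0r.
Qed.

Lemma derivable_cvg (f : 'rV[R]_p -> R) x v : derivable f x v ->
  h^-1 * (f (h *: v + x) - f x) @[h --> 0^'] --> 'D_v f x.
Proof. by []. Qed.

(** Continuous partial derivatives of the outer function suffice; the inner
   function need only have a derivative in the direction v. *)
Lemma is_derive_chain (phi : 'rV[R]_q -> R) (r : 'rV[R]_p -> 'rV[R]_q) x v :
  (\forall z \near r x, forall k, derivable phi z (delta_mx 0 k)) ->
  (forall k, {for r x, continuous (partial k phi)}) ->
  (forall k, derivable (fun y => r y 0 k) x v) ->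
  is_derive x v (phi \o r)
    (\sum_k partial k phi (r x) * 'D_v (fun y => r y 0 k) x).
Proof.
move=> dphi cphi dr.
have [A [Acvg Aeq]] := caratheodory_slope dphi cphi.
have rx : r (h *: v + x) @[h --> 0^'] --> r x.
  by apply/cvg_rV => k; exact: derivable_line_cvg (dr k).
have Q : h^-1 *: (phi (r (h *: v + x)) - phi (r x)) @[h --> 0^'] -->
    \sum_k partial k phi (r x) * 'D_v (fun y => r y 0 k) x.
  apply: cvg_trans (@cvg_sum_ord R R 0^' _ q
      (fun k h => A k (r (h *: v + x)) * (h^-1 *: (r (h *: v + x) 0 k - r x 0 k)))
      (fun k => partial k phi (r x) * 'D_v (fun y => r y 0 k) x) _); last first.
    by move=> k; apply: cvgM; [exact: cvg_comp rx (Acvg k)|exact: dr k].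
  apply: near_eq_cvg; near=> h => /=.
  have -> : phi (r (h *: v + x)) - phi (r x) =
      \sum_k A k (r (h *: v + x)) * (r (h *: v + x) 0 k - r x 0 k).
    by near: h; exact: rx _ Aeq.
  by rewrite scaler_sumr; apply: eq_bigr => k _; rewrite /= mulrCA.
by apply: DeriveDef; [apply: cvgP Q|apply: cvg_lim Q].
Unshelve. all: by end_near. Qed.

End Chain_rule.

Section Schwarz.
Variables (R : realType) (p : nat).
Implicit Types (x y z : 'rV[R]_p) (f : 'rV[R]_p -> R) (i j : 'I_p).

Lemma subr_swap (A B C D : R) : A - B - (C - D) = A - C - (B - D).
Proof. by lra. Qed.

Lemma dist_lt_half (A B C e : R) :
  `|A - C| < e / 2 -> `|B - C| < e / 2 -> `|A - B| <= e.
Proof. by rewrite ler_norml !ltr_norml; lra. Qed.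

(** The mean value theorem applied to the increment in direction j, as a
   function of the coordinate i, and then to the partial derivative i along
   direction j. *)
Lemma second_difference f x i j (a : R) : 0 < a ->
  (forall z, `|z - x| <= 2 * a ->
    derivable f z (delta_mx 0 i) /\ derivable (partial i f) z (delta_mx 0 j)) ->
  exists2 z, `|z - x| <= 2 * a &
    f (a *: delta_mx 0 j + (a *: delta_mx 0 i + x)) - f (a *: delta_mx 0 i + x)
      - (f (a *: delta_mx 0 j + x) - f x) = partial j (partial i f) z * a * a.
Proof.
move=> a0 df; set ei := delta_mx 0 i : 'rV[R]_p; set ej := delta_mx 0 j : 'rV[R]_p.
have shiftE c z : (fun h : R => h^-1 *: (f (c + (h *: ei + z)) - f (c + z))) =
    (fun h => h^-1 *: (f (h *: ei + (c + z)) - f (c + z))).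
  by apply/funext => h; rewrite addrCA.
have dshift c z : derivable f (c + z) ei -> derivable (fun y => f (c + y)) z ei.
  by rewrite /derivable shiftE.
have Dshift c z : 'D_ei (fun y => f (c + y)) z = partial i f (c + z).
  by rewrite /partial /derive shiftE.
have nle (t : R) k : `|t| <= a -> `|t *: delta_mx 0 k : 'rV[R]_p| <= a.
  by move=> ta; rewrite normrZ delta_norm mulr1.
have twoa : a + a = 2 * a by rewrite mulr_natl mulr2n.
have box1 t : `|t| <= a -> `|t *: ei + x - x| <= 2 * a.
  by move=> ta; rewrite addrK -twoa -[leLHS]addr0 lerD ?nle // ltW.
have box2 s t : `|s| <= a -> `|t| <= a -> `|s *: ej + (t *: ei + x) - x| <= 2 * a.
  move=> sa ta; rewrite addrA addrK -twoa.
  by rewrite (le_trans (ler_normD _ _)) // lerD ?nle.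
have aa : `|a| <= a by rewrite gtr0_norm.
pose u y := f (a *: ej + y) - f y.
have du t : `|t| <= `|a| -> derivable u (t *: ei + x) ei.
  rewrite (gtr0_norm a0) => ta; apply: derivableB.
    by apply: dshift; have [d1 _] := df _ (box2 a t aa ta).
  by have [d1 _] := df _ (box1 t ta).
have [t ta uE] := mvt_line du.
rewrite (gtr0_norm a0) in ta.
have DuE : partial i u (t *: ei + x) =
    partial i f (a *: ej + (t *: ei + x)) - partial i f (t *: ei + x).
  rewrite /partial deriveB -/ei.
  - by rewrite Dshift.
  - by apply: dshift; have [d1 _] := df _ (box2 a t aa ta).
  - by have [d1 _] := df _ (box1 t ta).
have [s|s sa vE] := @mvt_line R p (partial i f) (t *: ei + x) j a.
  by rewrite (gtr0_norm a0) => sa; have [_ d2] := df _ (box2 s t sa ta).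
rewrite (gtr0_norm a0) in sa.
exists (s *: ej + (t *: ei + x)); first exact: box2.
by rewrite -[LHS]/(u (a *: ei + x) - u x) uE DuE vE.
Qed.

(** Both mixed derivatives are close to values at which the two orders of
   taking the second difference agree, because that difference is symmetric in
   i and j. *)
Lemma schwarz f x i j :
  (\forall z \near x, [/\ derivable f z (delta_mx 0 i),
     derivable f z (delta_mx 0 j), derivable (partial i f) z (delta_mx 0 j) &
     derivable (partial j f) z (delta_mx 0 i)]) ->
  {for x, continuous (partial j (partial i f))} ->
  {for x, continuous (partial i (partial j f))} ->
  partial j (partial i f) x = partial i (partial j f) x.
Proof.
move=> df cji cij; apply/eqP; rewrite -subr_eq0 -normr_eq0.
rewrite eq_le normr_ge0 andbT; apply/ler_addgt0Pl => e e0.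
rewrite addr0.
have e20 : 0 < e / 2 by rewrite divr_gt0.
have : \forall z \near x,
    [/\ derivable f z (delta_mx 0 i), derivable f z (delta_mx 0 j),
        derivable (partial i f) z (delta_mx 0 j) &
        derivable (partial j f) z (delta_mx 0 i)] /\
    (`|partial j (partial i f) x - partial j (partial i f) z| < e / 2 /\
     `|partial i (partial j f) x - partial i (partial j f) z| < e / 2).
  apply: filterI; first exact: df.
  by apply: filterI; [exact: ((cvgrPdist_lt _ _).1 cji _ e20)
                     |exact: ((cvgrPdist_lt _ _).1 cij _ e20)].
move=> /nbhs_ballP[d /= d0 dP].
pose a := d / 4.
have a0 : 0 < a by rewrite divr_gt0.
have boxP z : `|z - x| <= 2 * a -> ball x d z.
  rewrite -ball_normE /ball_ /= distrC => /le_lt_trans; apply.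
  by rewrite /a; lra.
have [z|z zx Ez] := @second_difference f x i j a a0.
  by move=> /boxP /dP [[]].
have [w|w wx Ew] := @second_difference f x j i a a0.
  by move=> /boxP /dP [[]].
have aN0 : a != 0 by rewrite gt_eqF.
have E : partial j (partial i f) z = partial i (partial j f) w.
  apply/(mulIf aN0)/(mulIf aN0); apply: etrans (esym Ez) _; apply: etrans _ Ew.
  by rewrite (addrCA (a *: delta_mx 0 i) (a *: delta_mx 0 j) x); exact: subr_swap.
have [_ [zE _]] := dP _ (boxP _ zx); have [_ [_ wE]] := dP _ (boxP _ wx).
by rewrite E in zE; exact: dist_lt_half zE wE.
Unshelve. all: by end_near. Qed.

End Schwarz.

Opaque derive.
Arguments Ck : simpl never.

(** * Higher derivatives as words *)

Section Words.
Variables (R : realType) (p : nat) (W : normedModType R).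
Implicit Types (f g : 'rV[R]_p -> W) (V : set 'rV[R]_p) (w : seq 'I_p).

(** Words of indices instead of multi-indices: a mixed derivative taken in a
   prescribed order, the last letter first, so that induction can peel off
   either end. *)
Definition dword w f := foldr (fun j h => partial j h) f w.

Lemma eq_partial V f g j : open V -> (forall x, V x -> f x = g x) ->
  forall x, V x -> partial j f x = partial j g x.
Proof.
move=> oV fg x Vx; apply: near_eq_derive.
by near=> y; apply: fg; near: y; exact: open_nbhs_nbhs.
Unshelve. all: by end_near. Qed.

Lemma eq_derivable V f g v : open V -> (forall x, V x -> f x = g x) ->
  forall x, V x -> derivable f x v -> derivable g x v.
Proof.
move=> oV fg x Vx; apply: near_eq_derivable.
by near=> y; apply: fg; near: y; exact: open_nbhs_nbhs.
Unshelve. all: by end_near. Qed.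

Lemma eq_continuous V f g : open V -> (forall x, V x -> f x = g x) ->
  forall x, V x -> {for x, continuous f} -> {for x, continuous g}.
Proof.
move=> oV fg x Vx cf; rewrite /prop_for /continuous_at -(fg x Vx).
have near_fg : \forall y \near x, f y = g y.
  by near=> y; apply: fg; near: y; exact: open_nbhs_nbhs.
exact: cvg_trans (near_eq_cvg near_fg) cf.
Unshelve. all: by end_near. Qed.

Lemma eq_Ck V k f g : open V -> (forall x, V x -> f x = g x) ->
  Ck k V f -> Ck k V g.
Proof.
move=> oV; elim: k f g => [|k IH] f g fg /=.
  by move=> cf x Vx; apply: (eq_continuous oV fg Vx); exact: cf.
move=> [cf df]; split=> [x Vx|j].
  by apply: (eq_continuous oV fg Vx); exact: cf.
have [d c] := df j; split=> [x Vx|].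
  by apply: (eq_derivable oV fg Vx); exact: d.
by apply: IH c => x Vx; exact: (eq_partial _ oV fg).
Qed.

Lemma eq_dword V f g w : open V -> (forall x, V x -> f x = g x) ->
  forall x, V x -> dword w f x = dword w g x.
Proof.
by move=> oV fg; elim: w => //= j w IH x Vx; exact: (eq_partial _ oV IH).
Qed.

Lemma Ck_le V k l f : (k <= l)%N -> Ck l V f -> Ck k V f.
Proof.
elim: k l f => [|k IH] [|l] f //=; first by move=> _ [].
by rewrite ltnS => kl [cf df]; split=> // j; have [d c] := df j; split=> //; exact: IH c.
Qed.

Lemma Ck_dword V k f w : Ck (size w + k) V f -> Ck k V (dword w f).
Proof.
elim: w k => [//|j w IH] k Cf.
by have /IH [_ /(_ j) []] : Ck (size w + k.+1) V f by rewrite addnS.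
Qed.

Definition mword (alpha : 'I_p -> nat) : seq 'I_p :=
  flatten [seq nseq (alpha j) j | j <- enum 'I_p].

Lemma size_mword alpha : size (mword alpha) = mlen alpha.
Proof.
rewrite /mword /mlen size_flatten /shape -map_comp sumnE big_map big_enum /=.
by apply: eq_bigr => j _; rewrite size_nseq.
Qed.

Lemma mderive_dword alpha f : mderive alpha f = dword (mword alpha) f.
Proof.
rewrite /mderive /mword; elim: (enum _) => //= j s ->.
by rewrite /dword foldr_cat; elim: (alpha j) => //= n ->.
Qed.

Lemma mword_count w : perm_eq (mword (fun j => count_mem j w)) w.
Proof.
apply/allP => i _ /=; apply/eqP; rewrite /mword count_flatten -map_comp sumnE big_map.
rewrite big_enum /= (bigD1 i) //= big1 ?addn0 => [|j ji].
  by rewrite count_nseq /= eqxx mul1n.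
by rewrite count_nseq /= (negPf ji) mul0n.
Qed.

End Words.

Section Symmetry.
Variables (R : realType) (p : nat).
Implicit Types (f : 'rV[R]_p -> R) (V : set 'rV[R]_p) (w : seq 'I_p).

Lemma Ck2_schwarz V f i j : open V -> Ck 2 V f ->
  forall x, V x -> partial j (partial i f) x = partial i (partial j f) x.
Proof.
move=> oV [_ Cf] x Vx; have [di [_ Ci]] := Cf i; have [dj [_ Cj]] := Cf j.
have [dji cji] := Ci j; have [dij cij] := Cj i.
apply: schwarz; [|exact: cji|exact: cij].
near=> z; have Vz : V z by near: z; exact: open_nbhs_nbhs.
by split; [exact: di|exact: dj|exact: dji|exact: dij].
Unshelve. all: by end_near. Qed.

Lemma dword_move V f i w1 w2 : open V -> Ck (size w1 + size w2).+1 V f ->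
  forall x, V x -> dword (w1 ++ i :: w2) f x = dword (i :: w1 ++ w2) f x.
Proof.
move=> oV; elim: w1 => //= j w1 IH Cf x Vx.
rewrite (eq_partial _ oV (IH _) Vx) /=; last exact: Ck_le Cf.
apply: (Ck2_schwarz _ _ oV) => //; apply: Ck_dword.
by rewrite size_cat addn2.
Qed.

(** The bounds on a chart concern derivatives in the order of [mword], whereas
   estimates by induction on the order produce all words. *)
Lemma dword_perm V f w1 w2 : open V -> Ck (size w1) V f -> perm_eq w1 w2 ->
  forall x, V x -> dword w1 f x = dword w2 f x.
Proof.
move=> oV; elim: w1 w2 => [|i w1 IH] w2 Cf pw x Vx.
  by move: pw; rewrite perm_sym => /perm_nilP ->.
have := perm_mem pw i; rewrite mem_head => /esym /path.splitPr sp.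
case: sp pw => a b pw.
have pw' : perm_eq w1 (a ++ b).
  by move: pw; rewrite -[i :: b]cat1s perm_sym perm_catCA /= perm_cons perm_sym.
rewrite (dword_move _ oV _ Vx) /=.
  by apply: (eq_partial _ oV _ Vx) => y Vy; apply: IH => //; exact: Ck_le Cf.
by rewrite -size_cat -(perm_size pw').
Qed.

End Symmetry.

Section Components.
Variables (R : realType) (p q : nat).
Implicit Types (f : 'rV[R]_p -> 'rV[R]_q) (V : set 'rV[R]_p) (w : seq 'I_p).

Lemma continuous_coord f x : 
  {for x, continuous f} <-> forall c, {for x, continuous (fun y => f y 0 c)}.
Proof. have E := @cvg_rV R q _ (nbhs x) _ f (f x).
by split=> [/E h c|h]; [exact: h|apply/E => c; exact: (h c)]. Qed.

Lemma derivable_coord f x v :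
  derivable f x v <-> forall c, derivable (fun y => f y 0 c) x v.
Proof.
rewrite derivable_mxP; split=> [h c|h i c]; first exact: h.
by rewrite (ord1 i); exact: h.
Qed.

Lemma partial_coord f x j c : derivable f x (delta_mx 0 j) ->
  partial j f x 0 c = partial j (fun y => f y 0 c) x.
Proof. by move=> df; rewrite /partial derive_mx // mxE. Qed.

Lemma Ck_coord V k f : open V ->
  Ck k V f <-> forall c, Ck k V (fun x => f x 0 c).
Proof.
move=> oV; elim: k f => [|k IH] f /=.
  split=> [cf c x Vx|cf x Vx]; first exact: (continuous_coord f x).1 (cf x Vx) c.
  by apply/continuous_coord => c; exact: cf.
split=> [[cf df] c|Cf].
  split=> [x Vx|j]; first exact: (continuous_coord f x).1 (cf x Vx) c.
  have [d /IH C] := df j; split=> [x Vx|].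
    exact: (derivable_coord f x _).1 (d x Vx) c.
  apply: (eq_Ck oV) (C c) => x Vx; exact: partial_coord (d x Vx).
have d j x : V x -> derivable f x (delta_mx 0 j).
  by move=> Vx; apply/derivable_coord => c; case: (Cf c) => _ /(_ j) [+ _]; exact.
split=> [x Vx|j].
  by apply/continuous_coord => c; case: (Cf c) => + _; exact.
split=> [x|]; first exact: d.
apply/IH => c; case: (Cf c) => _ /(_ j) [_]; apply: (eq_Ck oV) => x Vx.
by rewrite partial_coord //; exact: d.
Qed.

Lemma dword_coord V f w c : open V -> Ck (size w) V f ->
  forall x, V x -> dword w f x 0 c = dword w (fun y => f y 0 c) x.
Proof.
move=> oV; elim: w => //= j w IH Cf x Vx.
have [_ /(_ j) [d _]] : Ck 1 V (dword w f) by apply: Ck_dword; rewrite addn1.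
rewrite partial_coord; last exact: d.
by apply: (eq_partial _ oV _ Vx) => y Vy; apply: IH => //; exact: Ck_le Cf.
Qed.

End Components.

(** * Families with uniform derivative bounds *)

Section Uniform_classes.
Variables (R : realType) (I : Type) (p : nat) (O E : I -> set 'rV[R]_p).
Hypothesis oO : forall i, open (O i).
Implicit Types (f g : I -> 'rV[R]_p -> R) (b : nat -> I -> R) (N : nat).

(** Continuity on O together with limits, along O, at the points of E: O will
   be the interior of a triangle E. Asking for limits instead of values lets
   the class contain derivatives, which are defined on O only. *)
Definition reg f :=
  (forall i x, O i x -> {for x, continuous (f i)}) /\
  (forall i x, E i x ->
     exists l : R, f i y @[y --> within (O i) (nbhs x)] --> l).

Definition bdd (b0 : I -> R) f :=
  exists2 C : R, 0 <= C & forall i x, O i x -> `|f i x| <= C * b0 i.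

(** The weight b n i bounds the derivatives of order n of the member i of the
   family, up to one constant for the whole family. *)
Fixpoint cls N b f : Prop :=
  [/\ reg f, bdd (b 0%N) f &
    match N with
    | 0 => True
    | N'.+1 => forall j,
        (forall i x, O i x -> derivable (f i) x (delta_mx 0 j)) /\
        cls N' (fun n => b n.+1) (fun i => partial j (f i))
    end].

(** Bounds on the derivatives of order at least 1 only; the weight b n belongs
   to the derivatives of order n + 1. The values of r and s themselves are not
   small, only their derivatives are. *)
Definition gcls N b f : Prop :=
  match N with
  | 0 => True
  | N'.+1 => forall j,
      (forall i x, O i x -> derivable (f i) x (delta_mx 0 j)) /\
      cls N' b (fun i => partial j (f i))
  end.

Lemma clsE N b f :
  cls N b f <-> [/\ reg f, bdd (b 0%N) f & gcls N (fun n => b n.+1) f].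
Proof. by case: N. Qed.

Lemma clsS N b f : cls N.+1 b f <->
  [/\ reg f, bdd (b 0%N) f & forall j,
    (forall i x, O i x -> derivable (f i) x (delta_mx 0 j)) /\
    cls N (fun n => b n.+1) (fun i => partial j (f i))].
Proof. by []. Qed.

(** One argument for sums and products, with respect to both filters that
   occur in [reg]. *)
Lemma reg_op2 (op : R -> R -> R) f g :
  (forall (G : set_system 'rV[R]_p) (u v : 'rV[R]_p -> R) (a c : R), Filter G ->
     u x @[x --> G] --> a -> v x @[x --> G] --> c ->
     op (u x) (v x) @[x --> G] --> op a c) ->
  reg f -> reg g -> reg (fun i x => op (f i x) (g i x)).
Proof.
move=> opc [cf lf] [cg lg]; split=> i x ix.
  by apply: (opc (nbhs x)); [exact: (cf i x ix)|exact: (cg i x ix)].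
have [l fl] := lf i x ix; have [k gk] := lg i x ix.
by exists (op l k); exact: opc.
Qed.

Lemma regD f g : reg f -> reg g -> reg (fun i x => f i x + g i x).
Proof. by apply: reg_op2 => G u v a c FG ua vc; exact: cvgD. Qed.

Lemma regM f g : reg f -> reg g -> reg (fun i x => f i x * g i x).
Proof. by apply: reg_op2 => G u v a c FG ua vc; exact: cvgM. Qed.

Lemma reg_cst (c : I -> R) : reg (fun i _ => c i).
Proof.
split=> i x _; first exact: cst_continuous.
by exists (c i); exact: cvg_cst.
Qed.

Lemma eq_reg f g : (forall i x, O i x -> f i x = g i x) -> reg f -> reg g.
Proof.
move=> fg [cf lf]; split=> i x ix.
  exact (eq_continuous (@oO i) (fg i) ix (cf i x ix)).
have [l fl] := lf i x ix; exists l.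
have near_fg : \forall y \near within (O i) (nbhs x), f i y = g i y.
  rewrite near_withinE; near=> y; exact: (fg i y).
exact: cvg_trans (near_eq_cvg near_fg) fl.
Unshelve. all: by end_near. Qed.

Lemma eq_cls N b f g : (forall i x, O i x -> f i x = g i x) ->
  cls N b f -> cls N b g.
Proof.
elim: N b f g => [|N IH] b f g fg.
  by move=> [rf [C C0 bf] _]; split=> //; [exact: eq_reg rf|exists C => // i x Ox; rewrite -fg ?bf].
move=> /clsS[rf [C C0 bf] df]; apply/clsS; split=> [||j]; first exact: eq_reg rf.
  by exists C => // i x Ox; rewrite -fg ?bf.
have [d c] := df j; split=> [i x Ox|].
  exact (eq_derivable (@oO i) (fg i) Ox (d i x Ox)).
by apply: IH c => i x Ox; exact: (eq_partial j (@oO i) (fg i) Ox).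
Qed.

Lemma eq_gcls N b f g : (forall i x, O i x -> f i x = g i x) ->
  gcls N b f -> gcls N b g.
Proof.
case: N => //= N fg df j; have [d c] := df j; split=> [i x Ox|].
  exact (eq_derivable (@oO i) (fg i) Ox (d i x Ox)).
by apply: eq_cls c => i x Ox; exact: (eq_partial j (@oO i) (fg i) Ox).
Qed.

Lemma cls_weight N b b' f : (forall n i, b n i <= b' n i) ->
  cls N b f -> cls N b' f.
Proof.
elim: N b b' f => [|N IH] b b' f bb.
  move=> [rf [C C0 bf] _]; split=> //; exists C => // i x Ox.
  by rewrite (le_trans (bf i x Ox)) ?ler_wpM2l.
move=> /clsS[rf [C C0 bf] df]; apply/clsS; split=> // [|j].
  by exists C => // i x Ox; rewrite (le_trans (bf i x Ox)) ?ler_wpM2l.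
by have [d c] := df j; split=> //; apply: IH c => n i; exact: bb.
Qed.

Lemma gcls_weight N b b' f : (forall n i, b n i <= b' n i) ->
  gcls N b f -> gcls N b' f.
Proof.
case: N => //= N bb df j; have [d c] := df j; split=> //.
exact: cls_weight c.
Qed.

Lemma cls_le N N' b f : (N <= N')%N -> cls N' b f -> cls N b f.
Proof.
elim: N N' b f => [|N IH] [|N'] b f //; first by move=> _ [].
rewrite ltnS => NN /clsS[rf bf df]; apply/clsS; split=> // j; have [d c] := df j; split=> //.
exact: IH c.
Qed.

Lemma gcls_le N N' b f : (N <= N')%N -> gcls N' b f -> gcls N b f.
Proof.
case: N N' => [|N] [|N'] //=; rewrite ltnS => NN df j; have [d c] := df j.
by split=> //; exact: cls_le c.
Qed.

Lemma bddD (b0 : I -> R) f g : bdd b0 f -> bdd b0 g -> bdd b0 (fun i x => f i x + g i x).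
Proof.
move=> [C C0 bf] [D D0 bg]; exists (C + D); first exact: addr_ge0.
move=> i x Ox; rewrite mulrDl (le_trans (ler_normD _ _)) // lerD //.
  exact: bf.
exact: bg.
Qed.

Lemma clsD N b f g : cls N b f -> cls N b g ->
  cls N b (fun i x => f i x + g i x).
Proof.
elim: N b f g => [|N IH] b f g.
  by move=> [rf bf _] [rg bg _]; split=> //; [exact: regD|exact: bddD].
move=> /clsS[rf bf df] /clsS[rg bg dg]; apply/clsS; split=> [||j]; [exact: regD|exact: bddD|].
have [d c] := df j; have [d' c'] := dg j; split=> [i x Ox|].
  by apply: derivableD; [exact: d|exact: d'].
apply: eq_cls (IH _ _ _ c c') => i x Ox.
by rewrite /partial deriveD; [|exact: d|exact: d'].
Qed.

(** The scaling factors may depend on the member of the family, so that their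
   size is absorbed by the weight. *)
Lemma cls_scale N b f (c a : I -> R) (C : R) : 0 <= C ->
  (forall i, `|c i| <= C * a i) -> cls N b f ->
  cls N (fun n i => a i * b n i) (fun i x => c i * f i x).
Proof.
move=> C0 ca; have bdd_scale (b0 : I -> R) g : bdd b0 g ->
    bdd (fun i => a i * b0 i) (fun i x => c i * g i x).
  move=> [D D0 bg]; exists (C * D) => [|i x Ox]; first exact: mulr_ge0.
  by rewrite mulrACA normrM ler_pM ?bg.
elim: N b f => [|N IH] b f.
  by move=> [rf bf _]; split=> //; [apply: regM => //; exact: reg_cst|exact: bdd_scale].
move=> /clsS[rf bf df]; apply/clsS; split=> [||j]; [by apply: regM => //; exact: reg_cst|exact: bdd_scale|].
have [d cl] := df j; split=> [i x Ox|].
  by apply: derivableZ; exact: d.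
apply: eq_cls (IH _ _ cl) => i x Ox.
by rewrite /partial deriveZ //; exact: d.
Qed.

Lemma cls0 N b : cls N b (fun _ _ => 0).
Proof.
elim: N b => [|N IH] b.
  by split=> //; [exact: reg_cst|exists 0 => // i x _; rewrite normr0 mul0r].
apply/clsS; split=> [||j]; first exact: reg_cst.
  by exists 0 => // i x _; rewrite normr0 mul0r.
split=> [i x _|]; first exact: derivable_cst.
by apply: eq_cls (IH _) => i x Ox; rewrite /partial derive_cst.
Qed.

Lemma cls_cst N b (c : I -> R) (C : R) : 0 <= C ->
  (forall i, `|c i| <= C * b 0%N i) -> cls N b (fun i _ => c i).
Proof.
move=> C0 cb; apply/clsE; split; first exact: reg_cst.
  by exists C.
case: N => //= N j; split=> [i x _|]; first exact: derivable_cst.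
by apply: eq_cls (cls0 N _) => i x Ox; rewrite /partial derive_cst.
Qed.

Lemma clsN N b f : cls N b f -> cls N b (fun i x => - f i x).
Proof.
move=> cf; have := @cls_scale N b f (fun=> -1) (fun=> 1) 1 ler01 _ cf.
have h : I -> `|-1 : R| <= 1 * 1 by move=> _; rewrite normrN normr1 mulr1.
move=> /(_ h) cN; apply: eq_cls (cls_weight _ cN) => [i x _|n i].
  by rewrite mulN1r.
by rewrite mul1r.
Qed.

Lemma cls_sum N b q (f : 'I_q -> I -> 'rV[R]_p -> R) :
  (forall k, cls N b (f k)) -> cls N b (fun i x => \sum_k f k i x).
Proof.
elim: q f => [|q IH] f cf.
  by apply: eq_cls (cls0 N b) => i x _; rewrite big_ord0.
apply: eq_cls (clsD (cf ord0) (IH (fun k => f (lift ord0 k)) _)) => [i x _|k].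
  by rewrite big_ord_recl.
exact: cf.
Qed.

(** By Leibniz' rule the derivative of order m + n of a product contains the
   pairings of orders m and n, so weights have to be submultiplicative. *)
Lemma clsM N b1 b2 b3 f g :
  (forall m n i, b1 m i * b2 n i <= b3 (m + n)%N i) ->
  cls N b1 f -> cls N b2 g -> cls N b3 (fun i x => f i x * g i x).
Proof.
have bddM (a1 a2 a3 : I -> R) u v : (forall i, a1 i * a2 i <= a3 i) ->
    bdd a1 u -> bdd a2 v -> bdd a3 (fun i x => u i x * v i x).
  move=> aa [C C0 bu] [D D0 bv]; exists (C * D) => [|i x Ox].
    exact: mulr_ge0.
  apply: (@le_trans _ _ (C * D * (a1 i * a2 i))); last first.
    by apply: ler_wpM2l (aa i); exact: mulr_ge0.
  by rewrite mulrACA normrM ler_pM ?bu ?bv.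
elim: N b1 b2 b3 f g => [|N IH] b1 b2 b3 f g bb cf cg.
  have [rf bf _] := cf; have [rg bg _] := cg.
  split=> //; first exact: regM.
  by apply: bddM bf bg => i; exact: bb.
have /clsS[rf bf df] := cf; have /clsS[rg bg dg] := cg.
apply/clsS; split=> [||j]; first exact: regM.
  by apply: bddM bf bg => i; exact: bb.
have [d c] := df j; have [d' c'] := dg j; split=> [i x Ox|].
  by apply: derivableM; [exact: d|exact: d'].
have P1 : cls N (fun n => b3 n.+1) (fun i x => partial j (f i) x * g i x).
  by apply: (IH _ _ _ _ _ _ c (cls_le _ cg)).
have P2 : cls N (fun n => b3 n.+1) (fun i x => f i x * partial j (g i) x).
  apply: (IH _ _ _ _ _ _ (cls_le _ cf) c') => // m n i.
  by have := bb m n.+1 i; rewrite addnS.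
apply: eq_cls (clsD P1 P2) => i x Ox.
rewrite /partial deriveM; [|exact: d|exact: d'].
by rewrite /GRing.scale /= addrC; congr (_ + _); rewrite mulrC.
Qed.

Definition dword_bdd n (e : I -> R) f :=
  (exists2 C : R, 0 <= C & forall w, size w = n -> forall i x, O i x ->
     `|dword w (f i) x| <= C * e i) /\
  (forall w, size w = n -> forall i x, E i x ->
     exists l : R, dword w (f i) y @[y --> within (O i) (nbhs x)] --> l).

Lemma dword_bddS n (e : I -> R) f : (forall j, dword_bdd n e (fun i => partial j (f i))) ->
  dword_bdd n.+1 e f.
Proof.
move=> dw; split; last first.
  case/lastP=> // w j; rewrite size_rcons => -[wn] i x Ex.
  by have [_ /(_ w wn i x Ex)] := dw j; rewrite /dword foldr_rcons.
have {dw} : forall j, exists C : R, 0 <= C /\ forall w, size w = n ->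
    forall i x, O i x -> `|dword w (partial j (f i)) x| <= C * e i.
  by move=> j; have [[C C0 CP] _] := dw j; exists C.
move=> /choice[C CP]; exists (\sum_j C j).
  by apply: sumr_ge0 => j _; case: (CP j).
case/lastP=> // w j; rewrite size_rcons => -[wn] i x Ox.
rewrite /dword foldr_rcons; apply: le_trans ((CP j).2 w wn i x Ox) _.
rewrite (bigD1 j) //= mulrDl lerDl mulr_suml; apply: sumr_ge0 => k _.
exact: le_trans (normr_ge0 _) ((CP k).2 w wn i x Ox).
Qed.

Lemma cls_dword N b f n : (n <= N)%N -> cls N b f -> dword_bdd n (b n) f.
Proof.
elim: n N b f => [|n IH] N b f nN cf.
  have [[_ lf] [C C0 bf] _] := (clsE _ _ _).1 cf.
  by split=> [|[]//]; exists C => // -[].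
case: N nN cf => // N nN /clsS[_ _ df].
by apply: dword_bddS => j; exact: IH nN (df j).2.
Qed.

Lemma gcls_dword N b f n : (n < N)%N -> gcls N b f -> dword_bdd n.+1 (b n) f.
Proof.
case: N => // N nN df; apply: dword_bddS => j; exact: (cls_dword (ltnSE nN) (df j).2).
Qed.

Lemma cls_Ck N b f i : cls N b f -> Ck N (O i) (f i).
Proof.
elim: N b f => [|N IH] b f; first by move=> [[cf _] _ _] x; exact: cf.
move=> /clsS[[cf _] _ df]; split=> [x|j]; first exact: cf.
by have [d c] := df j; split=> [x|]; [exact: d|exact: IH c].
Qed.

Lemma gcls_Ck N b f i : reg f -> gcls N b f -> Ck N (O i) (f i).
Proof.
case: N => [|N] [cf _]; first by move=> _ x; exact: cf.
move=> gf; split=> [x|j]; first exact: cf.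
by have [d c] := gf j; split=> [x|]; [exact: d|exact: cls_Ck c].
Qed.

End Uniform_classes.

Lemma cls_reindex (R : realType) (I J : Type) (pi : J -> I) p
    (O E : I -> set 'rV[R]_p) N b (f : I -> 'rV[R]_p -> R) :
  cls O E N b f ->
  cls (O \o pi) (E \o pi) N (fun n j => b n (pi j)) (f \o pi).
Proof.
elim: N b f => [|N IH] b f.
  move=> [[cf lf] [C C0 bf] _]; split=> //; first by split=> j x; [exact: cf|exact: lf].
  by exists C => // j x; exact: bf.
move=> /clsS[[cf lf] [C C0 bf] df]; apply/clsS; split; first by split=> j x; [exact: cf|exact: lf].
  by exists C => // j x; exact: bf.
move=> k; have [d c] := df k; split=> [j x|]; first exact: d.
exact: IH c.
Qed.

Lemma gcls_reindex (R : realType) (I J : Type) (pi : J -> I) p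
    (O E : I -> set 'rV[R]_p) N b (f : I -> 'rV[R]_p -> R) :
  gcls O E N b f ->
  gcls (O \o pi) (E \o pi) N (fun n j => b n (pi j)) (f \o pi).
Proof.
case: N => //= N df k; have [d c] := df k; split=> [j x|]; first exact: d.
exact: (cls_reindex pi c).
Qed.

(** * Composition and the grading by half powers of h *)

Section Pointwise_rules.
Variables (R : realType) (V : normedModType R).
Implicit Types (f g : V -> R) (x v : V).

Lemma is_derive_mul f g x v a b : is_derive x v f a -> is_derive x v g b ->
  is_derive x v (fun y => f y * g y) (a * g x + f x * b).
Proof.
move=> df dg; have := is_deriveM df dg.
by rewrite /GRing.scale /= addrC (mulrC (g x)).
Qed.

Lemma is_derive_addl (c : R) f x v a : is_derive x v f a ->
  is_derive x v (fun y => c + f y) a.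
Proof.
move=> [df <-]; apply: DeriveDef.
  by apply: derivableD => //; exact: derivable_cst.
by rewrite deriveD ?derive_cst ?add0r //; exact: derivable_cst.
Qed.

Lemma is_derive_sumr n (f : 'I_n -> V -> R) x v (a : 'I_n -> R) :
  (forall k, is_derive x v (f k) (a k)) ->
  is_derive x v (fun y => \sum_k f k y) (\sum_k a k).
Proof.
move=> df; have -> : (fun y => \sum_k f k y) = \sum_k f k.
  by apply/funext => y; rewrite fct_sumE.
exact: is_derive_sum.
Qed.

End Pointwise_rules.

Section Affine_maps.
Variables (R : realType) (p q : nat) (c : 'rV[R]_q) (A : 'M[R]_(p, q)).

Lemma continuous_affine : continuous (fun x : 'rV[R]_p => c + x *m A).
Proof.
move=> x; apply/(@cvg_rV R q _ (nbhs x) _ (fun x => c + x *m A) (c + x *m A)) => k.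
have rE : (fun y => (c + y *m A) 0 k) = (fun y => c 0 k + \sum_j y 0 j * A j k).
  by apply/funext => y; rewrite !mxE.
rewrite rE !mxE; apply: cvgD; first exact: cvg_cst.
apply: cvg_sum_ord => j; apply: cvgM; last exact: cvg_cst.
exact: coord_continuous.
Qed.

Lemma is_derive_affine (x : 'rV[R]_p) j k :
  is_derive x (delta_mx 0 j) (fun y => (c + y *m A) 0 k) (A j k).
Proof.
have nE : \forall h \near 0^',
    A j k = h^-1 *: ((c + (h *: delta_mx 0 j + x) *m A) 0 k - (c + x *m A) 0 k).
  near=> h; rewrite mulmxDl -scalemxAl -rowE !mxE.
  rewrite (addrC (h * _)) addrA [X in X - _]addrC addrK /GRing.scale /= mulKf //.
  by near: h; exact: nbhs_dnbhs_neq.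
have Q1 : h^-1 *: ((c + (h *: delta_mx 0 j + x) *m A) 0 k - (c + x *m A) 0 k)
    @[h --> 0^'] --> A j k.
  exact: cvg_trans (near_eq_cvg nE) (cvg_cst (A j k)).
by apply: DeriveDef; [exact: cvgP Q1|exact: cvg_lim Q1].
Unshelve. all: by end_near. Qed.

End Affine_maps.

Section Composition.
Variables (R : realType) (I : Type) (p q : nat).
Variables (O E : I -> set 'rV[R]_p) (Q : I -> set 'rV[R]_q).
Hypotheses (oO : forall i, open (O i)) (oQ : forall i, open (Q i)).

(** The conditions under which a function on the target may be composed with
   r: the limits of r at E have to stay in Q, where the outer function is
   continuous. *)
Definition inner (r : I -> 'rV[R]_p -> 'rV[R]_q) :=
  [/\ forall i x, O i x -> Q i (r i x),
      forall i x, O i x -> {for x, continuous (r i)} &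
      forall i x, E i x -> exists2 l, Q i l &
        r i y @[y --> within (O i) (nbhs x)] --> l].

(** Continuity relative to E covers both the neighbourhoods of interior points
   and the limits at the boundary. *)
Lemma inner_within r : (forall i, O i `<=` E i) ->
  (forall i x, E i x -> Q i (r i x)) ->
  (forall i x, E i x -> r i y @[y --> within (E i) (nbhs x)] --> r i x) -> inner r.
Proof.
move=> OE rQ rE; split=> i x ix; first by apply: rQ; exact: OE.
  apply: cvg_trans (rE _ _ (OE _ _ ix)); apply: cvg_app => P; rewrite /within /= => nP.
  have nO : \forall y \near x, O i y by apply: open_nbhs_nbhs.
  by apply: filterS2 nO nP => y Oy; apply; exact: OE.
exists (r i x); first exact: rQ.
have wOE : within (O i) (nbhs x) `=>` within (E i) (nbhs x).
  move=> P; rewrite /within /= => nP.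
  by apply: filterS nP => y Py Oy; apply: Py; exact: OE.
by apply: cvg_trans (rE _ _ ix); exact: cvg_app.
Qed.

Lemma reg_comp (phi : I -> 'rV[R]_q -> R) r : inner r ->
  (forall i x, Q i x -> {for x, continuous (phi i)}) ->
  reg O E (fun i => phi i \o r i).
Proof.
move=> [rQ cr lr] cphi; split=> i x ix.
  by apply: continuous_comp; [exact: cr|exact: cphi (rQ _ _ ix)].
have [l Ql rl] := lr i x ix; exists (phi i l).
apply: (@continuous_cvg _ _ _ (within (O i) (nbhs x)) _ (r i) (phi i) l) => //.
exact: cphi.
Qed.

Lemma partial_comp (phi : I -> 'rV[R]_q -> R) r i x j : inner r -> O i x ->
  (forall k, (forall z, Q i z -> derivable (phi i) z (delta_mx 0 k)) /\
     (forall z, Q i z -> {for z, continuous (partial k (phi i))})) ->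
  (forall k, derivable (fun y => r i y 0 k) x (delta_mx 0 j)) ->
  derivable (phi i \o r i) x (delta_mx 0 j) /\
  partial j (phi i \o r i) x =
    \sum_k partial k (phi i) (r i x) * partial j (fun y => r i y 0 k) x.
Proof.
move=> [rQ _ _] Ox dphi dr.
have Qx := rQ i x Ox.
have [||//|d e] := @is_derive_chain R p q (phi i) (r i) x (delta_mx 0 j).
- have nQ : \forall z \near r i x, Q i z by apply: open_nbhs_nbhs; split.
  by near=> z; move=> k; apply: (dphi k).1; near: z.
- by move=> k; exact: (dphi k).2.
- by [].
Unshelve. all: by end_near. Qed.

Section Affine_change.
Variables (EQ : I -> set 'rV[R]_q) (c : I -> 'rV[R]_q) (A : I -> 'M[R]_(p, q)).
Variables (a : I -> R) (C : R).
Hypotheses (C0 : 0 <= C) (Aa : forall i j k, `|A i j k| <= C * a i).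
Hypothesis OQ : forall i x, O i x -> Q i (c i + x *m A i).
Hypothesis EEQ : forall i x, E i x -> EQ i (c i + x *m A i).
Implicit Types f : I -> 'rV[R]_q -> R.
Let r i x := c i + x *m A i.

Lemma reg_affine f : reg Q EQ f -> reg O E (fun i x => f i (c i + x *m A i)).
Proof.
move=> [cf lf]; have cr i : continuous (r i) by exact: continuous_affine.
split=> i x ix.
  by apply: (@continuous_comp _ _ _ (r i) (f i)); [exact: cr|exact: cf (OQ ix)].
have [l fl] := lf i _ (EEQ ix); exists l; apply: cvg_comp fl.
move=> P nP; have := cr i x _ nP; rewrite /= !near_simpl => nP'.
rewrite near_withinE; near=> y => Oy; apply: (near nP' y) => //.
exact: OQ.
Unshelve. all: by end_near. Qed.

Let is_derive_comp_affine f i x j : O i x ->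
  (forall k, (forall z, Q i z -> derivable (f i) z (delta_mx 0 k)) /\
     (forall z, Q i z -> {for z, continuous (partial k (f i))})) ->
  is_derive x (delta_mx 0 j) (f i \o r i)
    (\sum_k partial k (f i) (r i x) * A i j k).
Proof.
move=> Ox df.
have dr k : is_derive x (delta_mx 0 j) (fun y => r i y 0 k) (A i j k).
  exact: is_derive_affine.
have nQ : \forall z \near r i x, Q i z.
  by apply: open_nbhs_nbhs; split; [exact: oQ|exact: OQ].
have [|||d e] := @is_derive_chain R p q (f i) (r i) x (delta_mx 0 j).
- by near=> z; move=> k; apply: (df k).1; near: z.
- by move=> k; apply: (df k).2; exact: OQ.
- by move=> k; case: (dr k).
apply: DeriveDef => //; rewrite e; apply: eq_bigr => k _.
by case: (dr k) => _ ->.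
Unshelve. all: by end_near. Qed.

Let partial_affine N b f j :
  (forall k, (forall i z, Q i z -> derivable (f i) z (delta_mx 0 k)) /\
     cls Q EQ N b (fun i => partial k (f i))) ->
  (forall k, cls O E N (fun n i => a i ^+ n * b n i)
     (fun i x => partial k (f i) (c i + x *m A i))) ->
  (forall i x, O i x -> derivable (f i \o r i) x (delta_mx 0 j)) /\
  cls O E N (fun n i => a i * (a i ^+ n * b n i)) (fun i => partial j (f i \o r i)).
Proof.
move=> df cf; have der i x (Ox : O i x) : is_derive x (delta_mx 0 j) (f i \o r i)
    (\sum_k partial k (f i) (r i x) * A i j k).
  apply: is_derive_comp_affine => // k; split; first exact: (df k).1.
  by have [[+ _] _ _] := (clsE _ _ _ _ _).1 (df k).2; exact.
split=> [i x Ox|]; first by case: (der i x Ox).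
apply: (@eq_cls _ _ _ _ _ oO _ _
   (fun i x => \sum_k A i j k * partial k (f i) (r i x))) => [i x Ox|].
  case: (der i x Ox) => _; rewrite /partial => ->.
  by apply: eq_bigr => k _; rewrite mulrC.
apply: cls_sum => // k; exact: (cls_scale oO C0 (fun i => Aa i j k) (cf k)).
Qed.

Lemma cls_affine N b f : cls Q EQ N b f ->
  cls O E N (fun n i => a i ^+ n * b n i) (fun i x => f i (c i + x *m A i)).
Proof.
elim: N b f => [|N IH] b f cf.
  have [rf [D D0 bf] _] := (clsE _ _ _ _ _).1 cf.
  split=> //; first exact: reg_affine.
  by exists D => // i x Ox; rewrite expr0 mul1r; exact: bf (OQ Ox).
have [rf [D D0 bf] df] := (clsS _ _ _ _ _).1 cf.
apply/clsS; split; first exact: reg_affine.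
  by exists D => // i x Ox; rewrite expr0 mul1r; exact: bf (OQ Ox).
move=> j; have [d cl] := partial_affine j df (fun k => IH _ _ (df k).2).
by split=> //; apply: cls_weight cl => n i; rewrite exprS mulrA.
Qed.

Lemma gcls_affine N b f : gcls Q EQ N b f ->
  gcls O E N (fun n i => a i ^+ n.+1 * b n i) (fun i x => f i (c i + x *m A i)).
Proof.
case: N => // N df j.
have [d cl] := partial_affine j df (fun k => cls_affine (df k).2).
by split=> //; apply: cls_weight cl => n i; rewrite exprS mulrA.
Qed.

End Affine_change.

End Composition.

Lemma uphalf_addn_double s a : uphalf (s + a.*2) = (uphalf s + a)%N.
Proof. by lia. Qed.

Section Graded_classes.
Variables (R : realType) (I : Type) (h : I -> R).
Hypothesis h01 : forall i, 0 < h i <= 1.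

(** Grade s: derivatives of order n are of size h^ceil((s + n) / 2). An
   exponent that increases at every second derivative is what survives
   repeated division by W, which is itself only of size h. *)
Definition hweight (s n : nat) (i : I) : R := h i ^+ uphalf (s + n).

Lemma hweight_shift s : (fun n => hweight s n.+1) = hweight s.+1.
Proof. by apply/funext => n; rewrite /hweight addnS. Qed.

Lemma hweight_le s t n i : (s <= t)%N -> hweight t n i <= hweight s n i.
Proof.
move=> st; have /andP[h0 h1] := h01 i.
apply: ler_wiXn2l => //; first exact: ltW.
by apply: uphalf_leq; rewrite leq_add2r.
Qed.

(** Rounding up halves is subadditive, so a product of weights is at most the
   weight of the sum of the grades as h <= 1. *)
Lemma hweight_mul s t m n i : hweight s m i * hweight t n i <= hweight (s + t) (m + n) i.
Proof.
have /andP[h0 h1] := h01 i.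
rewrite /hweight -exprD; apply: ler_wiXn2l => //; first exact: ltW.
by rewrite addnACA; lia.
Qed.

Variables (p : nat) (O E : I -> set 'rV[R]_p).
Hypothesis oO : forall i, open (O i).
Implicit Types (f g W : I -> 'rV[R]_p -> R).

Local Notation T N s f := (cls O E N (hweight s) f).

Lemma graded_mul N s t f g : T N s f -> T N t g -> T N (s + t)%N (fun i x => f i x * g i x).
Proof. by apply: (clsM oO) => m n i; exact: hweight_mul. Qed.

Lemma gradedE N s f : T N s f <->
  [/\ reg O E f, bdd O (hweight s 0%N) f & gcls O E N (hweight s.+1) f].
Proof. by rewrite clsE hweight_shift. Qed.

(** A composition with a smooth function inherits the grade of the derivatives
   of the inner map, because the outer derivatives have grade 0. The two
   conclusions are proved together: grade 0 for the composed partial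
   derivatives is what the induction step multiplies by the derivatives of r.
   *)
Lemma graded_comp N q (Q : I -> set 'rV[R]_q) (E' : I -> set 'rV[R]_q)
    (phi : I -> 'rV[R]_q -> R) (r : I -> 'rV[R]_p -> 'rV[R]_q) :
  (forall i, open (Q i)) -> inner O E Q r ->
  cls Q E' N (fun _ _ => 1) phi ->
  (forall k, gcls O E N (hweight 2) (fun i x => r i x 0 k)) ->
  gcls O E N (hweight 2) (fun i => phi i \o r i) /\ T N 0%N (fun i => phi i \o r i).
Proof.
move=> oQ ir; elim: N phi => [|N IH] phi cphi cr.
  split=> //; have [[c _] [C C0 b] _] := (clsE _ _ _ _ _).1 cphi.
  split=> //; first by apply: reg_comp ir _.
  exists C => // i x Ox; rewrite /hweight expr0.
  by apply: b; case: ir => rQ _ _; exact: rQ.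
have [[c _] [C C0 b] dphi] := (clsS _ _ _ _ _).1 cphi.
have G : gcls O E N.+1 (hweight 2) (fun i => phi i \o r i).
  move=> j; have pc i x (Ox : O i x) := @partial_comp _ _ _ _ _ _ _ oQ phi r i x j ir Ox.
  have pc' i x : O i x -> derivable (phi i \o r i) x (delta_mx 0 j) /\
      partial j (phi i \o r i) x =
      \sum_k partial k (phi i) (r i x) * partial j (fun y => r i y 0 k) x.
    move=> Ox; apply: (pc i x Ox) => k.
      split; first exact: (dphi k).1.
      by have [[+ _] _ _] := (clsE _ _ _ _ _).1 (dphi k).2; exact.
    by have [d _] := cr k j; exact: d.
  split=> [i x Ox|]; first by case: (pc' i x Ox).
  apply: (@eq_cls _ _ _ _ _ oO _ _ (fun i x =>
     \sum_k partial k (phi i) (r i x) * partial j (fun y => r i y 0 k) x)).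
    by move=> i x Ox; case: (pc' i x Ox).
  apply: cls_sum => // k; apply: (@graded_mul _ 0 2).
    have [|_] := IH (fun i => partial k (phi i)) (dphi k).2; last by [].
    by move=> l; exact: gcls_le (cr l).
  by have [_] := cr k j.
split=> //; apply/gradedE; split.
- exact: reg_comp ir _.
- by exists C => // i x Ox; rewrite /hweight expr0; apply: b; case: ir => rQ _ _; exact: rQ.
- by apply: gcls_weight G => n i; exact: hweight_le.
Qed.

(** The lower bound matches the grade of the denominator, so the quotient rule
   (f' - (f / W) W') / W closes under induction on the order: f / W is of
   grade s by induction, and (f / W) W' has the same grade as f'. *)
Lemma graded_div N a s f W (c : R) : 0 < c ->
  (forall i x, O i x -> c * h i ^+ a <= `|W i x|) ->
  T N a.*2 W -> T N (s + a.*2)%N f -> T N s (fun i x => f i x / W i x).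
Proof.
move=> c0 cW.
have h0 i : 0 < h i by have /andP[] := h01 i.
have ch i : 0 < c * h i ^+ a by rewrite mulr_gt0 // exprn_gt0.
have WN0 i x : O i x -> W i x != 0.
  by move=> Ox; rewrite -normr_gt0 (lt_le_trans (ch i)) // cW.
have div_cvg (G : set_system 'rV[R]_p) (u v : 'rV[R]_p -> R) (l k : R) :
    Filter G -> u x @[x --> G] --> l -> v x @[x --> G] --> k -> k != 0 ->
    u x / v x @[x --> G] --> l / k.
  by move=> FG ul vk k0; apply: cvgM ul _; exact: cvgV.
have reg_div u : reg O E u -> reg O E W -> reg O E (fun i x => u i x / W i x).
  move=> [cu lu] [cw lw]; split=> i x ix.
    by apply: (div_cvg (nbhs x)); [exact: (cu i x ix)|exact: (cw i x ix)|exact: WN0].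
  have [l ul] := lu i x ix; have [k wk] := lw i x ix.
  (* Far from O every value is a limit; elsewhere the lower bound on W passes
     to its limit, which is therefore nonzero. *)
  have [G0|G0] := pselect (within (O i) (nbhs x) set0).
    by exists 0 => A _; apply: filterS G0.
  exists (l / k); apply: div_cvg => //.
  apply/eqP => k0; apply: G0.
  have nO : \forall y \near within (O i) (nbhs x), O i y by exact: near_withinT.
  apply: filterS2 nO ((cvgrPdist_lt _ _).1 wk _ (ch i)) => y Oy /=.
  by rewrite k0 sub0r normrN ltNge cW.
have bdd_div t u : bdd O (hweight (t + a.*2)%N 0%N) u ->
    bdd O (hweight t 0%N) (fun i x => u i x / W i x).
  move=> [C C0 bu]; exists (C / c) => [|i x Ox]; first by rewrite divr_ge0 // ltW.
  have Wx := WN0 i x Ox.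
  rewrite normrM normfV ler_pdivrMr ?normr_gt0 //.
  apply: le_trans (bu i x Ox) _.
  apply: le_trans (ler_wpM2l _ (cW i x Ox)); last first.
    by rewrite !mulr_ge0 ?invr_ge0 ?exprn_ge0 // ltW.
  rewrite /hweight !addn0 uphalf_addn_double // exprD.
  have -> : C / c * h i ^+ uphalf t * (c * h i ^+ a) = C * (h i ^+ uphalf t * h i ^+ a).
    by have cN0 := lt0r_neq0 c0; field.
  by [].
elim: N s f => [|N IH] s f TW Tf.
  have [rf bf _] := (gradedE _ _ _).1 Tf; have [rW _ _] := (gradedE _ _ _).1 TW.
  by apply/gradedE; split=> //; [exact: reg_div|exact: bdd_div].
have [rf bf df] := (gradedE _ _ _).1 Tf; have [rW _ dW] := (gradedE _ _ _).1 TW.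
apply/gradedE; split=> [||j]; [exact: reg_div|exact: bdd_div|].
have [d cf] := df j; have [d' cW'] := dW j.
have dV i x : O i x -> derivable (fun y => (W i y)^-1) x (delta_mx 0 j).
  by move=> Ox; apply: derivableV; [exact: WN0|exact: d'].
split=> [i x Ox|]; first by apply: derivableM; [exact: d|exact: dV].
have TWN := cls_le (leqnSn N) TW; have TfN := cls_le (leqnSn N) Tf.
have Tq := IH s f TWN TfN.
apply: (@eq_cls _ _ _ _ _ oO _ _ (fun i x =>
    (partial j (f i) x - f i x / W i x * partial j (W i) x) / W i x)).
  move=> i x Ox; rewrite /partial deriveM; [|exact: d|exact: dV].
  rewrite deriveV; [|exact: WN0|exact: d'].
  rewrite /GRing.scale /=; move: (WN0 i x Ox).
  move: (f i x) (W i x) ('D_ _ (f i) x) ('D_ _ (W i) x) => u w du dw w0.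
  by field.
apply: IH => //; apply: clsD => //.
apply: clsN => //.
have := graded_mul Tq cW'; by rewrite addnS addSn.
Unshelve. all: by end_near. Qed.

End Graded_classes.

(** * The radial parameter *)

Arguments cls : simpl never.

Section Radial_parameter.
Variables (R : realType) (I : Type) (h : I -> R).
Hypothesis h01 : forall i, 0 < h i <= 1.
Variables (p q : nat) (O E : I -> set 'rV[R]_p).
Hypotheses (oO : forall i, open (O i)) (OE : forall i, O i `<=` E i).
Variables (F : 'rV[R]_q -> R) (Om : set 'rV[R]_q) (M : nat).
Hypothesis oOm : open Om.
Hypothesis dF : forall k z, Om z -> derivable F z (delta_mx 0 k).
Hypothesis CF : forall k,
  cls (fun _ : I => Om) (fun _ => set0) M (fun _ _ => 1) (fun _ => partial k F).
Variables (x0 v0 : I -> 'rV[R]_q) (A : I -> 'M[R]_(p, q)) (t : I -> 'rV[R]_p -> R).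
Let v i x := v0 i + x *m A i.
Let r i x := x0 i + t i x *: v i x.
Hypothesis rOm : forall i x, E i x -> Om (r i x).
Hypothesis Fr : forall i x, E i x -> F (r i x) = 0.
Variables (C c : R) (L : I -> R).
Hypotheses (C0 : 0 <= C) (c0 : 0 < c).
Hypothesis t_le : forall i x, O i x -> `|t i x| <= C.
Hypothesis t_lip : forall i x y, E i x -> E i y -> `|t i y - t i x| <= L i * `|y - x|.
Hypothesis v_le : forall i x k, O i x -> `|v i x 0 k| <= C * h i.
Hypothesis A_le : forall i j k, `|A i j k| <= C * h i.
Hypothesis W_ge : forall i x, O i x ->
  c * h i <= `|\sum_k partial k F (r i x) * v i x 0 k|.
Hypothesis N_le : forall i x j, O i x ->
  `|\sum_k partial k F (r i x) * A i j k| <= C * h i ^+ 2.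

Let h0 i : 0 < h i. Proof. by have /andP[] := h01 i. Qed.

Let t_lim i x : E i x -> t i y @[y --> within (E i) (nbhs x)] --> t i x.
Proof.
move=> Ex; apply/cvgrPdist_lt => e e0.
have L0 : 0 < `|L i| + 1 by rewrite ltr_wpDl.
have nx : \forall y \near within (E i) (nbhs x), `|x - y| < e / (`|L i| + 1).
  apply: cvg_within; apply/nbhs_ballP; exists (e / (`|L i| + 1)) => /=.
    by rewrite divr_gt0.
  by move=> y; rewrite -ball_normE.
have nE : \forall y \near within (E i) (nbhs x), E i y by exact: near_withinT.
apply: filterS2 nE nx => y Ey; rewrite ltr_pdivlMr // => xy.
apply: le_lt_trans (t_lip Ey Ex) _; apply: le_lt_trans xy.
by rewrite mulrC ler_wpM2l // (le_trans (ler_norm _)) // lerDl.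
Qed.

Let v_cont i : continuous (v i).
Proof. exact: continuous_affine. Qed.

Let v_cvg (T : Type) (G : set_system T) (FG : Filter G) (u : T -> 'rV[R]_p) i x :
  u @ G --> x -> v i (u y) @[y --> G] --> v i x.
Proof. exact: (@continuous_cvg _ _ _ G FG u (v i) x (@v_cont i x)). Qed.

Let r_cvg (T : Type) (G : set_system T) (FG : Filter G) (u : T -> 'rV[R]_p) i x :
  u @ G --> x -> t i (u y) @[y --> G] --> t i x -> r i (u y) @[y --> G] --> r i x.
Proof.
move=> Gx tx; apply/(@cvg_rV R q _ G FG (r i \o u) (r i x)) => k.
have rE : (fun y => r i (u y) 0 k) = (fun y => x0 i 0 k + t i (u y) * v i (u y) 0 k).
  by apply/funext => y; rewrite !mxE.
have -> : r i x 0 k = x0 i 0 k + t i x * v i x 0 k by rewrite !mxE.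
rewrite /comp rE; apply: cvgD; first exact: cvg_cst.
apply: cvgM => //.
exact: (@cvg_rV R q _ G FG (v i \o u) (v i x)).2 (v_cvg FG Gx) k.
Qed.

Let t_cont i x : O i x -> {for x, continuous (t i)}.
Proof.
move=> Ox; have := t_lim (OE Ox); apply: cvg_trans; apply: cvg_app.
move=> P; rewrite /within /= => nP.
have nO : \forall y \near x, O i y by apply: open_nbhs_nbhs.
by apply: filterS2 nO nP => y Oy; apply; exact: OE.
Qed.

Let reg_t : reg O E t.
Proof.
have wOE i (x : 'rV[R]_p) : within (O i) (nbhs x) `=>` within (E i) (nbhs x).
  move=> P; rewrite /within /= => nP.
  by apply: filterS nP => y Py Oy; apply: Py; exact: OE.
split=> i x ix; first exact: t_cont.
by exists (t i x); apply: cvg_trans (t_lim ix); apply: cvg_app; exact: wOE.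
Qed.

(** The Lipschitz bound on t holds on E, so the lift is continuous up to the
   boundary of the triangle. *)
Lemma radial_cvg i x : E i x -> r i y @[y --> within (E i) (nbhs x)] --> r i x.
Proof.
move=> Ex; apply: (@r_cvg _ (within (E i) (nbhs x)) _ id i x); last exact: t_lim.
exact: cvg_within.
Qed.

Lemma radial_inner : inner O E (fun=> Om) r.
Proof. by apply: inner_within => //; exact: radial_cvg. Qed.

Let W i x := \sum_k partial k F (r i x) * v i x 0 k.
Let Nj j i x := \sum_k partial k F (r i x) * A i j k.

Let W_neq0 i x : O i x -> W i x != 0.
Proof.
by move=> Ox; rewrite -normr_gt0 (lt_le_trans _ (W_ge Ox)) // mulr_gt0.
Qed.

Let cDF (i : I) k z : Om z -> {for z, continuous (partial k F)}.
Proof. by have [[+ _] _ _] := (clsE _ _ _ _ _).1 (CF k) => /(_ i z). Qed.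

(** Implicit differentiation of F (x0 + t v) = 0 without the implicit function
   theorem: with the slopes of F at r(x), the increment of t satisfies a
   linear equation whose coefficient converges to W, which does not vanish. *)
Let t_derive i x j : O i x ->
  is_derive x (delta_mx 0 j) (t i) (- (t i x * Nj j i x) / W i x).
Proof.
move=> Ox; have Omx := rOm (OE Ox).
have nOm : \forall z \near r i x, Om z by apply: open_nbhs_nbhs.
have [||S [Scvg Seq]] := @caratheodory_slope R q F (r i x).
- by apply: filterS nOm => z Oz k; exact: dF.
- by move=> k; exact: (cDF i).
have xE : (fun e : R => e *: delta_mx 0 j + x) @ 0^' --> x.
  apply: cvg_within_filter; rewrite -[in X in _ --> X](add0r x).
  apply: cvgD; last exact: cvg_cst.
  rewrite -[X in _ --> X](scale0r (delta_mx 0 j)).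
  by apply: cvgZr_tmp; exact: cvg_id.
have nO : \forall e \near (0 : R)^', O i (e *: delta_mx 0 j + x).
  by apply: xE; apply: open_nbhs_nbhs.
have tE : t i (e *: delta_mx 0 j + x) @[e --> 0^'] --> t i x.
  exact: cvg_comp xE (t_cont Ox).
have rE : r i (e *: delta_mx 0 j + x) @[e --> 0^'] --> r i x.
  exact: r_cvg xE tE.
have vE k : v i (e *: delta_mx 0 j + x) 0 k @[e --> 0^'] --> v i x 0 k.
  exact: (@cvg_rV R q _ 0^' _ _ (v i x)).2 (v_cvg _ xE) k.
have SE k : S k (r i (e *: delta_mx 0 j + x)) @[e --> 0^'] --> partial k F (r i x).
  exact: cvg_comp rE (Scvg k).
pose W' e := \sum_k S k (r i (e *: delta_mx 0 j + x)) * v i (e *: delta_mx 0 j + x) 0 k.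
pose N' e := \sum_k S k (r i (e *: delta_mx 0 j + x)) * A i j k.
have W'cvg : W' e @[e --> 0^'] --> W i x.
  by apply: cvg_sum_ord => k; exact: cvgM (SE k) (vE k).
have N'cvg : N' e @[e --> 0^'] --> Nj j i x.
  by apply: cvg_sum_ord => k; apply: cvgM (SE k) _; exact: cvg_cst.
have nE : \forall e \near 0^', - (t i x * N' e) / W' e =
    e^-1 *: (t i (e *: delta_mx 0 j + x) - t i x).
  have nW : \forall e \near 0^', W' e != 0.
    by apply: (cvgr_neq0 _ W'cvg); exact: W_neq0.
  have ne0 : \forall e \near (0 : R)^', e != 0 by exact: nbhs_dnbhs_neq.
  have nS := rE _ Seq.
  near=> e.
  have e0 : e != 0 by near: e.
  have W0 : W' e != 0 by near: e.
  have Oy : O i (e *: delta_mx 0 j + x) by near: e.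
  have : F (r i (e *: delta_mx 0 j + x)) - F (r i x) = \sum_k S k (r i (e *: delta_mx 0 j + x)) *
     (r i (e *: delta_mx 0 j + x) 0 k - r i x 0 k) by near: e.
  rewrite !Fr; [|exact: OE|exact: OE]; rewrite subrr.
  have -> : \sum_k S k (r i (e *: delta_mx 0 j + x)) *
     (r i (e *: delta_mx 0 j + x) 0 k - r i x 0 k) =
     (t i (e *: delta_mx 0 j + x) - t i x) * W' e + e * (t i x * N' e).
    rewrite !mulr_sumr -big_split /=; apply: eq_bigr => k _.
    have -> : r i x 0 k = x0 i 0 k + t i x * v i x 0 k by rewrite !mxE.
    have -> : r i (e *: delta_mx 0 j + x) 0 k =
      x0 i 0 k + t i (e *: delta_mx 0 j + x) * v i (e *: delta_mx 0 j + x) 0 k.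
      by rewrite !mxE.
    have -> : v i (e *: delta_mx 0 j + x) 0 k = v i x 0 k + e * A i j k.
      by rewrite /v mulmxDl -scalemxAl -rowE !mxE; ring.
    by ring.
  rewrite /GRing.scale /=.
  move: (t i (e *: delta_mx 0 j + x)) (t i x) (W' e) (N' e) W0 => a b w n W0 E0.
  have -> : a - b = - (e * (b * n)) / w.
    apply: (mulIf W0); rewrite divfK //; apply/eqP; rewrite -addr_eq0.
    by rewrite -E0.
  by field; apply/andP.
have Q1 : e^-1 *: (t i (e *: delta_mx 0 j + x) - t i x) @[e --> 0^'] -->
    - (t i x * Nj j i x) / W i x.
  apply: cvg_trans (near_eq_cvg nE) _; apply: cvgM.
    by apply: cvgN; apply: cvgM N'cvg; exact: cvg_cst.
  by apply: cvgV W'cvg; exact: W_neq0.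
by apply: DeriveDef; [exact: cvgP Q1|exact: cvg_lim Q1].
Unshelve. all: by end_near. Qed.

Local Notation T N s f := (cls O E N (hweight h s) f).

Let v_derive i x j k : is_derive x (delta_mx 0 j) (fun y => v i y 0 k) (A i j k).
Proof. exact: is_derive_affine. Qed.

Let A_T N j k : T N 2 (fun i _ => A i j k).
Proof. by apply: (@cls_cst _ _ _ _ _ oO N _ _ C C0) => i; rewrite /hweight expr1. Qed.

(** An affine function: grade 1 reflects its size h, and its first derivatives
   have size h as well. *)
Let v_T N k : T N 1 (fun i x => v i x 0 k).
Proof.
apply/gradedE; split.
- split=> i x ix; first exact: ((@continuous_coord R p q (v i) x).1 (@v_cont i x) k).
  exists (v i x 0 k).
  exact: ((@cvg_rV R q _ (within (O i) (nbhs x)) _ (v i) (v i x)).2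
    (@v_cvg _ (within (O i) (nbhs x)) _ id i x (@cvg_within _ _ _ _)) k).
- by exists C => // i x Ox; rewrite /hweight expr1; exact: v_le.
- case: N => //= N j; split=> [i x Ox|]; first by case: (v_derive i x j k).
  apply: (@eq_cls _ _ _ _ _ oO _ _ (fun i _ => A i j k)); last exact: A_T.
  by move=> i x Ox; case: (v_derive i x j k).
Qed.

(** Grades of d_j r = (d_j t) v + t d_j v: both products have grade 2. *)
Let r_gcls N : T N 0 t -> forall k, gcls O E N (hweight h 2) (fun i x => r i x 0 k).
Proof.
case: N => //= N Tt k j; have [_ _ dt] := (gradedE _ _ _ _ _ _).1 Tt.
have [d ct] := dt j.
have dr i x : O i x -> is_derive x (delta_mx 0 j) (fun y => r i y 0 k)
    (partial j (t i) x * v i x 0 k + t i x * A i j k).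
  move=> Ox.
  have rE : (fun y => r i y 0 k) = (fun y => x0 i 0 k + t i y * v i y 0 k).
    by apply/funext => y; rewrite !mxE.
  rewrite rE; apply: is_derive_addl.
  apply: is_derive_mul (v_derive i x j k).
  exact: derivableP (d i x Ox).
split=> [i x Ox|]; first by case: (dr i x Ox).
apply: (@eq_cls _ _ _ _ _ oO _ _ (fun i x =>
    partial j (t i) x * v i x 0 k + t i x * A i j k)).
  by move=> i x Ox; case: (dr i x Ox).
apply: clsD => //.
  exact: (graded_mul h01 oO ct (v_T N k)).
exact: (graded_mul h01 oO (cls_le (leqnSn N) Tt) (A_T N j k)).
Qed.

(** Bootstrap in the order N. From t of grade 0 up to order N one gets N_j and
   W up to order N, and then d_j t = - t N_j / W up to order N. *)
Lemma radial_parameter_cls N : (N <= M.+1)%N -> T N 0 t.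
Proof.
have bt : bdd O (hweight h 0%N 0%N) t.
  by exists C => // i x Ox; rewrite /hweight mulr1; exact: t_le.
elim: N => [|N IH] NM; first by apply/gradedE; split.
have Tt := IH (ltnW NM); have gr := r_gcls Tt.
have CFN k := cls_le (ltnSE NM) (CF k).
have P k := @graded_comp _ _ _ h01 _ _ _ oO N q (fun=> Om) (fun=> set0) (fun=> partial k F)
  r (fun=> oOm) radial_inner (CFN k) gr.
have TP k := (P k).2; have gP k := (P k).1.
(* As a product N_j has grade 2 only. The bound O(h^2) on its values repairs
   order 0, and its derivatives d_l (grad F (r)) . d_j v have grade 2 + 2. *)
have TN j : T N 3 (Nj j).
  apply/gradedE; split.
  - have TN2 : T N 2 (Nj j).
      apply: cls_sum => // k; exact: (graded_mul h01 oO (TP k) (A_T N j k)).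
    by have [+ _ _] := (gradedE _ _ _ _ _ _).1 TN2.
  - by exists C => // i x Ox; exact: N_le.
  - case: N {IH NM Tt gr CFN TP} P gP => //= N P gP l.
    have d i x : O i x -> is_derive x (delta_mx 0 l) (Nj j i)
        (\sum_k partial l (partial k F \o r i) x * A i j k).
      move=> Ox.
      apply: is_derive_sumr => k; rewrite -[X in is_derive _ _ _ X]addr0.
      rewrite -(mulr0 (partial k F (r i x))).
      apply: (is_derive_mul (f := partial k F \o r i) (g := fun=> A i j k)).
      exact: derivableP ((gP k l).1 i x Ox).
    split=> [i x Ox|]; first by case: (d i x Ox).
    apply: (@eq_cls _ _ _ _ _ oO _ _ (fun i x =>
       \sum_k partial l (partial k F \o r i) x * A i j k)).
      by move=> i x Ox; case: (d i x Ox).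
    by apply: cls_sum => // k; exact: (graded_mul h01 oO (gP k l).2 (A_T N j k)).
(* As a product W has grade 1. Its values are O(h), as grade 2 requires, and
   d_l W = d_l (grad F (r)) . v + N_l has grade 3. *)
have TW : T N 2 W.
  have TW1 : T N 1 W.
    apply: cls_sum => // k; exact: (graded_mul h01 oO (TP k) (v_T N k)).
  have [rW bW _] := (gradedE _ _ _ _ _ _).1 TW1.
  apply/gradedE; split=> //.
  case: N {IH NM Tt gr CFN TW1} P gP TP TN => //= N P gP TP TN l.
  have d i x : O i x -> is_derive x (delta_mx 0 l) (W i)
      (\sum_k partial l (partial k F \o r i) x * v i x 0 k + Nj l i x).
    move=> Ox.
    rewrite -big_split /=; apply: is_derive_sumr => k.
    apply: (is_derive_mul (f := partial k F \o r i)) (v_derive i x l k).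
    exact: derivableP ((gP k l).1 i x Ox).
  split=> [i x Ox|]; first by case: (d i x Ox).
  apply: (@eq_cls _ _ _ _ _ oO _ _ (fun i x =>
     \sum_k partial l (partial k F \o r i) x * v i x 0 k + Nj l i x)).
    by move=> i x Ox; case: (d i x Ox).
  apply: clsD => //; last exact: cls_le (leqnSn N) (TN l).
  by apply: cls_sum => // k; exact: (graded_mul h01 oO (gP k l).2 (v_T N k)).
apply/gradedE; split=> // j; split=> [i x Ox|]; first by case: (t_derive j Ox).
apply: (@eq_cls _ _ _ _ _ oO _ _ (fun i x => - (t i x * Nj j i x) / W i x)).
  by move=> i x Ox; case: (t_derive j Ox).
apply: (@graded_div _ _ _ h01 _ _ _ oO N 1 1 _ _ c c0) => //.
apply: clsN => //; exact: (graded_mul h01 oO Tt (TN j)).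
Qed.

Lemma radial_lift_gcls N k : (N <= M.+1)%N ->
  gcls O E N (hweight h 2) (fun i x => r i x 0 k).
Proof. by move=> NM; apply: r_gcls; exact: radial_parameter_cls. Qed.

End Radial_parameter.

(** * Coordinates of a point of the surface *)

Lemma sum2 (R : realType) (f : 'I_2 -> R) k : \sum_(a < 2) f a = f k + f (rev_ord k).
Proof.
rewrite big_ord_recl big_ord1.
case: k => -[|[|//]] lt; last rewrite [RHS]addrC.
  by congr (f _ + f _); apply: val_inj.
by congr (f _ + f _); apply: val_inj.
Qed.

Lemma cramer2 (R : realType) (a b c d x y u v : R) :
  a * x + b * y = u -> c * x + d * y = v -> a * d - b * c != 0 ->
  x = (d * u - b * v) / (a * d - b * c).
Proof. by move=> <- <- D0; field. Qed.

Section Chart_coordinates.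
Variables (R : realType) (I : Type) (h : I -> R).
Hypothesis h01 : forall i, 0 < h i <= 1.
Variables (p q : nat) (O E : I -> set 'rV[R]_p).
Hypothesis oO : forall i, open (O i).
Variables (V : I -> set 'rV[R]_2) (g : I -> 'rV[R]_2 -> 'rV[R]_q) (M : nat).
Hypothesis oV : forall i, open (V i).
Hypothesis dg : forall i k l z, V i z ->
  derivable (fun y => g i y 0 l) z (delta_mx 0 k).
Hypothesis Cg : forall k l,
  cls V (fun _ => set0) M (fun _ _ => 1) (fun i => partial k (fun y => g i y 0 l)).
Variables (r : I -> 'rV[R]_p -> 'rV[R]_q) (s : I -> 'rV[R]_p -> 'rV[R]_2).
Hypothesis sV : inner O E V s.
Hypothesis gs : forall i x, O i x -> g i (s i x) = r i x.
Hypothesis Cr : forall l, gcls O E M.+1 (hweight h 2) (fun i x => r i x 0 l).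

Let Dg i a l z := partial a (fun y => g i y 0 l) z.
(** The Gram matrix of the two tangent vectors of the chart; [gdet] is its
   determinant, written so that the index k of the unknown comes first. *)
Let Gr i z a b := \sum_l Dg i a l z * Dg i b l z.
Let gdet i z k := Gr i z k k * Gr i z (rev_ord k) (rev_ord k) -
  Gr i z k (rev_ord k) * Gr i z (rev_ord k) k.
Variable c : R.
Hypothesis c0 : 0 < c.
Hypothesis det_ge : forall i z k, V i z -> c <= `|gdet i z k|.

Let pr i x j a := \sum_l Dg i a l (s i x) * partial j (fun y => r i y 0 l) x.

Let r_der i l x j : O i x -> derivable (fun y => r i y 0 l) x (delta_mx 0 j).
Proof. by move=> Ox; have [+ _] := Cr l j; apply. Qed.

Let det_neq0 i z k : V i z -> gdet i z k != 0.
Proof. by move=> Vz; rewrite -normr_gt0 (lt_le_trans c0) // det_ge. Qed.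

(** The derivatives of s exist by the argument used for t: multiplying the
   increments of r = g(s) by the transpose of Dg gives a two by two linear
   system whose matrix converges to the Gram matrix. *)
Let s_derive i x j k : O i x -> is_derive x (delta_mx 0 j) (fun y => s i y 0 k)
  ((Gr i (s i x) (rev_ord k) (rev_ord k) * pr i x j k
     - Gr i (s i x) k (rev_ord k) * pr i x j (rev_ord k)) / gdet i (s i x) k).
Proof.
move=> Ox; have [sVm cs _] := sV; have Vx := sVm i x Ox.
have nV : \forall z \near s i x, V i z by apply: open_nbhs_nbhs.
have /choice[S SP] : forall l : 'I_q, exists A : 'I_2 -> 'rV_2 -> R,
    (forall k, A k y @[y --> s i x] --> Dg i k l (s i x)) /\
    \forall y \near s i x, g i y 0 l - g i (s i x) 0 l = \sum_k A k y * (y 0 k - s i x 0 k).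
  move=> l; apply: (@caratheodory_slope R 2 (fun y => g i y 0 l)).
    by apply: filterS nV => z Vz m; exact: dg.
  move=> m; have [[cm _] _ _] := (clsE _ _ _ _ _).1 (Cg m l).
  exact: cm.
have xE : (fun e : R => e *: delta_mx 0 j + x) @ 0^' --> x.
  apply: cvg_within_filter; rewrite -[in X in _ --> X](add0r x).
  apply: cvgD; last exact: cvg_cst.
  rewrite -[X in _ --> X](scale0r (delta_mx 0 j)).
  by apply: cvgZr_tmp; exact: cvg_id.
have nO : \forall e \near (0 : R)^', O i (e *: delta_mx 0 j + x).
  by apply: xE; apply: open_nbhs_nbhs.
have sE : s i (e *: delta_mx 0 j + x) @[e --> 0^'] --> s i x.
  exact: cvg_comp xE (cs i x Ox).
pose y e := e *: delta_mx 0 j + x.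
pose G' e a b := \sum_l Dg i a l (s i x) * S l b (s i (y e)).
pose b' e a := \sum_l Dg i a l (s i x) * (e^-1 * (r i (y e) 0 l - r i x 0 l)).
have SE l b : S l b (s i (y e)) @[e --> 0^'] --> Dg i b l (s i x).
  exact: cvg_comp sE ((SP l).1 b).
have G'cvg a b : G' e a b @[e --> 0^'] --> Gr i (s i x) a b.
  by apply: cvg_sum_ord => l; apply: cvgM (SE l b); exact: cvg_cst.
have b'cvg a : b' e a @[e --> 0^'] --> pr i x j a.
  apply: cvg_sum_ord => l; apply: cvgM; first exact: cvg_cst.
  exact (derivable_cvg (@r_der i l x j Ox)).
pose d' e := G' e k k * G' e (rev_ord k) (rev_ord k) - G' e k (rev_ord k) * G' e (rev_ord k) k.
have d'cvg : d' e @[e --> 0^'] --> gdet i (s i x) k.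
  by apply: cvgB; exact: cvgM (G'cvg _ _) (G'cvg _ _).
have nE : \forall e \near 0^',
    (G' e (rev_ord k) (rev_ord k) * b' e k - G' e k (rev_ord k) * b' e (rev_ord k)) / d' e =
    e^-1 *: (s i (y e) 0 k - s i x 0 k).
  have nd : \forall e \near 0^', d' e != 0.
    by apply: (cvgr_neq0 _ d'cvg); exact: det_neq0.
  have ne0 : \forall e \near (0 : R)^', e != 0 by exact: nbhs_dnbhs_neq.
  have nS l := sE _ (SP l).2.
  near=> e.
  have e0 : e != 0 by near: e.
  have d0 : d' e != 0 by near: e.
  have Oy : O i (y e) by near: e.
  have rl : forall l, r i (y e) 0 l - r i x 0 l =
      \sum_m S l m (s i (y e)) * (s i (y e) 0 m - s i x 0 m).
    rewrite -!gs //; near: e; apply: filter_forall => l; exact: nS.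
  have eq a : G' e a k * (e^-1 * (s i (y e) 0 k - s i x 0 k)) +
      G' e a (rev_ord k) * (e^-1 * (s i (y e) 0 (rev_ord k) - s i x 0 (rev_ord k))) = b' e a.
    rewrite /G' /b' !mulr_suml -big_split /=; apply: eq_bigr => l _.
    by rewrite rl (sum2 _ k); ring.
  by apply/esym; apply: cramer2 (eq k) (eq (rev_ord k)) d0.
have Q1 : e^-1 *: (s i (e *: delta_mx 0 j + x) 0 k - s i x 0 k) @[e --> 0^'] -->
    (Gr i (s i x) (rev_ord k) (rev_ord k) * pr i x j k
     - Gr i (s i x) k (rev_ord k) * pr i x j (rev_ord k)) / gdet i (s i x) k.
  apply: cvg_trans (near_eq_cvg nE) _; apply: cvgM.
    by apply: cvgB; exact: cvgM (G'cvg _ _) (b'cvg _).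
  by apply: cvgV d'cvg; exact: det_neq0.
by apply: DeriveDef; [exact: cvgP Q1|exact: cvg_lim Q1].
Unshelve. all: by end_near. Qed.

Local Notation T N s f := (cls O E N (hweight h s) f).

(** Induction on the order: the coefficients of the normal equations are
   functions of s, and their derivatives up to order N involve those of s up
   to order N only, while Cramer's formula yields order N + 1. *)
Lemma chart_coordinates_gcls N k : (N <= M.+1)%N ->
  gcls O E N (hweight h 2) (fun i x => s i x 0 k).
Proof.
elim: N k => [//|N IH] k NM j.
split=> [i x Ox|]; first by case: (s_derive j k Ox).
have TD a l : T N 0 (fun i x => Dg i a l (s i x)).
  have [|_] := @graded_comp _ _ _ h01 _ _ _ oO N 2 V (fun=> set0)
     (fun i => partial a (fun y => g i y 0 l)) s oV sV (cls_le (ltnSE NM) (Cg a l)) _.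
    by move=> k'; apply: IH; exact: ltnW.
  by [].
have TG a b : T N 0 (fun i x => Gr i (s i x) a b).
  by apply: cls_sum => // l; exact: (graded_mul h01 oO (TD a l) (TD b l)).
have Tdr l : T N 2 (fun i => partial j (fun y => r i y 0 l)).
  by have [_ c2] := Cr l j; apply: cls_le c2; exact: ltnSE.
have Tp a : T N 2 (fun i x => pr i x j a).
  by apply: cls_sum => // l; exact: (graded_mul h01 oO (TD a l) (Tdr l)).
have Td : T N 0 (fun i x => gdet i (s i x) k).
  apply: clsD => //; first exact: (graded_mul h01 oO (TG _ _) (TG _ _)).
  by apply: clsN => //; exact: (graded_mul h01 oO (TG _ _) (TG _ _)).
apply: (@eq_cls _ _ _ _ _ oO _ _ (fun i x =>
  (Gr i (s i x) (rev_ord k) (rev_ord k) * pr i x j k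
     - Gr i (s i x) k (rev_ord k) * pr i x j (rev_ord k)) / gdet i (s i x) k)).
  by move=> i x Ox; case: (s_derive j k Ox).
apply: (@graded_div _ _ _ h01 _ _ _ oO N 0 2 _ _ c c0) => //.
  by move=> i x Ox; rewrite expr0 mulr1; apply: det_ge; case: sV => sVm _ _; exact: sVm.
apply: clsD => //; first exact: (graded_mul h01 oO (TG _ _) (Tp _)).
by apply: clsN => //; exact: (graded_mul h01 oO (TG _ _) (Tp _)).
Qed.

End Chart_coordinates.

(** * Lengths, simplices and the tubular neighbourhood *)

Section Euclidean_norm.
Variables (R : realType) (p : nat).
Implicit Types (x y : 'rV[R]_p).

Lemma enorm_ge0 x : 0 <= enorm x.
Proof. exact: sqrtr_ge0. Qed.

Lemma norm_le_enorm x : `|x| <= enorm x.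
Proof.
apply: rV_norm_le => [|k]; first exact: enorm_ge0.
rewrite -sqrtr_sqr; apply: ler_wsqrtr; rewrite (bigD1 k) //= lerDl.
by apply: sumr_ge0 => j _; exact: sqr_ge0.
Qed.

Lemma enorm_le_norm x : enorm x <= p%:R * `|x|.
Proof.
have -> : p%:R * `|x| = Num.sqrt ((p%:R * `|x|) ^+ 2).
  by rewrite sqrtr_sqr ger0_norm // mulr_ge0.
apply: ler_wsqrtr; apply: (@le_trans _ _ (\sum_(j < p) `|x| ^+ 2)).
  apply: ler_sum => j _; rewrite -real_normK ?num_real // ler_sqr ?nnegrE //.
  exact: rV_coord_le.
rewrite sumr_const card_ord exprMn -[leLHS]mulr_natl ler_wpM2r ?sqr_ge0 //.
by case: (p) => [|n]; rewrite ?expr0n // expr2 ler_peMr // ler1n.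
Qed.

Lemma enormZ (a : R) x : enorm (a *: x) = `|a| * enorm x.
Proof.
rewrite /enorm -sqrtr_sqr -sqrtrM ?sqr_ge0 // mulr_sumr; congr Num.sqrt.
by apply: eq_bigr => j _; rewrite !mxE exprMn.
Qed.

Lemma enorm_mulmx q (Q : 'M[R]_(p, q)) x : Q *m Q^T = 1%:M ->
  enorm (x *m Q) = enorm x.
Proof.
have enE n (y : 'rV[R]_n) : enorm y = Num.sqrt ((y *m y^T) 0 0).
  by rewrite /enorm mxE; congr Num.sqrt; apply: eq_bigr => j _; rewrite mxE expr2.
by move=> QQ; rewrite !enE trmx_mul mulmxA -(mulmxA x) QQ mulmx1.
Qed.

End Euclidean_norm.

Section Hulls.
Variables (R : realType) (k p : nat) (P : 'M[R]_(k, p)).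

Lemma simplex_le1 (a : 'rV[R]_k) i : @std_simplex R k a -> 0 <= a 0 i <= 1.
Proof.
move=> [a0 a1]; rewrite a0 /= -a1 (bigD1 i) //= lerDl.
by apply: sumr_ge0 => j _; exact: a0.
Qed.

Lemma hull_bounded : exists B : R, forall x, hull P x -> `|x| <= B.
Proof.
exists (\sum_i \sum_j `|P i j|) => _ [a /simplex_le1 a1 <-].
apply: rV_norm_le => [|j]; first by do 2 apply: sumr_ge0 => ? _.
rewrite mxE (le_trans (ler_norm_sum _ _ _)) //; apply: ler_sum => i _.
have /andP[ai0 ai1] := a1 i.
rewrite normrM (ger0_norm ai0) (bigD1 j) //=.
rewrite (@le_trans _ _ `|P i j|) ?ler_piMl // lerDl.
by apply: sumr_ge0 => ? _.
Qed.

Lemma hull_diam x y : hull P x -> hull P y -> enorm (x - y) <= diam (hull P).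
Proof.
move=> Px Py; apply: ub_le_sup; last by exists x, y.
have [B PB] := hull_bounded.
exists (p%:R * (B + B)) => _ [u [w [Pu Pw ->]]].
apply: le_trans (enorm_le_norm _) _; rewrite ler_wpM2l //.
by rewrite (le_trans (ler_normB _ _)) // lerD ?PB.
Qed.

Lemma row_hull i : hull P (row i P).
Proof.
exists (delta_mx 0 i); last by rewrite rowE.
split=> [j|]; first by rewrite mxE; case: eqP => //= _; case: eqP.
rewrite (bigD1 i) //= mxE !eqxx big1 ?addr0 // => j ji.
by rewrite mxE (negPf ji) andbF.
Qed.

Lemma hull_convex x y (t : R) : 0 <= t <= 1 -> hull P x -> hull P y ->
  hull P ((1 - t) *: x + t *: y).
Proof.
move=> /andP[t0 t1] [a [a0 a1] <-] [b [b0 b1] <-].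
exists ((1 - t) *: a + t *: b); last by rewrite mulmxDl -!scalemxAl.
split=> [i|]; first by rewrite !mxE addr_ge0 // mulr_ge0 ?subr_ge0.
under eq_bigr do rewrite !mxE.
by rewrite big_split /= -!mulr_sumr a1 b1 !mulr1 subrK.
Qed.

End Hulls.

Lemma mesh_size_ge (R : realType) (Th : seq 'M[R]_(4, 3)) T :
  T \in Th -> diam (hull T) <= mesh_size Th.
Proof. by move=> TTh; exact: (le_bigmax_seq 0 T xpredT (fun T => diam (hull T)) TTh). Qed.

Lemma hull_row_perm (R : realType) k p (P : 'M[R]_(k, p)) (sigma : 'S_k) :
  hull (row_perm sigma P) = hull P.
Proof.
have sub (Q : 'M[R]_(k, p)) (tau : 'S_k) : hull (row_perm tau Q) `<=` hull Q.
  move=> _ [a [a0 a1] <-]; exists (col_perm tau^-1%g a).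
    split=> [i|]; first by rewrite mxE.
    rewrite -[RHS]a1 [RHS](reindex_inj (@perm_inj _ tau^-1%g)) /=.
    by apply: eq_bigr => i _; rewrite mxE.
  apply/rowP => j; rewrite !mxE [RHS](reindex_inj (@perm_inj _ tau^-1%g)) /=.
  by apply: eq_bigr => i _; rewrite !mxE permKV.
apply/seteqP; split; first exact: sub.
have -> : hull P = hull (row_perm sigma^-1%g (row_perm sigma P)).
  by rewrite -row_permM mulVg row_perm1.
exact: sub.
Qed.

Section Distance.
Variables (R : realType) (p : nat) (A : set 'rV[R]_p).

Lemma dist_le x y : A y -> dist A x <= enorm (x - y).
Proof.
move=> Ay; apply: ge_inf; last by exists y.
by exists 0 => _ [z _ <-]; exact: enorm_ge0.
Qed.

Lemma dist_ge0 x : 0 <= dist A x.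
Proof.
have [->|/set0P[y Ay]] := eqVneq A set0; first by rewrite /dist image_set0 inf0.
apply: lb_le_inf; first by exists (enorm (x - y)), y.
by move=> _ [z _ <-]; exact: enorm_ge0.
Qed.

End Distance.

Section Tube.
Variables (R : realType) (m : nat) (U : set 'rV[R]_3) (F : 'rV[R]_3 -> R).
Let Gamma := zero_set U F.

(** The sup norm is the one for which mean values are available, see
   [mvt_box]. *)
Definition tube (G : set 'rV[R]_3) (delta : R) : set 'rV[R]_3 :=
  [set x | exists2 y, G y & `|x - y| < delta].

Lemma open_tube G delta : open (tube G delta).
Proof.
have -> : tube G delta = \bigcup_(y in G) ball y delta.
  apply/seteqP; split=> x [y Gy xy]; exists y => //; move: xy;
  by rewrite -ball_normE /ball_ /= distrC.
by apply: bigcup_open => y _; exact: ball_open.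
Qed.

Lemma compact_tube (G : set 'rV[R]_3) (delta : R) : compact G ->
  compact [set x : 'rV[R]_3 | exists2 y, G y & `|x - y| <= delta].
Proof.
move=> cG.
have -> : [set x : 'rV[R]_3 | exists2 y, G y & `|x - y| <= delta] =
    (fun z : 'rV[R]_3 * 'rV[R]_3 => z.1 + z.2) @`
      (G `*` [set w | `|w| <= delta]).
  apply/seteqP; split=> [x [y Gy xy]|_ [[y w] [Gy wd] <-]].
    by exists (y, x - y) => //=; rewrite addrC subrK.
  by exists y => //=; rewrite addrC addKr.
apply: continuous_compact.
  by apply: continuous_subspaceT; exact: add_continuous.
apply: compact_setX => //; apply: bounded_closed_compact.
  by exists delta; split; [exact: num_real|move=> e de w /= /le_trans; apply; exact: ltW].
rewrite (_ : [set w | _] = Num.norm @^-1` [set e : R | e <= delta]) //.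
by apply: preimage_closed => [w _|]; [exact: norm_continuous|exact: closed_le].
Qed.

(** Compactness of the surface: on the closure of a thin tube continuous
   functions are bounded, which gives uniform bounds on all derivatives of F,
   and the squared gradient has a positive minimum on the surface. *)
Lemma surface_tube : surface_setting m U F ->
  exists delta c0 : R, [/\ 0 < delta, 0 < c0, tube Gamma delta `<=` U,
    forall y, Gamma y -> exists j, c0 <= `|partial j F y| &
    forall (I : Type) N (f : 'rV[R]_3 -> R), Ck N U f ->
      cls (fun _ : I => tube Gamma delta) (fun _ => set0) N (fun _ _ => 1) (fun _ => f)].
Proof.
move=> [_ CF [G0 cG _] [e e0 eP]].
pose delta : R := e / 4.
have d0 : 0 < delta by rewrite divr_gt0.
pose Z := [set x : 'rV[R]_3 | exists2 y, Gamma y & `|x - y| <= delta].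
have cZ : compact Z by exact: compact_tube.
have near_dist x : Z x -> dist Gamma x < e.
  move=> [y Gy xy]; apply: le_lt_trans (dist_le x Gy) _.
  apply: le_lt_trans (enorm_le_norm _) _.
  apply: le_lt_trans (ler_wpM2l _ xy) _ => //.
  by rewrite /delta; lra.
have ZU : Z `<=` U by move=> x /near_dist /eP[].
have Z0 : Z !=set0 by case: G0 => y Gy; exists y, y => //; rewrite subrr normr0 ltW.
have tZ : tube Gamma delta `<=` Z by move=> x [y Gy /ltW xy]; exists y.
have [_ cdF] := CF.
pose q x := \sum_j partial j F x ^+ 2.
have cq x : U x -> {for x, continuous q}.
  move=> Ux; apply: (@cvg_sum_ord R _ (nbhs x) _ 3
     (fun j y => partial j F y ^+ 2) (fun j => partial j F x ^+ 2)) => j.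
  have [_ [cj _]] := cdF j.
  by apply: cvgM; exact: (cj x Ux).
have [y Gy ymin] : exists2 y, y \in Gamma & forall t, t \in Gamma -> q y <= q t.
  apply: EVT_min_rV => //; apply: continuous_in_subspaceT => x.
  by rewrite inE => -[Ux _]; exact: cq.
have qy : 0 < q y.
  have Zy : Z y by exists y; rewrite ?inE // ?subrr ?normr0 ?ltW //; move: Gy; rewrite inE.
  have [_ [j dj]] := eP y (near_dist y Zy).
  rewrite /q (bigD1 j) //= ltr_pwDl //; last by apply: sumr_ge0 => i _; exact: sqr_ge0.
  by rewrite lt_neqAle sqr_ge0 eq_sym sqrf_eq0 dj.
exists delta, (Num.sqrt (q y / 3)); split=> //.
- by rewrite sqrtr_gt0 divr_gt0.
- by move=> x /tZ /ZU.
- move=> x Gx; apply: contrapT => nj.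
  suff : q x < q y by apply/negP; rewrite -leNgt; apply: ymin; rewrite inE.
  have lt j : partial j F x ^+ 2 < q y / 3.
    rewrite ltNge; apply/negP => le; apply: nj; exists j.
    by rewrite -sqrtr_sqr; exact: ler_wsqrtr.
  apply: (@lt_le_trans _ _ (\sum_(j < 3) (q y / 3))).
    apply: ltr_sum => [|j _]; last exact: lt.
    by apply/hasP; exists ord0; rewrite ?mem_index_enum.
  by rewrite sumr_const card_ord -(mulr_natr (q y / 3) 3) divfK ?pnatr_eq0.
- have bound (f : 'rV[R]_3 -> R) : (forall x, U x -> {for x, continuous f}) ->
      exists2 C : R, 0 <= C & forall x, tube Gamma delta x -> `|f x| <= C * 1.
    move=> cf; have [z Zz zmax] : exists2 z, z \in Z &
        forall t, t \in Z -> `|f t| <= `|f z|.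
      apply: (@EVT_max_rV R 3 (fun x => `|f x|)) => //.
      apply: continuous_in_subspaceT => x; rewrite inE => /ZU Ux.
      by apply: (@continuous_comp _ _ _ f Num.norm); [exact: cf|exact: norm_continuous].
    by exists `|f z| => // x /tZ Zx; rewrite mulr1; apply: zmax; rewrite inE.
  move=> I; elim=> [|N IH] f Cf.
    split=> //; first by split=> // _ x /tZ /ZU Ux; exact: Cf.
    by have [C C0 CP] := bound f Cf; exists C.
  have [cf df] := Cf; apply/clsS; split.
  + by split=> // _ x /tZ /ZU Ux; exact: cf.
  + by have [C C0 CP] := bound f cf; exists C.
  + move=> j; have [d c] := df j; split; last exact: IH.
    by move=> _ x /tZ /ZU Ux; exact: d.
Qed.

End Tube.

(** * A level function near its zero set *)

Lemma zero_on_segment (R : realType) (p : nat) (f : 'rV[R]_p -> R) (x y : 'rV[R]_p) :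
  (forall t : R, 0 <= t <= 1 -> {for (1 - t) *: x + t *: y, continuous f}) ->
  f x * f y <= 0 ->
  exists2 t : R, 0 <= t <= 1 & f ((1 - t) *: x + t *: y) = 0.
Proof.
move=> cf fxy; pose g (t : R) := f ((1 - t) *: x + t *: y).
have cl : continuous (fun t : R => (1 - t) *: x + t *: y).
  move=> t; apply: cvgD.
    apply: cvgZr_tmp; apply: cvgB; [exact: cvg_cst|exact: cvg_id].
  by apply: cvgZr_tmp; exact: cvg_id.
have [||t tI gt] := @IVT R g 0 1 0 ler01.
- apply: continuous_in_subspaceT => t; rewrite inE /= in_itv /= => t01.
  by apply: (@continuous_comp _ _ _ (fun t : R => (1 - t) *: x + t *: y) f);
    [exact: cl|exact: cf].
- have -> : g 0 = f x by rewrite /g subr0 scale1r scale0r addr0.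
  have -> : g 1 = f y by rewrite /g subrr scale1r scale0r add0r.
  apply/andP; split.
    by rewrite leNgt lt_min; apply/negP => /andP[fx fy]; nra.
  by rewrite leNgt gt_max; apply/negP => /andP[fx fy]; nra.
- by exists t => //; move: tI; rewrite in_itv.
Qed.

(** The slope D is close to a, so the increment D B has the sign of a B,
   opposite to that of A, and at least half the size of a B, which is enough
   to reach or pass 0 from A. *)
Lemma level_sign (R : realType) (A B D a c0 : R) : 0 < c0 -> c0 <= `|a| -> `|D - a| <= c0 / 2 ->
  A * (a * B) <= 0 -> `|A| <= c0 / 2 * `|B| -> A * (A + D * B) <= 0.
Proof.
move=> c00 ca Da AaB AB.
have Aab : A * (D * B) <= - (`|A| * (c0 / 2 * `|B|)).
  have [a0|a0] := leP 0 a.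
    have D1 : c0 / 2 <= D.
      by move: Da ca; rewrite (ger0_norm a0) ler_norml => /andP[]; lra.
    have AB0 : A * B <= 0.
      have : a * (A * B) <= 0 by rewrite mulrCA.
      by rewrite pmulr_rle0 // (lt_le_trans c00) // -(ger0_norm a0).
    have -> : `|A| * (c0 / 2 * `|B|) = c0 / 2 * `|A * B| by rewrite normrM; ring.
    rewrite ler0_norm // mulrN opprK mulrCA.
    by rewrite -subr_ge0 -mulrBl; apply: mulr_le0; rewrite ?subr_le0.
  have D1 : D <= - (c0 / 2).
    by move: Da ca; rewrite (ltr0_norm a0) ler_norml => /andP[]; lra.
  have AB0 : 0 <= A * B.
    have : a * (A * B) <= 0 by rewrite mulrCA.
    by rewrite nmulr_rle0.
  have -> : `|A| * (c0 / 2 * `|B|) = c0 / 2 * `|A * B| by rewrite normrM; ring.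
  rewrite ger0_norm // mulrCA -subr_ge0 -mulNr -mulrBl.
  by apply: mulr_ge0 => //; rewrite subr_ge0.
rewrite mulrDr -expr2 -real_normK ?num_real // expr2.
apply: le_trans (lerD (ler_wpM2l (normr_ge0 A) AB) Aab) _.
by rewrite subrr.
Qed.

Section Near_surface.
Variables (R : realType) (G : set 'rV[R]_3) (F : 'rV[R]_3 -> R) (delta C : R).
Let Om := tube G delta.
Hypothesis C0 : 0 <= C.
Hypothesis G0 : forall x, Om x -> F x = 0 <-> G x.
Hypothesis cF : forall x, Om x -> {for x, continuous F}.
Hypothesis dF : forall k x, Om x -> derivable F x (delta_mx 0 k).
Hypothesis F1 : forall k x, Om x -> `|partial k F x| <= C.
Hypothesis ddF : forall k l x, Om x -> derivable (partial k F) x (delta_mx 0 l).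
Hypothesis F2 : forall k l x, Om x -> `|partial l (partial k F) x| <= C.

Lemma level_lipschitz y z : G y -> `|z - y| < delta -> `|F z| <= 3 * C * `|z - y|.
Proof.
move=> Gy zy.
have Fy : F y = 0 by apply/G0 => //; exists y => //; rewrite subrr normr0 (le_lt_trans _ zy).
have [w k wy|w [wy]] := @mvt_box R 3 F y z.
  by apply: dF; exists y => //; exact: le_lt_trans wy zy.
rewrite Fy subr0 => ->; rewrite (le_trans (ler_norm_sum _ _ _)) //.
apply: (@le_trans _ _ (\sum_(k < 3) C * `|z - y|)); last first.
  by rewrite sumr_const card_ord -[leLHS]mulr_natl mulrA.
apply: ler_sum => k _; rewrite normrM ler_pM //.
  by apply: F1; exists y => //; exact: le_lt_trans (wy k) zy.
by have := rV_coord_le (z - y) k; rewrite !mxE.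
Qed.

Lemma gradient_lipschitz y z k : G y -> `|z - y| < delta ->
  `|partial k F z - partial k F y| <= 3 * C * `|z - y|.
Proof.
move=> Gy zy.
have [w l wy|w [wy]] := @mvt_box R 3 (partial k F) y z.
  by apply: ddF; exists y => //; exact: le_lt_trans wy zy.
move=> ->; rewrite (le_trans (ler_norm_sum _ _ _)) //.
apply: (@le_trans _ _ (\sum_(k < 3) C * `|z - y|)); last first.
  by rewrite sumr_const card_ord -[leLHS]mulr_natl mulrA.
apply: ler_sum => l _; rewrite normrM ler_pM //.
  by apply: F2; exists y => //; exact: le_lt_trans (wy l) zy.
by have := rV_coord_le (z - y) l; rewrite !mxE.
Qed.

Variables (y : 'rV[R]_3) (h : R).
Hypotheses (Gy : G y) (h0 : 0 < h) (hd : 3 * h < delta).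

Lemma gradient_near w k : `|w - y| <= 3 * h ->
  `|partial k F w - partial k F y| <= 9 * C * h.
Proof.
move=> wy; apply: le_trans (gradient_lipschitz _ Gy (le_lt_trans wy hd)) _.
have -> : 9 * C * h = 3 * C * (3 * h) by ring.
by rewrite ler_wpM2l // mulr_ge0.
Qed.

(** The increment of a C^2 function between points of a ball of radius h is,
   up to h^2, the slope given by gradients at any points of a comparable ball.
   The points w k may differ from one coordinate to the other, as in
   [mvt_box]. The factor 108 is 3 coordinates times 18 C h, the distance of
   two gradients, times 2 h, the length of the chord. *)
Lemma chord_slope x z (w : 'I_3 -> 'rV[R]_3) : `|x - y| <= h -> `|z - y| <= h ->
  (forall k, `|w k - y| <= 3 * h) ->
  `|\sum_k partial k F (w k) * (z 0 k - x 0 k) - (F z - F x)| <= 108 * C * h ^+ 2.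
Proof.
move=> xy zy wy.
have zx : `|z - x| <= 2 * h.
  rewrite -(subrKA y) (le_trans (ler_normD _ _)) // (distrC y x).
  by rewrite (le_trans (lerD zy xy)) // -mulr2n mulr_natl.
have near_w v : `|v - x| <= `|z - x| -> `|v - y| <= 3 * h.
  move=> vx; rewrite -(subrKA x) (le_trans (ler_normD _ _)) //.
  apply: (le_trans (lerD (le_trans vx zx) xy)).
  by lra.
have Om_w v : `|v - y| <= 3 * h -> Om v by move=> vy; exists y => //; exact: le_lt_trans hd.
have [u k /near_w /Om_w|u [ux ->]] := @mvt_box R 3 F x z; first exact: dF.
rewrite -sumrB; under eq_bigr do rewrite -mulrBl.
rewrite (le_trans (ler_norm_sum _ _ _)) //.
apply: (@le_trans _ _ (\sum_(k < 3) (18 * C * h) * (2 * h))); last first.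
  rewrite sumr_const card_ord -[leLHS]mulr_natl.
  by rewrite le_eqVlt; apply/orP; left; apply/eqP; ring.
apply: ler_sum => k _; rewrite normrM ler_pM //; last first.
  by apply: le_trans zx; have := rV_coord_le (z - x) k; rewrite !mxE.
rewrite -(subrKA (partial k F y)) (le_trans (ler_normD _ _)) //.
have -> : 18 * C * h = 9 * C * h + 9 * C * h by ring.
by rewrite lerD ?gradient_near // distrC gradient_near // near_w.
Qed.

(** If |F x| were small, F would change sign along an axis segment at x of
   length eta h / 2, because one partial derivative is at least c0 / 2 there.
   A zero would then lie too close to x. *)
Lemma level_ge_dist (c0 eta : R) x : 0 < c0 -> (exists j, c0 <= `|partial j F y|) ->
  0 < eta -> eta <= 1 -> 18 * C * h <= c0 -> `|x - y| <= h ->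
  (forall z, G z -> eta * h <= `|x - z|) ->
  c0 * eta / 4 * h <= `|F x|.
Proof.
move=> c00 [j cj] eta0 eta1 hc xy far; rewrite leNgt; apply/negP => Fx.
pose tau := eta * h / 2.
have tau0 : 0 < tau by rewrite divr_gt0 // mulr_gt0.
have tauh : tau <= h.
  rewrite /tau ler_pdivrMr // (le_trans (ler_wpM2r (ltW h0) eta1)) //.
  by rewrite mul1r ler_pMr // ler1n.
(* The direction along the axis j in which F moves towards 0. *)
have [b bt sgn] : exists2 b : R, `|b| = tau & F x * (partial j F y * b) <= 0.
  have [s|s] := leP (F x * partial j F y) 0.
    by exists tau; rewrite ?gtr0_norm // mulrA pmulr_lle0.
  by exists (- tau); rewrite ?normrN ?gtr0_norm // mulrA mulrN oppr_le0 mulr_ge0 // ltW.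
have near_e t : `|t| <= tau -> `|t *: delta_mx 0 j + x - y| <= 2 * h.
  move=> tt; rewrite -addrA (le_trans (ler_normD _ _)) //.
  rewrite normrZ delta_norm mulr1 (le_trans (lerD (le_trans tt tauh) xy)) //.
  by rewrite -mulr2n mulr_natl.
have near3 v : `|v - y| <= 2 * h -> `|v - y| <= 3 * h.
  by move=> /le_trans; apply; rewrite ler_wpM2r ?ler_nat // ltW.
have Om_e v : `|v - y| <= 2 * h -> Om v.
  by move=> /near3 vy; exists y => //; exact: le_lt_trans hd.
have [t|t tt E] := @mvt_line R 3 F x j b.
  by rewrite bt => /near_e /Om_e; exact: dF.
rewrite bt in tt.
have prod : F x * F (b *: delta_mx 0 j + x) <= 0.
  have -> : F (b *: delta_mx 0 j + x) =
      F x + partial j F (t *: delta_mx 0 j + x) * b by rewrite -E addrCA subrr addr0.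
  apply: (level_sign c00 cj _ sgn).
    apply: le_trans (gradient_near _ (near3 _ (near_e t tt))) _.
    by move: hc; lra.
  rewrite bt ltW // (lt_le_trans Fx) // /tau le_eqVlt; apply/orP; left; apply/eqP.
  by field.
have segE s : (1 - s) *: x + s *: (b *: delta_mx 0 j + x) = (s * b) *: delta_mx 0 j + x.
  by rewrite scalerDr scalerBl scale1r scalerA addrCA subrK.
have sb s : 0 <= s <= 1 -> `|s * b| <= tau.
  by move=> /andP[s0 s1]; rewrite normrM bt (ger0_norm s0) ler_piMl // ltW.
have [s s01|s s01] := @zero_on_segment R 3 F x (b *: delta_mx 0 j + x) _ prod.
  by rewrite segE; apply: cF; apply: Om_e; apply: near_e; exact: sb.
rewrite segE => /G0 Gs.
have {}/far : G ((s * b) *: delta_mx 0 j + x) by apply: Gs; apply: Om_e; apply: near_e; exact: sb.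
rewrite opprD addrCA subrr addr0 normrN normrZ delta_norm mulr1.
apply/negP; rewrite -ltNge (le_lt_trans (sb s s01)) // /tau.
by rewrite ltr_pdivrMr // ltr_pMr ?mulr_gt0 // ltr1n.
Qed.

End Near_surface.

(** * The cut tetrahedron *)

Section Row_entries.
Variables (R : realType) (n : nat) (x z : 'rV[R]_n) (k : 'I_n).

Lemma rV_subE : (x - z) 0 k = x 0 k - z 0 k.
Proof. by rewrite !mxE. Qed.

Lemma rV_addZE a : (x + a *: z) 0 k = x 0 k + a * z 0 k.
Proof. by rewrite !mxE. Qed.

End Row_entries.

Section Affine_triangle.
Variables (R : realType) (B : 'M[R]_3).

Definition edge_mx : 'M[R]_(2, 3) := \matrix_(j < 2) (row (lift ord0 j) B - row 0 B).

Definition bary (xi : 'rV[R]_2) : 'rV[R]_3 :=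
  \row_i (if unlift ord0 i is Some j then xi 0 j else 1 - xi 0 0 - xi 0 1).

Lemma baryE xi : [/\ bary xi 0 0 = 1 - xi 0 0 - xi 0 1,
  bary xi 0 (lift ord0 0) = xi 0 0 & bary xi 0 (lift ord0 1) = xi 0 1].
Proof. by rewrite !mxE unlift_none !liftK. Qed.

Lemma sum3E (V : zmodType) (f : 'I_3 -> V) :
  \sum_i f i = f 0 + f (lift ord0 0) + f (lift ord0 1).
Proof.
rewrite big_ord_recl big_ord_recl big_ord1 addrA.
by congr (_ + f _ + f _); apply: val_inj.
Qed.

Lemma affine_paramE xi : affine_param B xi = row 0 B + xi *m edge_mx.
Proof.
rewrite /affine_param -addrA; congr (_ + _).
have -> : (2%:R : 'I_3) = lift ord0 (1 : 'I_2) by exact: val_inj.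
have -> : (1 : 'I_3) = lift ord0 (0 : 'I_2) by exact: val_inj.
apply/rowP => k; rewrite !mxE big_ord_recl big_ord1 !mxE.
have -> : lift ord0 ord0 = 1 :> 'I_2 by exact: val_inj.
by [].
Qed.

Lemma affine_param_bary xi : affine_param B xi = \sum_i bary xi 0 i *: row i B.
Proof.
rewrite /affine_param sum3E; have [-> -> ->] := baryE xi.
have -> : (2%:R : 'I_3) = lift ord0 (1 : 'I_2) by exact: val_inj.
have -> : (1 : 'I_3) = lift ord0 (0 : 'I_2) by exact: val_inj.
by apply/rowP => k; rewrite !mxE; ring.
Qed.

Lemma bary_simplex xi : ref_triangle xi -> @std_simplex R 3 (bary xi).
Proof.
move=> [x0 x1 x01]; split=> [i|]; last first.
  by rewrite sum3E; have [-> -> ->] := baryE xi; ring.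
rewrite mxE; case: unliftP => [j _|_]; last by rewrite -addrA -opprD subr_ge0.
by case: j => -[|[|//]] lt; [move: x0|move: x1];
  congr (_ <= xi _ _); apply: val_inj.
Qed.

Lemma simplex_bary (a : 'rV[R]_3) : @std_simplex R 3 a ->
  exists2 xi, ref_triangle xi & bary xi = a.
Proof.
move=> [a0 a1]; exists (\row_j a 0 (lift ord0 j)).
  split; rewrite ?mxE ?a0 //.
  by move: a1 (a0 0); rewrite sum3E; lra.
apply/rowP => i; rewrite mxE; case: unliftP => [j ->|->]; rewrite !mxE //.
by move: a1; rewrite sum3E; lra.
Qed.

Lemma affine_param_hull : hull B = [set affine_param B xi | xi in @ref_triangle R].
Proof.
apply/seteqP; split=> x.
  move=> [a /simplex_bary[xi xiR xia] <-]; exists xi => //.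
  by rewrite affine_param_bary xia mulmx_sum_row.
move=> [xi /bary_simplex xiR <-]; exists (bary xi) => //.
by rewrite affine_param_bary mulmx_sum_row.
Qed.

End Affine_triangle.

Section Cut_tetrahedron.
Variables (R : realType) (G : set 'rV[R]_3) (F : 'rV[R]_3 -> R) (delta C : R).
Let Om := tube G delta.
Hypothesis C0 : 0 <= C.
Hypothesis G0 : forall x, Om x -> F x = 0 <-> G x.
Hypothesis cF : forall x, Om x -> {for x, continuous F}.
Hypothesis dF : forall k x, Om x -> derivable F x (delta_mx 0 k).
Hypothesis F1 : forall k x, Om x -> `|partial k F x| <= C.
Hypothesis ddF : forall k l x, Om x -> derivable (partial k F) x (delta_mx 0 l).
Hypothesis F2 : forall k l x, Om x -> `|partial l (partial k F) x| <= C.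
Variables (X : 'M[R]_(4, 3)) (y : 'rV[R]_3) (h c1 : R).
Hypotheses (Gy : G y) (Xy : hull X y) (h0 : 0 < h) (hd : 3 * h < delta) (c10 : 0 < c1).
Hypothesis diamX : forall x z, hull X x -> hull X z -> `|x - z| <= h.
Hypothesis FX : forall i, c1 * h <= `|F (row i X)|.
Hypothesis signX : forall i : 'I_3, F (row ord0 X) * F (row (lift ord0 i) X) < 0.
Hypothesis hC : 216 * C * h <= c1.
Let x0 := row ord0 X.
Let B := cut_triangle G X.

Let Om_hull x : hull X x -> Om x.
Proof.
move=> Xx; exists y => //; apply: le_lt_trans (diamX Xx Xy) (le_lt_trans _ hd).
by rewrite ler_peMl ?ler1n // ltW.
Qed.

Let X_x0 : hull X x0. Proof. exact: row_hull. Qed.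

Let Ch2 : 108 * C * h ^+ 2 <= c1 / 2 * h.
Proof.
have -> : 108 * C * h ^+ 2 = (216 * C * h) / 2 * h by field.
by rewrite ler_pM2r // ler_pM2r ?invr_gt0.
Qed.

(** The cut point exists by the intermediate value theorem; it is not x0,
   where F does not vanish, hence tau > 0. *)
Lemma cut_pointP i : G (cut_point G X i) /\
  exists2 tau, 0 < tau <= 1 & cut_point G X i = x0 + tau *: (row (lift ord0 i) X - x0).
Proof.
have segE (s : R) : (1 - s) *: x0 + s *: row (lift ord0 i) X =
    x0 + s *: (row (lift ord0 i) X - x0).
  by rewrite scalerBl scale1r scalerBr addrA addrAC.
have Xs s : 0 <= s <= 1 -> hull X ((1 - s) *: x0 + s *: row (lift ord0 i) X).
  by move=> s01; apply: hull_convex => //; exact: row_hull.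
have [t t01|t t01 Ft] := @zero_on_segment R 3 F x0 (row (lift ord0 i) X) _ (ltW (signX i)).
  by apply: cF; apply: Om_hull; exact: Xs.
have [Gc [u u01 uE]] : (G `&` segment x0 (row (lift ord0 i) X)) (cut_point G X i).
  apply: getPex; exists ((1 - t) *: x0 + t *: row (lift ord0 i) X); split.
    by apply/G0 => //; apply: Om_hull; exact: Xs.
  by exists t => //; rewrite /= in_itv.
split=> //; exists u; last by rewrite -uE segE.
move: u01; rewrite /= in_itv /= => /andP[u0 ->]; rewrite andbT lt_neqAle u0 andbT.
apply/eqP => u00; move: Gc; rewrite -uE -u00 subr0 scale1r scale0r addr0 => /G0.
move=> /(_ (Om_hull X_x0)) Fx0; have := signX i.
by rewrite -/x0 Fx0 mul0r ltxx.
Qed.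

Let rowB i : row i B = cut_point G X i.
Proof. by rewrite rowK. Qed.

Let X_B i : hull X (row i B).
Proof.
rewrite rowB; have [_ [t /andP[/ltW t0 t1] ->]] := cut_pointP i.
have -> : x0 + t *: (row (lift ord0 i) X - x0) = (1 - t) *: x0 + t *: row (lift ord0 i) X.
  by rewrite scalerBl scale1r scalerBr addrA addrAC.
by apply: hull_convex; rewrite ?t0 //; exact: row_hull.
Qed.

Let F_B i : F (row i B) = 0.
Proof. by apply/G0; [exact: Om_hull|rewrite rowB; case: (cut_pointP i)]. Qed.

Let hull_sum n (mu : 'rV[R]_n) (P : 'I_n -> 'rV[R]_3) : @std_simplex R n mu ->
  (forall i, hull X (P i)) -> hull X (\sum_i mu 0 i *: P i).
Proof.
move=> [mu0 mu1] XP; have /choice[a aP] : forall i, exists a, @std_simplex R 4 a /\ a *m X = P i.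
  by move=> i; have [a ? ?] := XP i; exists a.
exists (\sum_i mu 0 i *: a i); last first.
  rewrite mulmx_suml; apply: eq_bigr => i _; rewrite -scalemxAl.
  by rewrite (aP i).2.
split=> [k|].
  by rewrite summxE; apply: sumr_ge0 => i _; rewrite mxE mulr_ge0 //; case: (aP i) => -[].
under eq_bigr do rewrite summxE.
rewrite exchange_big /= -[RHS]mu1; apply: eq_bigr => i _.
under eq_bigr do rewrite mxE.
by rewrite -mulr_sumr; case: (aP i) => -[_ ->] _; rewrite mulr1.
Qed.

(** The chord estimate passes to convex combinations of points because both
   sides are affine in the end point of the chord. On the left the combination
   replaces the point, on the right the values of F are averaged. *)
Let convex_slope n (mu : 'rV[R]_n) (P : 'I_n -> 'rV[R]_3) x (w : 'I_3 -> 'rV[R]_3) :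
  @std_simplex R n mu -> (forall i, hull X (P i)) -> hull X x ->
  (forall k, `|w k - y| <= 3 * h) ->
  `|\sum_k partial k F (w k) * ((\sum_i mu 0 i *: P i) 0 k - x 0 k)
     - (\sum_i mu 0 i * F (P i) - F x)| <= 108 * C * h ^+ 2.
Proof.
move=> [mu0 mu1] XP Xx wy.
have -> : \sum_k partial k F (w k) * ((\sum_i mu 0 i *: P i) 0 k - x 0 k)
     - (\sum_i mu 0 i * F (P i) - F x) =
   \sum_i mu 0 i * (\sum_k partial k F (w k) * (P i 0 k - x 0 k) - (F (P i) - F x)).
  under [RHS]eq_bigr do rewrite !mulrBr.
  rewrite !sumrB -mulr_suml mu1 mul1r; congr (_ - _).
  under [RHS]eq_bigr do rewrite mulr_sumr.
  rewrite exchange_big /=; apply: eq_bigr => k _.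
  have xk : x 0 k = \sum_i mu 0 i * x 0 k by rewrite -mulr_suml mu1 mul1r.
  rewrite summxE {1}xk -sumrB mulr_sumr.
  by apply: eq_bigr => i _; rewrite mxE; ring.
rewrite (le_trans (ler_norm_sum _ _ _)) //.
rewrite [leRHS](_ : _ = \sum_i mu 0 i * (108 * C * h ^+ 2)); last first.
  by rewrite -mulr_suml mu1 mul1r.
apply: ler_sum => i _.
rewrite normrM (ger0_norm (mu0 i)) ler_wpM2l //.
apply: (@chord_slope _ _ _ _ _ C0 dF ddF F2 y h Gy hd) => //; exact: diamX.
Qed.

Let v xi := (row 0 B - x0) + xi *m edge_mx B.

Let vE xi : v xi = affine_param B xi - x0.
Proof. by rewrite affine_paramE /v addrAC. Qed.

Let X_param xi : ref_triangle xi -> hull X (affine_param B xi).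
Proof. by move=> /bary_simplex bs; rewrite affine_param_bary; exact: hull_sum. Qed.

Lemma ray_coord_le xi k : ref_triangle xi -> `|v xi 0 k| <= h.
Proof.
move=> /X_param Xp; rewrite vE.
by apply: le_trans (rV_coord_le _ _) _; exact: diamX.
Qed.

Lemma edge_le j k : `|edge_mx B j k| <= h.
Proof.
have -> : edge_mx B j k = (row (lift ord0 j) B - row 0 B) 0 k by rewrite !mxE.
by apply: le_trans (rV_coord_le _ _) _; exact: diamX.
Qed.

(** Transversality of the rays: the average of F over the vertices of K is 0,
   so the slope along the ray is - F x0 up to h^2, and |F x0| >= c1 h. *)
Lemma ray_slope xi (w : 'I_3 -> 'rV[R]_3) : ref_triangle xi ->
  (forall k, `|w k - y| <= 3 * h) ->
  c1 / 2 * h <= `|\sum_k partial k F (w k) * v xi 0 k|.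
Proof.
move=> /bary_simplex bs wy.
have := convex_slope bs X_B X_x0 wy.
have FB : \sum_i bary xi 0 i * F (row i B) = 0 by rewrite big1 // => i _; rewrite F_B mulr0.
rewrite FB sub0r opprK -affine_param_bary.
have -> : \sum_k partial k F (w k) * (affine_param B xi 0 k - x0 0 k) =
    \sum_k partial k F (w k) * v xi 0 k.
  by apply: eq_bigr => k _; rewrite vE rV_subE.
move=> S; have S2 := le_trans S Ch2; have := FX ord0; rewrite -/x0.
move: S2; move: (\sum_k _) => a; move: (F x0) => b ab bh.
have : `|b| <= `|a + b| + `|a|.
  by rewrite -{1}(addKr a b) addrC (le_trans (ler_normD _ _)) // normrN.
by move: ab bh; lra.
Qed.

(** Tangency of the edges: F takes the same value 0 at both ends. *)
Lemma edge_slope j (w : 'I_3 -> 'rV[R]_3) : (forall k, `|w k - y| <= 3 * h) ->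
  `|\sum_k partial k F (w k) * edge_mx B j k| <= 108 * C * h ^+ 2.
Proof.
move=> wy.
have := @chord_slope _ _ _ _ _ C0 dF ddF F2 y h Gy hd (row 0 B) (row (lift ord0 j) B) w.
rewrite !F_B subrr subr0 => /(_ _ _ wy).
have -> : \sum_k partial k F (w k) * (row (lift ord0 j) B 0 k - row 0 B 0 k) =
   \sum_k partial k F (w k) * edge_mx B j k.
  by apply: eq_bigr => k _; rewrite !mxE.
by apply; exact: diamX.
Qed.

(** The ray through a point of K leaves the tetrahedron through the face
   opposite to x0, at the point yf. On that face F differs by h^2 from an
   average of its values at the three vertices, which have the sign opposite
   to F x0 and size at least c1 h. Hence F changes sign between x0 and yf. *)
Lemma patch_liftP xi : ref_triangle xi ->
  [/\ G (patch_lift G X xi), hull X (patch_lift G X xi) &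
    exists t, patch_lift G X xi = x0 + t *: v xi].
Proof.
move=> xiR; have bs := bary_simplex xiR.
have /choice[tau tauP] : forall i, exists tau, 0 < tau <= 1 /\
    row i B = x0 + tau *: (row (lift ord0 i) X - x0).
  by move=> i; have [_ [t t01 tE]] := cut_pointP i; exists t; rewrite rowB.
have [b0 b1] := bs.
pose theta := \sum_i bary xi 0 i * tau i.
have theta0 : 0 < theta.
  rewrite lt_neqAle eq_sym; apply/andP; split; last first.
    by apply: sumr_ge0 => i _; rewrite mulr_ge0 // ltW //; case: (tauP i) => /andP[].
  apply/eqP => /eqP; rewrite psumr_eq0 => [/allP al|i _]; last first.
    by rewrite mulr_ge0 // ltW //; case: (tauP i) => /andP[].
  move: b1; rewrite big1 => [/esym/eqP|i _]; first by rewrite oner_eq0.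
  have := al i; rewrite mem_index_enum => /(_ isT) /=; rewrite mulf_eq0.
  by case: (tauP i) => /andP[/gt_eqF -> _] _; rewrite orbF => /eqP.
(* Barycentric coordinates of the exit point with respect to the face opposite
   to x0: the point of K has coordinate bary * tau with respect to the vertex
   x_i. *)
pose mu : 'rV[R]_3 := \row_i (bary xi 0 i * tau i / theta).
have ms : @std_simplex R 3 mu.
  split=> [i|].
    rewrite mxE; apply: mulr_ge0; last by rewrite invr_ge0 ltW.
    by rewrite mulr_ge0 // ltW //; case: (tauP i) => /andP[].
  by under eq_bigr do rewrite mxE; rewrite -mulr_suml divff // gt_eqF.
pose yf := \sum_i mu 0 i *: row (lift ord0 i) X.
have Xf : hull X yf by apply: hull_sum => // i; exact: row_hull.
have yfE : yf = x0 + theta^-1 *: v xi.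
  have vS : v xi = \sum_i (bary xi 0 i * tau i) *: (row (lift ord0 i) X - x0).
    rewrite vE affine_param_bary -{1}[x0]scale1r -b1 scaler_suml -sumrB.
    apply: eq_bigr => i _; rewrite (tauP i).2 scalerDr addrAC subrr add0r.
    by rewrite scalerA.
  rewrite vS scaler_sumr /yf.
  have -> : x0 = \sum_i mu 0 i *: x0 by rewrite -scaler_suml (ms.2) scale1r.
  rewrite -big_split /=; apply: eq_bigr => i _.
  have -> : \sum_i mu 0 i *: x0 = x0 by rewrite -scaler_suml (ms.2) scale1r.
  rewrite scalerA [theta^-1 * _]mulrC; have -> : bary xi 0 i * tau i / theta = mu 0 i by rewrite [RHS]mxE.
  by rewrite scalerBr addrC subrK.
have signf : F x0 * F yf <= 0.
  have := @convex_slope 3 mu (fun i => row (lift ord0 i) X) yf (fun=> y) ms _ Xf _.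
  have -> : \sum_k partial k F y * ((\sum_i mu 0 i *: row (lift ord0 i) X) 0 k - yf 0 k) = 0.
    by rewrite big1 // => k _; rewrite subrr mulr0.
  rewrite sub0r normrN => /(_ (fun i => row_hull _ _)) /(_ _) S.
  have {S} : `|\sum_i mu 0 i * F (row (lift ord0 i) X) - F yf| <= 108 * C * h ^+ 2.
    by apply: S => _; rewrite subrr normr0 mulr_ge0 // ltW.
  move=> /le_trans /(_ Ch2) S.
  have Sle : F x0 * (\sum_i mu 0 i * F (row (lift ord0 i) X)) <= - (`|F x0| * (c1 * h)).
    rewrite mulr_sumr -mulrN -[- _]mul1r -(ms.2) mulr_suml mulr_sumr.
    apply: ler_sum => i _; rewrite mulrCA [leRHS]mulrCA ler_wpM2l ?(ms.1) //.
    have := signX i; rewrite -/x0 => si.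
    rewrite mulrN lerNr -(ltr0_norm si) normrM ler_wpM2l //.
  have : F x0 * F yf = F x0 * (\sum_i mu 0 i * F (row (lift ord0 i) X))
     - F x0 * (\sum_i mu 0 i * F (row (lift ord0 i) X) - F yf) by ring.
  move=> ->; rewrite subr_le0; apply: le_trans Sle _.
  rewrite lerNl -mulrN (le_trans (ler_norm _)) // normrM normrN ler_wpM2l //.
  have ch : 0 < c1 * h by rewrite mulr_gt0.
  by apply: le_trans S _; move: ch; lra.
have segE s : (1 - s) *: x0 + s *: yf = x0 + (s / theta) *: v xi.
  by rewrite yfE scalerDr scalerBl scale1r scalerA addrA subrK.
have Xs s : 0 <= s <= 1 -> hull X (x0 + (s / theta) *: v xi).
  by move=> s01; rewrite -segE; apply: hull_convex.
have [s s01|s s01] := @zero_on_segment R 3 F x0 yf _ signf.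
  by rewrite segE; apply: cF; apply: Om_hull; exact: Xs.
rewrite segE => Fs.
have [[Gr Xr] [t _ tE]] : (G `&` hull X `&` ray x0 (affine_param B xi)) (patch_lift G X xi).
  apply: getPex; exists (x0 + (s / theta) *: v xi); split.
    split; last exact: Xs.
    by apply/G0 => //; apply: Om_hull; exact: Xs.
  exists (s / theta); last by rewrite vE.
  by have /andP[s0 _] := s01; apply: divr_ge0 => //; exact: ltW.
by split=> //; exists t; rewrite vE.
Qed.

(** The chord from x0 to the lift has slope t W, which equals - F x0 up to
   h^2; now |F x0| is at most of order h and |W| at least. *)
Lemma radial_parameter_le xi t : ref_triangle xi ->
  patch_lift G X xi = x0 + t *: v xi -> `|t| <= 6 * C / c1 + 1.
Proof.
move=> xiR tE; have [Gr Xr _] := patch_liftP xiR.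
have := @chord_slope _ _ _ _ _ C0 dF ddF F2 y h Gy hd x0 (patch_lift G X xi) (fun=> y).
have -> : F (patch_lift G X xi) = 0 by apply/G0 => //; exact: Om_hull.
rewrite sub0r opprK.
have -> : \sum_k partial k F y * (patch_lift G X xi 0 k - x0 0 k) =
    t * \sum_k partial k F y * v xi 0 k.
  rewrite mulr_sumr; apply: eq_bigr => k _.
  by rewrite tE rV_addZE addrAC subrr add0r mulrCA.
move=> /(_ (diamX X_x0 Xy) (diamX Xr Xy)) S.
have {S} : `|t * (\sum_k partial k F y * v xi 0 k) + F x0| <= 108 * C * h ^+ 2.
  by apply: S => _; rewrite subrr normr0 mulr_ge0 // ltW.
move=> /le_trans /(_ Ch2) S.
have W := @ray_slope xi (fun=> y) xiR.
have {}W : c1 / 2 * h <= `|\sum_k partial k F y * v xi 0 k|.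
  by apply: W => _; rewrite subrr normr0 mulr_ge0 // ltW.
have hdy : `|x0 - y| < delta.
  by apply: le_lt_trans (diamX X_x0 Xy) (le_lt_trans _ hd); rewrite ler_peMl ?ler1n // ltW.
have Fx0 : `|F x0| <= 3 * C * h.
  apply: le_trans (@level_lipschitz _ _ _ _ _ G0 dF F1 y x0 Gy hdy) _.
  by rewrite ler_wpM2l ?mulr_ge0 //; exact: diamX.
have tW : `|t| * `|\sum_k partial k F y * v xi 0 k| <= c1 / 2 * h + 3 * C * h.
  rewrite -normrM; move: S; move: (_ * _) => a S.
  rewrite -(addrK (F x0) a) (le_trans (ler_normB _ _)) //.
  by rewrite lerD.
have hc : 0 < c1 / 2 * h by rewrite mulr_gt0 // divr_gt0.
have tc : `|t| * (c1 / 2 * h) <= c1 / 2 * h + 3 * C * h.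
  by apply: le_trans tW; rewrite ler_wpM2l.
rewrite -(ler_pM2r hc); apply: le_trans tc _; rewrite le_eqVlt; apply/orP; left; apply/eqP.
by field; rewrite gt_eqF.
Qed.

(** The mean value formula between two lifted points, both zeros of F: (u - t)
   times a transversal slope equals, up to sign, t times a slope along the
   plane of K. The powers of h cancel, which makes the constant uniform. *)
Lemma radial_parameter_lip xi zeta t u : ref_triangle xi -> ref_triangle zeta ->
  patch_lift G X xi = x0 + t *: v xi -> patch_lift G X zeta = x0 + u *: v zeta ->
  `|u - t| <= 12 * C * (6 * C / c1 + 1) / c1 * `|zeta - xi|.
Proof.
move=> xiR zR tE uE; have [Gr Xr _] := patch_liftP xiR; have [Gs Xs _] := patch_liftP zR.
have nw w : `|w - patch_lift G X xi| <= `|patch_lift G X zeta - patch_lift G X xi| ->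
    `|w - y| <= 3 * h.
  move=> wx; rewrite -(subrKA (patch_lift G X xi)) (le_trans (ler_normD _ _)) //.
  apply: le_trans (lerD (le_trans wx (diamX Xs Xr)) (diamX Xr Xy)) _.
  by move: h0; lra.
have [w k /nw wy|w [/(_ _)/nw wy]] := @mvt_box R 3 F (patch_lift G X xi) (patch_lift G X zeta).
  by apply: dF; exists y => //; exact: le_lt_trans hd.
have -> : F (patch_lift G X zeta) = 0 by apply/G0 => //; exact: Om_hull.
have -> : F (patch_lift G X xi) = 0 by apply/G0 => //; exact: Om_hull.
rewrite subrr.
have -> : \sum_k partial k F (w k) * (patch_lift G X zeta 0 k - patch_lift G X xi 0 k) =
   (u - t) * (\sum_k partial k F (w k) * v zeta 0 k)
   + t * (\sum_k partial k F (w k) * ((zeta - xi) *m edge_mx B) 0 k).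
  rewrite !mulr_sumr -big_split /=; apply: eq_bigr => k _.
  have -> : ((zeta - xi) *m edge_mx B) 0 k = v zeta 0 k - v xi 0 k.
    by rewrite /v mulmxBl !mxE; ring.
  by rewrite uE tE !rV_addZE; ring.
move=> /esym/eqP; rewrite addr_eq0 => /eqP E.
have W := @ray_slope zeta w zR wy.
have N : `|\sum_k partial k F (w k) * ((zeta - xi) *m edge_mx B) 0 k| <= 6 * C * h * `|zeta - xi|.
  rewrite (le_trans (ler_norm_sum _ _ _)) //.
  apply: (@le_trans _ _ (\sum_(k < 3) C * (2 * (h * `|zeta - xi|)))); last first.
    rewrite sumr_const card_ord -[leLHS]mulr_natl le_eqVlt; apply/orP; left; apply/eqP.
    by ring.
  apply: ler_sum => k _; rewrite normrM ler_pM //.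
    by apply: F1; exists y => //; exact: le_lt_trans hd.
  rewrite mxE (le_trans (ler_norm_sum _ _ _)) //.
  have -> : 2 * (h * `|zeta - xi|) = \sum_(j < 2) h * `|zeta - xi|.
    by rewrite sumr_const card_ord mulr_natl.
  apply: ler_sum => j _.
  by rewrite normrM mulrC ler_pM ?edge_le ?rV_coord_le.
have tl := radial_parameter_le xiR tE.
have hc : 0 < c1 / 2 * h by rewrite mulr_gt0 // divr_gt0.
rewrite -(ler_pM2r hc); apply: le_trans (ler_wpM2l (normr_ge0 _) W) _.
rewrite -normrM E normrN normrM; apply: le_trans (ler_pM _ _ tl N) _ => //.
by rewrite le_eqVlt; apply/orP; left; apply/eqP; field; rewrite gt_eqF.
Qed.

End Cut_tetrahedron.

(** * Charts of the surface *)

(** Uniform bounds on all words of derivatives. As E is empty, nothing is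
   asked at the boundary: the class is only composed with inner functions
   whose limits stay in V. *)
Lemma dword_cls (R : realType) (I : Type) p (V : I -> set 'rV[R]_p) N
    (f : I -> 'rV[R]_p -> R) (C : R) : 0 <= C ->
  (forall i, Ck N (V i) (f i)) ->
  (forall w, (size w <= N)%N -> forall i z, V i z -> `|dword w (f i) z| <= C) ->
  cls V (fun=> set0) N (fun _ _ => 1) f.
Proof.
move=> C0; elim: N f => [|N IH] f Cf fC.
  apply/clsE; split=> //.
  by exists C => // i x Vx; rewrite mulr1; exact: (fC [::]).
apply/clsS; split.
- by split=> // i x Vx; case: (Cf i) => + _; apply.
- by exists C => // i x Vx; rewrite mulr1; exact: (fC [::]).
- move=> j; split=> [i x Vx|]; first by case: (Cf i) => _ /(_ j)[+ _]; apply.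
  apply: IH => [i|w wN i z Vz]; first by case: (Cf i) => _ /(_ j)[].
  have := fC (rcons w j) _ i z Vz; rewrite size_rcons ltnS => /(_ wN).
  by rewrite /dword foldr_rcons.
Qed.

Section Chart.
Variables (R : realType) (G : set 'rV[R]_3) (k : nat) (M : R).
Variables (V : set 'rV[R]_2) (g : 'rV[R]_2 -> 'rV[R]_3).
Hypothesis gV : local_coordinates G k.+1 M V g.

Lemma chart_open : open V. Proof. by case: gV => -[]. Qed.

Lemma chart_Ck l : Ck k.+1 V (fun y => g y 0 l).
Proof. by case: gV => -[oV] + _ _ _ _ => /(Ck_coord _ _ oV); apply. Qed.

Lemma chart_derivable a l z : V z ->
  derivable (fun y => g y 0 l) z (delta_mx 0 a).
Proof. by move=> Vz; have [_ /(_ a)[+ _]] := chart_Ck l; apply. Qed.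

Lemma chart_dword w l z : (1 <= size w <= k.+1)%N -> V z ->
  `|dword w (fun y => g y 0 l) z| <= M.
Proof.
move=> sw Vz; have oV := chart_open; have /andP[_ wk] := sw.
have pw := mword_count w; have swE := perm_size pw.
have [[_ Cg] _ _ gM _] := gV.
have Cl : Ck (size (mword (fun j => count_mem j w))) V (fun y => g y 0 l).
  by apply: Ck_le (chart_Ck l); rewrite swE.
rewrite -(dword_perm oV Cl pw Vz) -(dword_coord _ oV _ Vz); last first.
  by apply: Ck_le Cg; rewrite swE.
rewrite -mderive_dword; apply: le_trans (rV_coord_le _ _) _.
apply: le_trans (norm_le_enorm _) _; apply: gM => //.
by rewrite -size_mword swE.
Qed.

(** Only partial derivatives of g are known to exist; the directional
   derivatives in the lower bound on Dg follow from the chain rule with the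
   identity as inner map. *)
Lemma chart_derive v z l : V z ->
  ('D_v g z) 0 l = \sum_a partial a (fun y => g y 0 l) z * v 0 a.
Proof.
move=> Vz; have oV := chart_open.
have nV : \forall y \near z, V y by apply: open_nbhs_nbhs.
have dv l' : is_derive z v (fun y => g y 0 l')
    (\sum_a partial a (fun y => g y 0 l') z * v 0 a).
  have did : derivable (fun y : 'rV[R]_2 => y) z v by exact: derivable_id.
  have [|||d e] := @is_derive_chain R 2 2 (fun y => g y 0 l') (fun y => y) z v.
  - by apply: filterS nV => y Vy a; exact: chart_derivable.
  - move=> a; have [_ /(_ a)[_ c]] := chart_Ck l'.
    by have c0 := Ck_le (leq0n k) c; exact: c0.
  - by move=> a; exact: ((derivable_coord _ _ _).1 did a).
  apply: DeriveDef => //; rewrite e; apply: eq_bigr => a _; congr (_ * _).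
  have := derive_mx did; rewrite derive_id => /rowP /(_ a).
  by rewrite mxE.
have dg : derivable g z v by apply/derivable_coord => l'; case: (dv l').
by rewrite derive_mx // mxE; case: (dv l).
Qed.

(** Openness of the chart on its image, used with the filter of neighbourhoods
   in the triangle: points of the surface that converge have coordinates that
   converge. *)
Lemma chart_inv_cvg (T : Type) (Fl : set_system T) (FF : Filter Fl)
    (s : T -> 'rV[R]_2) (r : T -> 'rV[R]_3) (z : 'rV[R]_2) (D : set T) :
  V z -> Fl D -> (forall t, D t -> V (s t) /\ r t = g (s t)) ->
  r @ Fl --> g z -> s @ Fl --> z.
Proof.
move=> Vz FD sD rz A; rewrite nbhsE => -[W [oW Wz] WA].
have [[oV _] [inj gG] gopen _ _] := gV.
have [] := gopen (W `&` V) (openI oW oV); first by move=> ? [].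
move=> O oO OE.
have Oz : O (g z).
  have : (g @` (W `&` V)) (g z) by exists z.
  by rewrite OE => -[].
have FO : Fl (r @^-1` O) by apply: rz; apply: open_nbhs_nbhs.
change (Fl (s @^-1` A)); apply: filterS2 FD FO => t Dt Ot; have [Vs rs] := sD t Dt.
have : (g @` (W `&` V)) (g (s t)).
  rewrite OE; split; first by rewrite -rs.
  by apply: gG; exists (s t).
move=> [w [Ww Vw] gws]; apply: WA.
by rewrite -(inj w (s t) _ _ gws) ?inE.
Qed.

End Chart.

(** The lower bound on Dg says that the Gram form is at least M^-2 times the
   square of the length. At the vector (E, - B) it equals E times the
   determinant A E - B^2, and E itself is at least M^-2. *)
Lemma gram_det_ge (R : realType) q (D : 'I_2 -> 'I_q -> R) (M : R) (a : 'I_2) :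
  0 < M ->
  (forall v : 'rV[R]_2, enorm v <= M * enorm (\row_l \sum_b D b l * v 0 b)) ->
  M ^- 4 <= `|(\sum_l D a l * D a l) * (\sum_l D (rev_ord a) l * D (rev_ord a) l)
    - (\sum_l D a l * D (rev_ord a) l) * (\sum_l D (rev_ord a) l * D a l)|.
Proof.
move=> M0 DM; set b := rev_ord a.
set A := \sum_l D a l * D a l; set B := \sum_l D a l * D b l.
set E := \sum_l D b l * D b l.
have -> : \sum_l D b l * D a l = B by apply: eq_bigr => l _; rewrite mulrC.
have ab : a != b by rewrite /b; case: a {A B E b} => -[|[|//]].
have Q (x y : R) : x ^+ 2 + y ^+ 2 <= M ^+ 2 * (A * x ^+ 2 + 2 * B * x * y + E * y ^+ 2).
  pose v : 'rV[R]_2 := \row_c (if c == a then x else y).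
  have va : v 0 a = x by rewrite mxE eqxx.
  have vb : v 0 b = y by rewrite mxE eq_sym (negPf ab).
  have := DM v; rewrite -ler_sqr ?nnegrE ?mulr_ge0 ?enorm_ge0 ?(ltW M0) // exprMn.
  rewrite /enorm !sqr_sqrtr; try by apply: sumr_ge0 => ? _; exact: sqr_ge0.
  rewrite (sum2 _ a) -/b va vb => /le_trans; apply.
  rewrite le_eqVlt; apply/orP; left; apply/eqP; congr (_ * _).
  rewrite /A /B /E !mulr_suml !mulr_sumr !mulr_suml -!big_split /=.
  by apply: eq_bigr => l _; rewrite mxE (sum2 _ a) -/b va vb; ring.
have M2 : 0 < M ^+ 2 by rewrite exprn_gt0.
have E1 : 1 <= M ^+ 2 * E by have := Q 0 1; rewrite expr0n expr1n !mulr0 !mul0r !add0r mulr1.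
have QE := Q E (- B).
have D1 : E <= M ^+ 2 * (A * E - B * B).
  have E0 : 0 < E by rewrite -(pmulr_rgt0 _ M2) (lt_le_trans ltr01).
  rewrite -(ler_pM2l E0); apply: (@le_trans _ _ (E ^+ 2 + (- B) ^+ 2)).
    by rewrite -expr2 lerDl sqr_ge0.
  apply: le_trans QE _; rewrite le_eqVlt; apply/orP; left; apply/eqP; ring.
apply: le_trans (ler_norm _).
rewrite -(ler_pM2l M2) -(ler_pM2l M2) mulrA -exprD.
rewrite divff ?expf_neq0 ?gt_eqF //; apply: le_trans E1 _.
by rewrite ler_pM2l.
Qed.

(** * The plane of the cut triangle *)

Section Inscribed_ball.
Variables (R : realType) (T : 'M[R]_(4, 3)).

Lemma nondegenerate_free (a : 'rV[R]_4) : Defs.nondegenerate T ->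
  \sum_i a 0 i = 0 -> a *m T = 0 -> a = 0.
Proof.
rewrite /Defs.nondegenerate => free a0 aT.
have a'0 : (\row_j a 0 (lift ord0 j)) = 0 :> 'rV[R]_3.
  apply/eqP; rewrite -(mulmx_free_eq0 _ free); apply/eqP.
  rewrite -[RHS]aT !mulmx_sum_row [RHS]big_ord_recl /=.
  have -> : a 0 ord0 = - \sum_(j < 3) a 0 (lift ord0 j).
    by apply/eqP; rewrite -addr_eq0 -big_ord_recl a0.
  rewrite scaleNr scaler_suml -sumrN -big_split /=; apply: eq_bigr => j _.
  by rewrite mxE rowK scalerBr addrC.
apply/rowP => i; rewrite [RHS]mxE.
have al j : a 0 (lift ord0 j) = 0 by have /rowP/(_ j) := a'0; rewrite !mxE.
case: (unliftP ord0 i) => [j ->|->]; first exact: al.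
by move: a0; rewrite big_ord_recl big1 ?addr0.
Qed.

(** A vector of length rho moves the centre of the ball within the
   tetrahedron, and barycentric coordinates of its points lie between 0 and 1;
   so it changes each of them by at most 1. *)
Lemma ball_coord_le (a : 'rV[R]_4) c (rho : R) i : Defs.nondegenerate T -> 0 < rho ->
  [set y | enorm (y - c) <= rho] `<=` hull T -> \sum_i a 0 i = 0 ->
  rho * `|a 0 i| <= enorm (a *m T).
Proof.
move=> nT rho0 cT a0; have [w0|wN0] := eqVneq (enorm (a *m T)) 0.
  have aT : a *m T = 0.
    apply/eqP; rewrite -normr_le0; apply: le_trans (norm_le_enorm _) _.
    by rewrite w0.
  by rewrite (nondegenerate_free nT a0 aT) mxE normr0 mulr0 enorm_ge0.
have w0 : 0 < enorm (a *m T) by rewrite lt_neqAle eq_sym wN0 enorm_ge0.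
pose e := rho / enorm (a *m T).
have e0 : 0 < e by rewrite divr_gt0.
have enorm0 : enorm (0 : 'rV[R]_3) = 0.
  by rewrite -(scale0r (0 : 'rV[R]_3)) enormZ normr0 mul0r.
have [b bS bE] : hull T c by apply: cT; rewrite /= subrr enorm0 ltW.
have [b' b'S b'E] : hull T (c + e *: (a *m T)).
  by apply: cT; rewrite /= addrC addKr enormZ gtr0_norm // divfK.
have : e *: a = b' - b.
  apply/eqP; rewrite -subr_eq0; apply/eqP; apply: nondegenerate_free => //.
    under eq_bigr do rewrite !mxE.
    by rewrite !sumrB -mulr_sumr a0 bS.2 b'S.2 mulr0 subrr oppr0 addr0.
  by rewrite !mulmxBl b'E bE -scalemxAl [c + _]addrC addrK subrr.
move=> /rowP /(_ i); rewrite !mxE => ai.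
have /andP[b1 b2] := simplex_le1 i bS; have /andP[b3 b4] := simplex_le1 i b'S.
have : `|e * a 0 i| <= 1 by rewrite ai ler_norml; apply/andP; split; lra.
rewrite normrM gtr0_norm // /e mulrAC ler_pdivrMr // mul1r.
by [].
Qed.

(** Shape regularity bounds the supremum of the diameters of inscribed balls
   from below. A ball of half the supremal size exists, and this spares an
   argument on whether the supremum is attained. *)
Lemma inball_large (kappa d : R) : 0 < d -> d <= diam (hull T) ->
  shape_regular kappa T ->
  0 < kappa /\ exists rho c, [/\ 0 < rho, d / (4 * kappa) <= rho &
    [set y | enorm (y - c) <= rho] `<=` hull T].
Proof.
move=> d0 dT sr; have dk : d <= kappa * inball_diam T by exact: le_trans sr.
set S := [set 2 * r | r in [set r : R | 0 <= r /\
    exists c, [set y | enorm (y - c) <= r] `<=` hull T]].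
have S0 : S 0.
  exists 0; rewrite ?mulr0 //; split=> //; exists (row 0 T) => y /= y0.
  have : y - row 0 T = 0.
    by apply/eqP; rewrite -normr_le0; apply: le_trans (norm_le_enorm _) y0.
  by move=> /eqP; rewrite subr_eq0 => /eqP ->; exact: row_hull.
have inb0 : 0 <= inball_diam T.
  rewrite /inball_diam -/S.
  have [ub|nub] := pselect (has_ubound S); first exact: ub_le_sup.
  by rewrite sup_out // => -[].
have k0 : 0 < kappa.
  by rewrite ltNge; apply/negP => k0; have := mulr_le0_ge0 k0 inb0; lra.
split=> //; apply: contrapT => nball.
have : inball_diam T <= d / (2 * kappa).
  apply: ge_sup; first by exists 0.
  move=> _ [r [r0 [c cr]] <-]; rewrite leNgt; apply/negP => dr.
  have rd : d / (4 * kappa) <= r.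
    have -> : d / (4 * kappa) = d / (2 * kappa) / 2 by field; rewrite gt_eqF.
    by rewrite ler_pdivrMr // (mulrC r); exact: ltW.
  apply: nball; exists r, c; split=> //.
  by apply: lt_le_trans rd; rewrite divr_gt0 // mulr_gt0.
rewrite -(ler_pM2l k0) => /(le_trans dk).
have -> : kappa * (d / (2 * kappa)) = d / 2 by field; rewrite gt_eqF.
by lra.
Qed.

End Inscribed_ball.

(** A displacement in the plane of K with parameter xi changes one barycentric
   coordinate with respect to K by xi j, hence the corresponding one with
   respect to the tetrahedron by tau times as much, tau being the position of
   the cut point on its edge; the inscribed ball bounds such a change by the
   length over rho. *)
Lemma edge_mx_expand (R : realType) (T : 'M[R]_(4, 3)) (sigma : 'S_4)
    (B : 'M[R]_3) (tau : 'I_3 -> R) (eta rho : R) c (xi : 'rV[R]_2) j :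
  let X := row_perm sigma T in
  Defs.nondegenerate T -> 0 < rho -> [set y | enorm (y - c) <= rho] `<=` hull T ->
  0 < eta -> (forall i, eta <= tau i) ->
  (forall i, row i B = row ord0 X + tau i *: (row (lift ord0 i) X - row ord0 X)) ->
  rho * eta * `|xi 0 j| <= enorm (xi *m edge_mx B).
Proof.
move=> X nT rho0 cT eta0 eta_tau BE.
(* Increments of the barycentric coordinates with respect to K and, below,
   with respect to the tetrahedron; both have sum 0. *)
pose beta : 'rV[R]_3 := \row_i (if unlift ord0 i is Some j then xi 0 j else - xi 0 0 - xi 0 1).
have [be0 be1 be2] : [/\ beta 0 0 = - xi 0 0 - xi 0 1, beta 0 (lift ord0 0) = xi 0 0 &
    beta 0 (lift ord0 1) = xi 0 1] by rewrite !mxE unlift_none !liftK.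
pose a : 'rV[R]_4 := \row_i (if unlift ord0 i is Some j then beta 0 j * tau j
  else - \sum_j beta 0 j * tau j).
have a_lift (i : 'I_3) : a 0 (lift ord0 i) = beta 0 i * tau i by rewrite mxE liftK.
have a_0 : a 0 ord0 = - \sum_i beta 0 i * tau i by rewrite mxE unlift_none.
have aS : \sum_i a 0 i = 0.
  rewrite big_ord_recl; under eq_bigr do rewrite a_lift.
  by rewrite a_0 addrC subrr.
have aX : a *m X = xi *m edge_mx B.
  have bB : xi *m edge_mx B = \sum_i beta 0 i *: row i B.
    rewrite sum3E be0 be1 be2; apply/rowP => k; rewrite !mxE big_ord_recl big_ord1 !mxE.
    have -> : lift ord0 ord0 = 1 :> 'I_2 by exact: val_inj.
    by ring.
  have bS : \sum_i beta 0 i = 0 by rewrite sum3E be0 be1 be2; ring.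
  rewrite bB mulmx_sum_row big_ord_recl; under eq_bigr do rewrite a_lift.
  rewrite a_0 scaleNr scaler_suml -sumrN -big_split /=.
  under [RHS]eq_bigr do rewrite BE scalerDr.
  rewrite [RHS]big_split /= -scaler_suml bS scale0r add0r.
  by apply: eq_bigr => i _; rewrite scalerA scalerBr addrC.
pose a' := col_perm sigma^-1%g a.
have a'S : \sum_i a' 0 i = 0.
  rewrite -[RHS]aS [RHS](reindex_inj (@perm_inj _ sigma^-1%g)) /=.
  by apply: eq_bigr => i _; rewrite mxE.
have a'T : a' *m T = xi *m edge_mx B.
  rewrite -aX; apply/rowP => k; rewrite !mxE.
  rewrite [RHS](reindex_inj (@perm_inj _ sigma^-1%g)) /=.
  by apply: eq_bigr => i _; rewrite !mxE permKV.
have xj : xi 0 j = beta 0 (lift ord0 j) by rewrite mxE liftK.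
have := ball_coord_le (sigma (lift ord0 (lift ord0 j))) nT rho0 cT a'S.
rewrite a'T mxE permK a_lift -xj normrM => /(le_trans _); apply.
rewrite -mulrA ler_pM2l // mulrC ler_wpM2l //.
exact: le_trans (eta_tau _) (ler_norm _).
Qed.

Lemma interior_preimage (T U : topologicalType) (f : T -> U) (f' : U -> T) (D : set U) :
  continuous f -> continuous f' -> cancel f f' -> cancel f' f ->
  (f @^-1` D)° = f @^-1` D°.
Proof.
move=> cf cf' fK f'K; apply/seteqP; split=> x /= Dx; last exact: cf.
have := cf' (f x) (f @^-1` D); rewrite fK => /(_ Dx) nfD.
have nD : \forall y \near f x, (f @^-1` D) (f' y) by exact: nfD.
by change (\forall y \near f x, D y); apply: filterS nD => y /=; rewrite f'K.
Qed.

(** The expansion bound makes the parametrization injective, and its inverse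
   has entries at most 1 / b. An isometry of the plane does not change
   lengths, so the bound transfers to Cartesian coordinates. *)
Lemma cartesian_inverse (R : realType) (B : 'M[R]_3) p (Q : 'M[R]_(2, 3)) (b : R) :
  0 < b -> cartesian_frame B p Q ->
  (forall (xi : 'rV[R]_2) j, b * `|xi 0 j| <= enorm (xi *m edge_mx B)) ->
  exists c (A : 'M[R]_2), [/\ forall i j, `|A i j| <= b^-1,
    forall y, hull B (p + y *m Q) <-> ref_triangle (c + y *m A),
    forall y, p + y *m Q = affine_param B (c + y *m A) &
    [set y | hull B (p + y *m Q)]° = (fun y => c + y *m A) @^-1` (@ref_triangle R)°].
Proof.
move=> b0 [QQ /choice[y yE]] expand.
pose J : 'M[R]_2 := \matrix_(j < 2) (y (lift ord0 j) - y 0).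
have JQ : J *m Q = edge_mx B.
  apply/row_matrixP => j; rewrite row_mul rowK /edge_mx rowK !yE.
  by rewrite mulmxBl opprD addrACA subrr add0r.
have isoQ (x : 'rV[R]_2) : enorm (x *m Q) = enorm x by exact: enorm_mulmx.
have expJ (xi : 'rV[R]_2) j : b * `|xi 0 j| <= enorm (xi *m J).
  by rewrite -isoQ -mulmxA JQ.
have Ju : J \in unitmx.
  rewrite -row_free_unit -kermx_eq0; apply/eqP/row_matrixP => i; rewrite row0.
  have kJ : row i (kermx J) *m J = 0 by rewrite -row_mul mulmx_ker row0.
  apply/rowP => j; rewrite [RHS]mxE; apply/eqP; rewrite -normr_le0.
  rewrite -(ler_pM2l b0) mulr0; apply: le_trans (expJ _ j) _; rewrite kJ.
  by rewrite -(scale0r (0 : 'rV[R]_2)) enormZ normr0 mul0r.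
pose A := invmx J; pose c := - (y 0 *m A).
have AE x : c + x *m A = (x - y 0) *m A by rewrite /c mulmxBl addrC.
have pE x : p + x *m Q = affine_param B (c + x *m A).
  rewrite affine_paramE -JQ AE mulmxA mulmxKV // mulmxBl yE.
  by rewrite -addrA; congr (_ + _); rewrite addrC subrK.
have hE x : hull B (p + x *m Q) <-> ref_triangle (c + x *m A).
  rewrite affine_param_hull pE; split=> [[xi xiR]|]; last by exists (c + x *m A).
  rewrite !affine_paramE => /addrI; rewrite -JQ !mulmxA => /(congr1 (mulmx^~ Q^T)).
  rewrite -!mulmxA QQ !mulmx1 => /(congr1 (mulmx^~ A)).
  by rewrite !mulmxK // => <-.
exists c, A; split=> //.
- move=> i j; rewrite -(ler_pM2l b0) divff ?gt_eqF //.
  have -> : A i j = (row i A) 0 j by rewrite mxE.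
  apply: le_trans (expJ _ _) _; rewrite -row_mul mulVmx // row1.
  rewrite /enorm (bigD1 i) //= mxE !eqxx expr1n big1 ?addr0 ?sqrtr1 // => k ki.
  by rewrite mxE (negPf ki) andbF expr0n.
- have -> : [set x | hull B (p + x *m Q)] = (fun x => c + x *m A) @^-1` (@ref_triangle R).
    by apply/seteqP; split=> x /hE.
  apply: (@interior_preimage _ _ (fun x : 'rV[R]_2 => c + x *m A) (fun xi => y 0 + xi *m J)).
  + exact: continuous_affine.
  + exact: continuous_affine.
  + by move=> x; rewrite AE mulmxKV // addrC subrK.
  + by move=> xi; rewrite AE addrC addKr mulmxK.
Qed.

Section Boundary_values.
Variables (R : realType) (p q : nat).
Implicit Types D : set 'rV[R]_p.

Lemma eq_has_mderive D alpha (f g : 'rV[R]_p -> 'rV[R]_q) x l :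
  (forall y, D y -> f y = g y) ->
  has_mderive D alpha f x l -> has_mderive D alpha g x l.
Proof.
move=> fg [Cf lf]; have oD : open D° by exact: open_interior.
have fgO y : D° y -> f y = g y by move=> /interior_subset; exact: fg.
split; first exact: (eq_Ck oD fgO Cf).
apply: cvg_trans lf; apply: near_eq_cvg; rewrite near_withinE.
by near=> y => Dy; rewrite !mderive_dword (eq_dword _ oD fgO Dy).
Unshelve. all: by end_near. Qed.

Variables (I : Type) (E : I -> set 'rV[R]_p).
Variables (N : nat) (b : nat -> I -> R) (f : I -> 'rV[R]_p -> 'rV[R]_q).
Let O i := (E i)°.
Hypothesis b0 : forall n i, 0 <= b n i.
Hypothesis rf : forall k, reg O E (fun i x => f i x 0 k).
Hypothesis gf : forall k, gcls O E N b (fun i x => f i x 0 k).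

(** The derivatives have limits at the boundary by membership in the class,
   and a bound valid on the interior passes to the limit. *)
Lemma has_mderive_of_gcls n : (n < N)%N ->
  exists2 C : R, 0 < C & forall i alpha x, mlen alpha = n.+1 -> E i x ->
    exists2 l, has_mderive (E i) alpha (f i) x l & enorm l <= C * b n i.
Proof.
move=> nN; have oO i : open (O i) by exact: open_interior.
have /choice[C CP] : forall k, exists C : R, 0 <= C /\
    forall w, size w = n.+1 -> forall i x, O i x ->
      `|dword w (fun y => f i y 0 k) x| <= C * b n i.
  by move=> k; have [[C C0 CP] _] := gcls_dword nN (gf k); exists C.
pose K := q%:R * \sum_k C k + 1.
have S0 : 0 <= \sum_k C k by apply: sumr_ge0 => k _; case: (CP k).
exists K => [|i alpha x an Ex]; first by rewrite ltr_wpDl // mulr_ge0.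
have CfN : Ck N (O i) (f i).
  by apply/(Ck_coord _ _ (oO i)) => k; exact: (gcls_Ck i (rf k) (gf k)).
have Cf : Ck (mlen alpha) (O i) (f i) by apply: Ck_le CfN; rewrite an.
pose w := mword alpha; have wn : size w = n.+1 by rewrite size_mword.
have dwE y k : O i y -> mderive alpha (f i) y 0 k = dword w (fun y => f i y 0 k) y.
  move=> Oy; rewrite mderive_dword (dword_coord _ (oO i)) //.
  by rewrite size_mword.
pose G := within (O i) (nbhs x).
(* Away from the closure of the interior any vector is a limit. *)
have [G0|G0] := pselect (G set0).
  exists 0; first by split=> // A _; apply: filterS G0.
  by rewrite -(scale0r (0 : 'rV[R]_q)) enormZ normr0 mul0r mulr_ge0 // addr_ge0 // mulr_ge0.
have /choice[l lP] : forall k, exists l : R, mderive alpha (f i) y 0 k @[y --> G] --> l.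
  move=> k; have [_ /(_ w wn i x Ex) [l wl]] := gcls_dword nN (gf k); exists l.
  apply: cvg_trans wl; apply: near_eq_cvg; rewrite near_withinE.
  by near=> y => Oy; rewrite dwE.
have l_le k : `|l k| <= C k * b n i.
  rewrite leNgt; apply/negP => lt; apply: G0.
  have e0 : 0 < `|l k| - C k * b n i by rewrite subr_gt0.
  have nO : \forall y \near G, O i y by exact: near_withinT.
  apply: filterS2 nO ((cvgrPdist_lt _ _).1 (lP k) _ e0) => y Oy /=.
  rewrite dwE // => /(le_lt_trans (lerB_dist _ _)).
  have := (CP k).2 w wn i y Oy.
  move: (dword _ _ _) (l k) (C k * b n i) => u v a; lra.
exists (\row_k l k).
  split=> //; apply/(@cvg_rV R q _ G _ _ (\row_k l k)) => k.
  by rewrite mxE; exact: lP.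
apply: le_trans (enorm_le_norm _) _.
apply: (@le_trans _ _ (q%:R * (\sum_k C k * b n i))).
  apply: ler_wpM2l => //; apply/rV_norm_le.
    by apply: sumr_ge0 => k _; apply: mulr_ge0 => //; case: (CP k).
  move=> k; rewrite mxE; apply: le_trans (l_le k) _.
  rewrite (bigD1 k) //= lerDl; apply: sumr_ge0 => k' _.
  by apply: mulr_ge0 => //; case: (CP k').
by rewrite -mulr_suml mulrA /K mulrDl lerDl mul1r.
Unshelve. all: by end_near. Qed.

End Boundary_values.

(** * Uniform estimates for a family of cut triangles *)
Section Lifted_triangles.
Variables (R : realType) (G : set 'rV[R]_3) (F : 'rV[R]_3 -> R) (delta C c1 : R).
Let Om := tube G delta.
Hypotheses (C0 : 0 <= C) (c10 : 0 < c1).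
Hypothesis G0 : forall x, Om x -> F x = 0 <-> G x.
Hypothesis cF : forall x, Om x -> {for x, continuous F}.
Hypothesis dF : forall k x, Om x -> derivable F x (delta_mx 0 k).
Hypothesis F1 : forall k x, Om x -> `|partial k F x| <= C.
Hypothesis ddF : forall k l x, Om x -> derivable (partial k F) x (delta_mx 0 l).
Hypothesis F2 : forall k l x, Om x -> `|partial l (partial k F) x| <= C.
Variables (I : Type) (N : nat) (X : I -> 'M[R]_(4, 3)) (y : I -> 'rV[R]_3) (h : I -> R).
Hypothesis CF : forall k,
  cls (fun _ : I => Om) (fun _ => set0) N (fun _ _ => 1) (fun _ => partial k F).
Hypothesis h01 : forall i, 0 < h i <= 1.
Hypotheses (Gy : forall i, G (y i)) (Xy : forall i, hull (X i) (y i)).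
Hypothesis hd : forall i, 3 * h i < delta.
Hypothesis hC : forall i, 216 * C * h i <= c1.
Hypothesis diamX : forall i x z, hull (X i) x -> hull (X i) z -> `|x - z| <= h i.
Hypothesis FX : forall i j, c1 * h i <= `|F (row j (X i))|.
Hypothesis signX : forall i (j : 'I_3), F (row ord0 (X i)) * F (row (lift ord0 j) (X i)) < 0.

Let E (i : I) : set 'rV[R]_2 := @ref_triangle R.
Let O i := (E i)°.
Let x0 i := row ord0 (X i).
Let B i := cut_triangle G (X i).
Let v0 i := row 0 (B i) - x0 i.
Let h0 i : 0 < h i. Proof. by have /andP[] := h01 i. Qed.

(** Chosen on the whole plane; only its values on the triangle matter. *)
Let t i xi : R := get [set t : R |
  patch_lift G (X i) xi = x0 i + t *: (v0 i + xi *m edge_mx (B i))].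

Let lift_t i xi : E i xi ->
  patch_lift G (X i) xi = x0 i + t i xi *: (v0 i + xi *m edge_mx (B i)).
Proof.
move=> xiR; have [_ _ tP] :=
  patch_liftP C0 G0 cF dF ddF F2 (Gy i) (Xy i) (h0 i) (hd i) c10 (@diamX i) (FX i)
    (signX i) (hC i) xiR.
exact: (getPex tP).
Qed.

Let lift_near i xi : E i xi -> `|patch_lift G (X i) xi - y i| <= 3 * h i.
Proof.
move=> xiR; have [_ Xr _] :=
  patch_liftP C0 G0 cF dF ddF F2 (Gy i) (Xy i) (h0 i) (hd i) c10 (@diamX i) (FX i)
    (signX i) (hC i) xiR.
apply: le_trans (diamX Xr (Xy i)) _.
by rewrite ler_peMl ?ler1n // ltW.
Qed.

Let lift_G i xi : E i xi -> G (patch_lift G (X i) xi).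
Proof.
move=> xiR; by have [] :=
  patch_liftP C0 G0 cF dF ddF F2 (Gy i) (Xy i) (h0 i) (hd i) c10 (@diamX i) (FX i)
    (signX i) (hC i) xiR.
Qed.

Let delta0 (i : I) : 0 < delta. Proof. by apply: le_lt_trans (hd i); rewrite mulr_ge0 // ltW. Qed.

Let lift_Om i xi : E i xi -> Om (patch_lift G (X i) xi).
Proof.
by move=> xiR; exists (patch_lift G (X i) xi); [exact: lift_G|rewrite subrr normr0 (delta0 i)].
Qed.

Let t_lip i xi zeta : E i xi -> E i zeta ->
  `|t i zeta - t i xi| <= 12 * C * (6 * C / c1 + 1) / c1 * `|zeta - xi|.
Proof.
move=> xiR zR.
exact: (radial_parameter_lip C0 G0 cF dF F1 ddF F2 (Gy i) (Xy i) (h0 i) (hd i) c10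
  (@diamX i) (FX i) (signX i) (hC i) xiR zR (lift_t xiR) (lift_t zR)).
Qed.

Lemma patch_lift_cvg i x : E i x ->
  patch_lift G (X i) z @[z --> within (E i) (nbhs x)] --> patch_lift G (X i) x.
Proof.
move=> Ex; rewrite (lift_t Ex).
apply: cvg_trans (radial_cvg (x0 := x0) (v0 := v0) (A := fun i => edge_mx (B i)) t_lip Ex).
apply: near_eq_cvg; rewrite near_withinE; near=> z => Ez; exact: esym (lift_t Ez).
Unshelve. all: by end_near. Qed.

Lemma patch_lift_gcls k : gcls O E N.+1 (hweight h 2) (fun i xi => patch_lift G (X i) xi 0 k).
Proof.
have oO i : open (O i) by exact: open_interior.
have OE i : O i `<=` E i by exact: interior_subset.
have Cc : 0 <= 6 * C / c1 by rewrite divr_ge0 ?mulr_ge0 // ltW.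
(* One constant for all the bounds that the radial parameter needs. *)
pose K := 108 * C + (6 * C / c1 + 1).
have K0 : 0 <= K by rewrite addr_ge0 ?mulr_ge0 // addr_ge0.
have K1 : 1 <= K by rewrite /K addrA lerDr addr_ge0 // mulr_ge0.
have c20 : 0 < c1 / 2 by rewrite divr_gt0.
have hK i : h i <= K * h i by rewrite ler_peMl // ltW.
have rOm i xi : E i xi -> Om (x0 i + t i xi *: (v0 i + xi *m edge_mx (B i))).
  by move=> Ex; rewrite -lift_t //; exact: lift_Om.
have Fr i xi : E i xi -> F (x0 i + t i xi *: (v0 i + xi *m edge_mx (B i))) = 0.
  by move=> Ex; rewrite -lift_t //; apply/G0; [exact: lift_Om|exact: lift_G].
have oOm : open Om by exact: open_tube.
apply: (@eq_gcls _ _ _ _ _ oO _ _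
   (fun i xi => (x0 i + t i xi *: (v0 i + xi *m edge_mx (B i))) 0 k)).
  by move=> i xi /OE Ex; rewrite -lift_t.
apply: (@radial_lift_gcls _ _ _ h01 _ _ _ _ oO OE F Om N oOm dF CF
  x0 v0 (fun i => edge_mx (B i)) t rOm Fr K (c1 / 2) _ K0 c20 _ t_lip).
- move=> i xi /OE Ex.
  have tb := radial_parameter_le C0 G0 cF dF F1 ddF F2 (Gy i) (Xy i) (h0 i) (hd i) c10
    (@diamX i) (FX i) (signX i) (hC i) Ex (lift_t Ex).
  by apply: le_trans tb _; rewrite lerDr mulr_ge0.
- move=> i xi l /OE Ex; apply: le_trans (hK i).
  exact: (ray_coord_le G0 cF (Gy i) (Xy i) (h0 i) (hd i) (@diamX i) (signX i) l Ex).
- move=> i j l; apply: le_trans (hK i).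
  exact: (edge_le G0 cF (Gy i) (Xy i) (h0 i) (hd i) (@diamX i) (signX i)).
- move=> i xi /OE Ex.
  apply: (ray_slope C0 G0 cF dF ddF F2 (Gy i) (Xy i) (h0 i) (hd i)
    (@diamX i) (FX i) (signX i) (hC i) Ex) => _.
  by rewrite -lift_t //; exact: lift_near.
- move=> i xi j /OE Ex; apply: (@le_trans _ _ (108 * C * h i ^+ 2)).
    apply: (edge_slope C0 G0 cF dF ddF F2 (Gy i) (Xy i) (h0 i) (hd i)
      (@diamX i) (signX i)) => _.
    by rewrite -lift_t //; exact: lift_near.
  by rewrite ler_wpM2r ?sqr_ge0 // lerDl addr_ge0.
- by [].
Qed.

Variables (M : R) (V : I -> set 'rV[R]_2) (g : I -> 'rV[R]_2 -> 'rV[R]_3).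
Variable s : I -> 'rV[R]_2 -> 'rV[R]_2.
Hypothesis M0 : 0 < M.
Hypothesis gV : forall i, local_coordinates G N.+2 M (V i) (g i).
Hypothesis sg : forall i xi, E i xi -> V i (s i xi) /\ patch_lift G (X i) xi = g i (s i xi).

Lemma coordinates_inner : inner O E V s.
Proof.
have oO i : open (O i) by exact: open_interior.
apply: inner_within => // [i|i x Ex|i x Ex]; first exact: interior_subset.
  by have [] := sg Ex.
have [Vsx rsx] := sg Ex.
have FF : Filter (within (E i) (nbhs x)) by exact: within_filter.
apply: (chart_inv_cvg (gV i) FF Vsx (D := E i) (r := patch_lift G (X i))).
- by rewrite /within /=; apply: nearW.
- by move=> z; exact: sg.
- by rewrite -rsx; exact: patch_lift_cvg.
Qed.

Lemma coordinates_reg k : reg O E (fun i xi => s i xi 0 k).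
Proof.
have cE i (z : 'rV[R]_2) : V i z -> {for z, continuous (fun w : 'rV[R]_2 => w 0 k)}.
  by move=> _; exact: coord_continuous.
exact (reg_comp coordinates_inner cE).
Qed.

Lemma coordinates_gcls k : gcls O E N.+1 (hweight h 2) (fun i xi => s i xi 0 k).
Proof.
have oO i : open (O i) by exact: open_interior.
have oV i := chart_open (gV i).
have M4 : 0 < M ^- 4 by rewrite invr_gt0 exprn_gt0.
apply: (@chart_coordinates_gcls _ _ _ h01 _ _ _ _ oO V g N oV _ _
  (fun i => patch_lift G (X i)) s coordinates_inner _ patch_lift_gcls _ M4) => //.
- by move=> i a l z Vz; exact: chart_derivable (gV i) _ _ _ Vz.
- move=> a l; apply: (dword_cls (ltW M0)) => [i|w wN i z Vz].
    by have [_ /(_ a)[_ cl]] := chart_Ck (gV i) l; exact: Ck_le (leqnSn N) cl.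
  have := chart_dword (gV i) (w := rcons w a) l _ Vz.
  by rewrite size_rcons /= ltnS (leqW wN) /dword foldr_rcons => /(_ isT).
- by move=> i x /interior_subset Ex; have [] := sg Ex.
- move=> i z a Vz.
  apply: (@gram_det_ge R 3 (fun a l => partial a (fun w => g i w 0 l) z) M a M0) => v.
  have [_ _ _ _ /(_ z v Vz)] := gV i; congr (_ <= _ * enorm _).
  by apply/rowP => l; rewrite mxE (chart_derive (gV i)).
Qed.

Variables (J : Type) (pi : J -> I) (beta : R).
Variables (p : J -> 'rV[R]_3) (Q : J -> 'M[R]_(2, 3)).
Hypothesis beta0 : 0 < beta.
Hypothesis expand : forall i (xi : 'rV[R]_2) j,
  beta * h i * `|xi 0 j| <= enorm (xi *m edge_mx (B i)).
Hypothesis frame : forall j, cartesian_frame (B (pi j)) (p j) (Q j).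
Let K j : set 'rV[R]_2 := [set z : 'rV[R]_2 | hull (B (pi j)) (p j + z *m Q j)].

(** The function f j is s after the affine change of variables; it is kept
   abstract because the statement about sX concerns it on K only. *)
Lemma cartesian_gcls : exists f : J -> 'rV[R]_2 -> 'rV[R]_2,
  [/\ forall (j : J) z, K j z -> exists2 xi, ref_triangle xi &
        p j + z *m Q j = affine_param (B (pi j)) xi /\ f j z = s (pi j) xi,
      forall k, reg (fun j => (K j)°) K (fun j z => f j z 0 k) &
      forall k, gcls (fun j => (K j)°) K N.+1
        (fun n j => (h (pi j))^-1 ^+ n.+1 * hweight h 2 n (pi j))
        (fun j z => f j z 0 k)].
Proof.
have frameP j : exists cA : 'rV[R]_2 * 'M[R]_2,
    [/\ forall k l, `|cA.2 k l| <= (beta * h (pi j))^-1,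
    forall z, K j z <-> ref_triangle (cA.1 + z *m cA.2),
    forall z, p j + z *m Q j = affine_param (B (pi j)) (cA.1 + z *m cA.2) &
    (K j)° = (fun z => cA.1 + z *m cA.2) @^-1` (@ref_triangle R)°].
  have b0 : 0 < beta * h (pi j) by rewrite mulr_gt0.
  by have [c [A cA]] := cartesian_inverse b0 (frame j) (@expand (pi j)); exists (c, A).
have [cA cAP] := choice frameP.
have oO (i : I) : open (O i) by exact: open_interior.
have oK (j : J) : open (K j)° by exact: open_interior.
have b0 : 0 <= beta^-1 by rewrite invr_ge0 ltW.
have A_le j k l : `|(cA j).2 k l| <= beta^-1 * (h (pi j))^-1.
  by have [A1 _ _ _] := cAP j; apply: le_trans (A1 k l) _; rewrite invfM.
have OQ j z : (K j)° z -> (O \o pi) j ((cA j).1 + z *m (cA j).2).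
  by have [_ _ _ ->] := cAP j.
have EEQ j z : K j z -> (E \o pi) j ((cA j).1 + z *m (cA j).2).
  by have [_ KE _ _] := cAP j => /KE.
exists (fun j z => s (pi j) ((cA j).1 + z *m (cA j).2)); split.
- move=> j z Kz; exists ((cA j).1 + z *m (cA j).2); first exact: EEQ Kz.
  by have [_ _ pE _] := cAP j.
- move=> k; have [cs ls] := coordinates_reg k.
  apply: (reg_affine OQ EEQ (f := fun j xi => s (pi j) xi 0 k)).
  by split=> j x; [exact: cs|exact: ls].
- move=> k; have gs := gcls_reindex pi (coordinates_gcls k).
  exact: (gcls_affine oK (fun j => oO (pi j)) b0 A_le OQ EEQ gs).
Qed.

End Lifted_triangles.

(** Makes the bound on the charts positive, without loss of generality. *)
Lemma local_coordinates_le (R : realType) (G : set 'rV[R]_3) k (M M' : R) V g :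
  M <= M' -> local_coordinates G k M V g -> local_coordinates G k M' V g.
Proof.
move=> MM [oV inj gopen gM gv]; split=> // [alpha s ak Vs|s v Vs].
  exact: le_trans (gM _ _ ak Vs) MM.
by apply: le_trans (gv _ v Vs) _; rewrite ler_wpM2r // enorm_ge0.
Qed.

Lemma tube_bounds (R : realType) (m : nat) (U : set 'rV[R]_3) (F : 'rV[R]_3 -> R) :
  surface_setting m U F ->
  let Gamma := zero_set U F in
  exists delta c0 C : R, [/\ 0 < delta, 0 < c0, 0 <= C,
    forall y, Gamma y -> exists j, c0 <= `|partial j F y| &
    let Om := tube Gamma delta in
    [/\ forall x, Om x -> F x = 0 <-> Gamma x,
        forall x, Om x -> {for x, continuous F},
        forall k x, Om x ->
          derivable F x (delta_mx 0 k) /\ `|partial k F x| <= C,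
        forall k l x, Om x ->
          derivable (partial k F) x (delta_mx 0 l) /\
          `|partial l (partial k F) x| <= C &
        forall (I : Type) k, cls (fun _ : I => Om) (fun _ => set0) m
          (fun _ _ => 1) (fun _ => partial k F)]].
Proof.
move=> hF; have [delta [c0 [d0 c00 OmU gc clsU]]] := surface_tube hF.
have [_ CF _ _] := hF; have cF := clsU unit _ _ CF.
have [[C1 C10 P1] _] := cls_dword (isT : (1 <= m.+2)%N) cF.
have [[C2 C20 P2] _] := cls_dword (isT : (2 <= m.+2)%N) cF.
exists delta, c0, (C1 + C2); split=> //; first exact: addr_ge0.
have [cFc dF] := CF; split.
- by move=> x Ox; split=> [Fx|[]//]; split=> //; exact: OmU.
- by move=> x /OmU; exact: cFc.
- move=> k x Ox; split; first by apply: (dF k).1; exact: OmU.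
  have := P1 [:: k] erefl tt x Ox; rewrite mulr1 => /le_trans; apply.
  by rewrite lerDl.
- move=> k l x Ox; split.
    by have [_ [_ /(_ l)[d _]]] := dF k; apply: d; exact: OmU.
  have := P2 [:: l; k] erefl tt x Ox; rewrite mulr1 => /le_trans; apply.
  by rewrite lerDr.
- move=> I k; apply: clsU; have [_ c] := dF k; exact: Ck_le (leqnSn m) c.
Qed.

Lemma signed_dist_le (R : realType) (U : set 'rV[R]_3) F (x z : 'rV[R]_3) :
  zero_set U F z -> `|signed_dist U F x| <= enorm (x - z).
Proof.
move=> Gz; have d0 := dist_ge0 (zero_set U F) x.
have -> : `|signed_dist U F x| = dist (zero_set U F) x; last exact: dist_le.
rewrite /signed_dist /=; case: (F x < 0) => /=; first rewrite normrN.
  exact: ger0_norm.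
exact: ger0_norm.
Qed.

(** For h small the admissible cut tetrahedra satisfy all the hypotheses of
   the estimates above with constants independent of the tetrahedron. The cut
   points are at distance at least eta h from x0 along edges of length at most
   h, so tau >= eta, which keeps the cut triangle from degenerating. *)
Lemma cut_geometry (R : realType) (U : set 'rV[R]_3)
    (F : 'rV[R]_3 -> R) (Fam : set (seq 'M[R]_(4, 3))) (delta c0 C : R) :
  let Gamma := zero_set U F in let Om := tube Gamma delta in
  0 < delta -> 0 < c0 -> 0 <= C ->
  (forall y, Gamma y -> exists j, c0 <= `|partial j F y|) ->
  (forall x, Om x -> F x = 0 <-> Gamma x) ->
  (forall x, Om x -> {for x, continuous F}) ->
  (forall k x, Om x -> derivable F x (delta_mx 0 k)) ->
  (forall k l x, Om x -> derivable (partial k F) x (delta_mx 0 l)) ->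
  (forall k l x, Om x -> `|partial l (partial k F) x| <= C) ->
  admissible_family U F Fam ->
  exists c1 beta h0 : R, [/\ 0 < c1, 0 < beta, 0 < h0 &
  forall Th T (sigma : 'S_4),
  let h := mesh_size Th in let X := row_perm sigma T in
  Fam Th -> h < h0 -> T \in Th -> three_edge_cut U F X ->
  [/\ 0 < h <= 1, 3 * h < delta, 216 * C * h <= c1,
      exists y, Gamma y /\ hull X y &
  [/\ forall x z, hull X x -> hull X z -> `|x - z| <= h,
      forall i, c1 * h <= `|F (row i X)|,
      forall i : 'I_3, F (row ord0 X) * F (row (lift ord0 i) X) < 0 &
      forall (xi : 'rV[R]_2) j,
        beta * h * `|xi 0 j| <= enorm (xi *m edge_mx (cut_triangle Gamma X))]]].
Proof.
move=> Gamma Om delta0 c00 C0 gc G0 cF dF ddF F2 [meshP [h1 [kappa [eta [c [h10 eta0 admP]]]]]].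
(* The sup norm is smaller than the Euclidean one by a factor up to 3. *)
pose eta' := Num.min (eta / 3) 1.
have eta'0 : 0 < eta' by rewrite lt_min divr_gt0 //= ltr01.
have eta'1 : eta' <= 1 by rewrite ge_min lexx orbT.
have eta'3 : eta' <= eta / 3 by rewrite ge_min lexx.
pose c1 := c0 * eta' / 4.
have c10 : 0 < c1 by rewrite divr_gt0 // mulr_gt0.
(* The inscribed ball has radius at least eta h / (4 kappa), by which the
   smallest tau is multiplied. The absolute value and the 1 keep beta positive
   whatever kappa is. *)
pose beta := eta / (4 * (`|kappa| + 1)) * eta.
have k10 : 0 < `|kappa| + 1 by rewrite ltr_wpDl.
have beta0 : 0 < beta by rewrite mulr_gt0 // divr_gt0 // mulr_gt0.
pose h0 := Num.min h1 (Num.min 1 (Num.min (delta / 3)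
  (Num.min (c0 / (18 * C + 1)) (c1 / (216 * C + 1))))).
have C18 : 0 < 18 * C + 1 by rewrite ltr_wpDl //; exact: mulr_ge0 (ler0n _ _) C0.
have C216 : 0 < 216 * C + 1 by rewrite ltr_wpDl //; exact: mulr_ge0 (ler0n _ _) C0.
have h00 : 0 < h0 by rewrite /h0 !lt_min h10 ltr01 /=; apply/and3P; split; exact: divr_gt0.
exists c1, beta, h0; split=> // Th T sigma h X FTh hh0 TTh [[y [Gy Xy]] signX].
move: hh0; rewrite /h0 !lt_min => /and5P[hh1 hle1 hdelta h18 h216].
have XT : hull X = hull T by exact: hull_row_perm.
have hull_h x z : hull X x -> hull X z -> enorm (x - z) <= h.
  rewrite XT => Tx Tz; apply: le_trans (hull_diam Tx Tz) _; exact: mesh_size_ge.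
have diamX x z : hull X x -> hull X z -> `|x - z| <= h.
  by move=> Xx Xz; apply: le_trans (norm_le_enorm _) _; exact: hull_h.
(* The values of F at the two ends of a cut edge have opposite signs, so the
   ends differ. *)
have hpos : 0 < h.
  have := diamX _ _ (row_hull X ord0) (row_hull X (lift ord0 ord0)).
  apply: lt_le_trans; rewrite normr_gt0 subr_eq0; apply/eqP => e01.
  have := signX ord0; rewrite -e01 -expr2 => /(le_lt_trans (sqr_ge0 _)).
  by rewrite ltxx.
have hd : 3 * h < delta by move: hdelta; rewrite ltr_pdivlMr // mulrC.
have hc18 : 18 * C * h <= c0.
  move: h18; rewrite ltr_pdivlMr // mulrC mulrDl mul1r => /ltW; apply: le_trans.
  by rewrite lerDl ltW.
have hc216 : 216 * C * h <= c1.
  move: h216; rewrite ltr_pdivlMr // mulrC mulrDl mul1r => /ltW; apply: le_trans.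
  by rewrite lerDl ltW.
have [shapeT _ distT _] := admP Th FTh hh1.
have cutT : is_cut Gamma T by exists y; split=> //; rewrite -XT.
have far i z : Gamma z -> eta * h <= enorm (row i X - z).
  move=> Gz; have -> : row i X = row (sigma i) T by apply/rowP => k; rewrite !mxE.
  by apply: le_trans (distT T _ TTh cutT) _; exact: signed_dist_le.
have FX i : c1 * h <= `|F (row i X)|.
  apply: (level_ge_dist C0 G0 cF dF ddF F2 Gy hpos hd) => //; first exact: gc.
    by apply: diamX => //; exact: row_hull.
  move=> z Gz; apply: (@le_trans _ _ (eta / 3 * h)); first by rewrite ler_pM2r.
  rewrite mulrAC ler_pdivrMr // (le_trans (far i z Gz)) // mulrC.
  exact: enorm_le_norm.
split=> //; [by rewrite hpos ltW|by exists y|split=> // xi j].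
have cutP := cut_pointP G0 cF Gy Xy hpos hd diamX signX.
have /choice[tau tauP] : forall i, exists tau, 0 < tau <= 1 /\
    cut_point Gamma X i = row ord0 X + tau *: (row (lift ord0 i) X - row ord0 X).
  by move=> i; have [_ [t t01 tE]] := cutP i; exists t.
have eta_tau i : eta <= tau i.
  have [/andP[t0 t1] tE] := tauP i; rewrite -(ler_pM2r hpos).
  apply: le_trans (far ord0 _ (cutP i).1) _; rewrite tE opprD addrA subrr add0r.
  rewrite -scaleNr enormZ normrN gtr0_norm // ler_pM2l //.
  by apply: hull_h; exact: row_hull.
have etah : eta * h <= diam (hull T).
  have [_ tE] := tauP ord0; apply: le_trans (far ord0 _ (cutP ord0).1) _.
  rewrite tE opprD addrA subrr add0r -scaleNr enormZ normrN.
  have [/andP[t0 t1] _] := tauP ord0; rewrite gtr0_norm //.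
  apply: le_trans (_ : enorm (row (lift ord0 ord0) X - row ord0 X) <= _).
    by rewrite ler_piMl ?enorm_ge0.
  by apply: hull_diam; rewrite -XT; exact: row_hull.
have [kappa0 [rho [ctr [rho0 rho_ge ballT]]]] :=
  inball_large (mulr_gt0 eta0 hpos) etah (shapeT T TTh).
have nT : Defs.nondegenerate T by have [+ _ _] := meshP Th FTh; exact.
apply: le_trans (_ : rho * eta * `|xi 0 j| <= _); last first.
  by apply: (edge_mx_expand xi j nT rho0 ballT eta0 eta_tau) => i; rewrite rowK (tauP i).2.
rewrite ler_wpM2r // /beta mulrAC ler_pM2r //; apply: le_trans rho_ge.
rewrite mulrAC ler_pM2l ?mulr_gt0 // lef_pV2 ?posrE ?mulr_gt0 //.
by rewrite ler_pM2l // (gtr0_norm kappa0) lerDl.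
Qed.

(** The weight of grade 2 at order n - 1 is that of the derivatives of s of
   order n. *)
Lemma uphalf_shift n : (0 < n)%N -> uphalf (2 + n.-1) = n./2.+1.
Proof. by lia. Qed.

Lemma uphalf_half_pred n : (0 < n)%N -> (uphalf (2 + n.-1) + n.-1./2 = n)%N.
Proof. by lia. Qed.

(** The index type of the family of all configurations with the same
   constants. *)
Record cut_patch (R : realType) (U : set 'rV[R]_3) (F : 'rV[R]_3 -> R)
    (Fam : set (seq 'M[R]_(4, 3))) (k : nat) (h0 M : R) := CutPatch {
  patch_mesh : seq 'M[R]_(4, 3);
  patch_tetra : 'M[R]_(4, 3);
  patch_perm : 'S_4;
  patch_dom : set 'rV[R]_2;
  patch_chart : 'rV[R]_2 -> 'rV[R]_3;
  patch_coord : 'rV[R]_2 -> 'rV[R]_2;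
  patch_cut : [/\ Fam patch_mesh, mesh_size patch_mesh < h0,
    patch_tetra \in patch_mesh &
    three_edge_cut U F (row_perm patch_perm patch_tetra)];
  patch_local : local_coordinates (zero_set U F) k M patch_dom patch_chart;
  patch_coordP : forall xi, @ref_triangle R xi -> patch_dom (patch_coord xi) /\
    patch_lift (zero_set U F) (row_perm patch_perm patch_tetra) xi =
    patch_chart (patch_coord xi) }.

Record framed_patch (R : realType) (U : set 'rV[R]_3) (F : 'rV[R]_3 -> R)
    (Fam : set (seq 'M[R]_(4, 3))) (k : nat) (h0 M : R) := FramedPatch {
  framed_cut : cut_patch U F Fam k h0 M;
  frame_point : 'rV[R]_3;
  frame_mx : 'M[R]_(2, 3);
  frameP : cartesian_frame (cut_triangle (zero_set U F)
     (row_perm (patch_perm framed_cut) (patch_tetra framed_cut))) frame_point frame_mx }.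

Theorem theorem4p4 (R : realType) (m : nat) (U : set 'rV[R]_3)
    (F : 'rV[R]_3 -> R) (Fam : set (seq 'M[R]_(4, 3)))
    (hF : surface_setting m U F) (hFam : admissible_family U F Fam) :
  exists2 h0 : R, 0 < h0 &
  forall (M : R) (n : nat), (1 <= n <= m)%N ->
  exists2 C : R, 0 < C &
  forall (Th : seq 'M[R]_(4, 3)) (T : 'M[R]_(4, 3)) (sigma : 'S_4)
    (V : set 'rV[R]_2) (g : 'rV[R]_2 -> 'rV[R]_3) (s : 'rV[R]_2 -> 'rV[R]_2),
  let h := mesh_size Th in
  let Gamma := zero_set U F in
  let X := row_perm sigma T in
  let B := cut_triangle Gamma X in
  Fam Th -> h < h0 -> T \in Th -> three_edge_cut U F X ->
  local_coordinates Gamma m.+2 M V g ->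
  (forall xi, @ref_triangle R xi ->
     V (s xi) /\ patch_lift Gamma X xi = g (s xi)) ->
  (forall (alpha : 'I_2 -> nat) xi, mlen alpha = n -> @ref_triangle R xi ->
     exists2 l, has_mderive (@ref_triangle R) alpha s xi l &
                enorm l <= C * h ^+ (n./2).+1) /\
  (forall sX : 'rV[R]_3 -> 'rV[R]_2,
     (forall xi, @ref_triangle R xi -> sX (affine_param B xi) = s xi) ->
   forall (p : 'rV[R]_3) (Q : 'M[R]_(2, 3)), cartesian_frame B p Q ->
   let K := [set y : 'rV[R]_2 | hull B (p + y *m Q)] in
   forall (alpha : 'I_2 -> nat) y, mlen alpha = n -> K y ->
     exists2 l, has_mderive K alpha (fun y => sX (p + y *m Q)) y l &
                enorm l <= C * h ^- (n.-1)./2).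
Proof.
have [delta [c0 [C0 [delta0 c00 C00 gc [G0 cF F1 F2 CF]]]]] := tube_bounds hF.
have dF k x Ox := (F1 k x Ox).1; have dF1 k x Ox := (F1 k x Ox).2.
have ddF k l x Ox := (F2 k l x Ox).1; have dF2 k l x Ox := (F2 k l x Ox).2.
have [c1 [beta [h0 [c10 beta0 h00 geo]]]] :=
  cut_geometry delta0 c00 C00 gc G0 cF dF ddF dF2 hFam.
exists h0 => // M n /andP[n0 nm].
pose M' := Num.max M 1; have M'0 : 0 < M' by rewrite lt_max ltr01 orbT.
have MM' : M <= M' by rewrite le_max lexx.
pose I := cut_patch U F Fam m.+2 h0 M'.
pose X (i : I) := row_perm (patch_perm i) (patch_tetra i).
pose h (i : I) := mesh_size (patch_mesh i).
have geoI (i : I) := let: And4 a b c d := patch_cut i in geo _ _ (patch_perm i) a b c d.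
have yP (i : I) : exists y, zero_set U F y /\ hull (X i) y by have [] := geoI i.
have [y yGX] := choice yP.
have h01 i : 0 < h i <= 1 by have [] := geoI i.
have hd i : 3 * h i < delta by have [] := geoI i.
have hC i : 216 * C0 * h i <= c1 by have [] := geoI i.
have diamX i : forall x z, hull (X i) x -> hull (X i) z -> `|x - z| <= h i.
  by have [_ _ _ _ []] := geoI i.
have FX i : forall j, c1 * h i <= `|F (row j (X i))| by have [_ _ _ _ []] := geoI i.
have signX i : forall j : 'I_3, F (row ord0 (X i)) * F (row (lift ord0 j) (X i)) < 0.
  by have [_ _ _ _ []] := geoI i.
have expand i : forall (xi : 'rV[R]_2) j, beta * h i * `|xi 0 j| <=
    enorm (xi *m edge_mx (cut_triangle (zero_set U F) (X i))).
  by have [_ _ _ _ []] := geoI i.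
have Gy i := (yGX i).1; have Xy i := (yGX i).2.
have sV (i : I) := @patch_local _ _ _ _ _ _ _ i.
have sg (i : I) := @patch_coordP _ _ _ _ _ _ _ i.
have nN : (n.-1 < m.+1)%N by rewrite ltnS (leq_trans (leq_pred n)).
have hge0 i : 0 <= h i by have /andP[/ltW] := h01 i.
have sreg := coordinates_reg C00 c10 G0 cF dF dF1 ddF dF2 h01 Gy Xy hd hC diamX FX signX sV sg.
have sgcls := coordinates_gcls C00 c10 G0 cF dF dF1 ddF dF2 (CF I) h01 Gy Xy hd hC diamX FX
  signX M'0 sV sg.
have hw0 k i : 0 <= hweight h 2 k i by exact: exprn_ge0.
have [C1 C10 P1] := has_mderive_of_gcls hw0 sreg sgcls nN.
pose J := framed_patch U F Fam m.+2 h0 M'.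
have frameJ (j : J) := frameP j.
have [f [fE freg fgcls]] := cartesian_gcls C00 c10 G0 cF dF dF1 ddF dF2 (CF I) h01 Gy Xy hd hC
  diamX FX signX M'0 sV sg beta0 expand frameJ.
have hw1 k (j : J) : 0 <= (h (framed_cut j))^-1 ^+ k.+1 * hweight h 2 k (framed_cut j).
  by rewrite mulr_ge0 ?exprn_ge0 ?invr_ge0.
have [C2 C20 P2] := has_mderive_of_gcls hw1 freg fgcls nN.
exists (C1 + C2); first exact: addr_gt0.
move=> Th T sigma V g s hT Gamma XT B FTh hTh TTh cut gV sP.
pose i : I := CutPatch (And4 FTh hTh TTh cut) (local_coordinates_le MM' gV) sP.
have hT0 : 0 < hT by have /andP[] := h01 i.
split=> [alpha xi an xiR|sX sXE p Q fr K alpha z an Kz].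
  have an' : mlen alpha = n.-1.+1 by rewrite prednK.
  have [l lP l_le] := P1 i alpha xi an' xiR; exists l => //.
  apply: le_trans l_le _.
  have -> : hweight h 2 n.-1 i = hT ^+ (n./2).+1 by rewrite /hweight uphalf_shift.
  by rewrite ler_wpM2r ?exprn_ge0 ?(ltW hT0) // lerDl ltW.
(* In the Cartesian frame, sX is s after the affine change of variables. *)
pose j : J := @FramedPatch _ _ _ _ _ _ _ i p Q fr.
have an' : mlen alpha = n.-1.+1 by rewrite prednK.
have [l lP l_le] := P2 j alpha z an' Kz; exists l.
  apply: eq_has_mderive lP => w Kw; have [xi xiR [-> ->]] := fE j w Kw.
  by rewrite sXE.
apply: le_trans l_le _.
have -> : (h i)^-1 ^+ n.-1.+1 * hweight h 2 n.-1 i = hT ^- (n.-1)./2.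
  have hN0 : hT != 0 by rewrite gt_eqF.
  rewrite /hweight exprVn; apply: (mulIf (expf_neq0 (n.-1./2) hN0)).
  rewrite mulVf ?expf_neq0 // -mulrA -exprD.
  by rewrite uphalf_half_pred // prednK // mulVf ?expf_neq0.
by rewrite ler_wpM2r ?invr_ge0 ?exprn_ge0 ?(ltW hT0) // lerDr ltW.
Qed.
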